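(* Let $L>0$ and let $\phi(x)=\sum_{n=-\infty}^{\infty}\phi_n e^{i\frac{2\pi}{L}nx}\in H$ with $\phi_{-n}=\overline{\phi_n}$ for all $n\in\mathbb{Z}$. Assume that $$\sum_{n\in\mathbb{Z},\,n\neq 0} n^2|\phi_n|^2<\frac{1}{72}\qquad\text{and}\qquad \int_0^L\left(\phi(x)-3\phi^2(x)\right)dx=0,$$ where $\phi_0$ is given by the plus root of the latter constraint, i.e. $$\phi_0=\frac16\left(1+\sqrt{1-36\sum_{n\in\mathbb{Z},\,n\ne 0}|\phi_n|^2}\right).$$ Then the problem $$u_{tx}=u-3u^2,\qquad u(0,t)=u(L,t)\ (t\ge 0),\qquad u(x,0)=\phi(x)\ (x\in\mathbb{R})$$ has one and only one solution, in the generalized sense defined in the context. For all $t\ge 0$, the Fourier series $$u(x,t)=\sum_{n=-\infty}^{\infty}u_n(t)e^{i\frac{2\pi}{L}nx}$$ converges uniformly in $x$. Its sum is differentiable in $x$. The derivative satisfies the conditions $u_x(\cdot,t)\in L_2([0,L],\mathbb{R})$ and $u_x(x,\cdot)\in C([0,\infty),\mathbb{R})$. Moreover, $u_x$ is differentiable in $t$ and the equation $u_{tx}=u-3u^2$ holds.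
   Context: $H$ denotes the space of complex sequences $v=\{v_n\}_{n\in\mathbb{Z}}$ with the norm $$|v|=\left(|v_0|^2+\sum_{n\in\mathbb{Z},\,n\neq0}n^2|v_n|^2\right)^{1/2}.$$ The space of $L$-periodic functions whose sequence of Fourier coefficients (with respect to $e^{i\frac{2\pi}{L}nx}$) belongs to $H$ is also denoted by $H$. Generalized solution: a function $u\in C([0,\infty),H)$, $$t\mapsto u(t)=\sum_{n=-\infty}^{\infty}u_n(t)e^{i\frac{2\pi}{L}nx},\qquad u_{-n}=\overline{u_n},$$ is called a solution of the problem if $\dot u\in L_\infty([0,\infty),H)$ (where $\dot u=\{\dot u_n\}_{n\in\mathbb{Z}}$ is the derivative in $t$), if $u_n(0)=\phi_n$ for all $n\in\mathbb{Z}$, and if the Fourier coefficients satisfy $$u_0(t)=\frac16\left(1+\sqrt{1-36\sum_{n\in\mathbb{Z},\,n\neq0}|u_n(t)|^2}\right)$$ and $$u_n(t)=\phi_n-\frac{iL}{2\pi n}\int_0^t\left(u_n(s)-3\sum_{\alpha+\beta=n,\ \alpha,\beta\in\mathbb{Z}}u_\alpha(s)u_\beta(s)\right)ds,\qquad n\neq0.$$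
   Formalization: Differentiability of u in x, continuity and differentiability of u_x in t, and u_tx = u - 3u^2 hold for almost every x (one null set for all t ≥ 0); at every x this fails, e.g. at t = 0 for φ a constant plus a small triangle wave. *)

(* Defs.v *)
From HB Require Import structures.
From mathcomp Require Import all_boot all_order all_algebra.
From mathcomp Require Import all_classical all_reals all_analysis.
From mathcomp Require Export complex.

Set Implicit Arguments.
Unset Strict Implicit.
Unset Printing Implicit Defensive.

Import Order.TTheory GRing.Theory Num.Theory numFieldNormedType.Exports.

Local Open Scope classical_set_scope.
Local Open Scope complex_scope.
Local Open Scope ring_scope.

(* Limits of complex sequences are taken in R[i]^o, the copy of R[i] that
   carries the topology of the modulus. *)

Definition bilateral_sum (R : realType) (f : int -> R[i]) (N : nat) : R[i]^o :=
  \sum_(k < N.*2.+1) f (k%:Z - N%:Z).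

Definition sumsq_osc (R : realType) (v : int -> R[i]) : \bar R :=
  \esum_(n in [set n : int | n != 0]) ((ComplexField.Normc.normc (v n) ^+ 2)%:E).

Definition sumsq_deriv (R : realType) (v : int -> R[i]) : \bar R :=
  \esum_(n in [set n : int | n != 0])
    ((n%:~R ^+ 2 * ComplexField.Normc.normc (v n) ^+ 2)%:E).

Definition Hnormsq (R : realType) (v : int -> R[i]) : \bar R :=
  ((ComplexField.Normc.normc (v 0) ^+ 2)%:E + sumsq_deriv v)%E.

Definition inH (R : realType) (v : int -> R[i]) : Prop := (Hnormsq v < +oo)%E.

(* the norm of H; meaningful only under inH *)
Definition Hnorm (R : realType) (v : int -> R[i]) : R :=
  Num.sqrt (fine (Hnormsq v)).

Definition conj_symmetric (R : realType) (v : int -> R[i]) : Prop :=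
  forall n : int, v (- n) = conjc (v n).

(* The inequality says that the real square root is genuine: Num.sqrt is 0 on
   negative numbers. *)
Definition plus_root (R : realType) (v : int -> R[i]) : Prop :=
  (sumsq_osc v <= (36^-1)%:E)%E /\
  v 0 = (6^-1 * (1 + Num.sqrt (1 - 36 * fine (sumsq_osc v))))%:C.

(* sum over a + b = n of v_a v_b; absolutely convergent for v in H *)
Definition autoconv (R : realType) (v : int -> R[i]) (n : int) : R[i] :=
  limn (bilateral_sum (fun a => v a * v (n - a))).

Definition fourier_mode (R : realType) (L : R) (n : int) (x : R) : R[i] :=
  let theta := 2 * pi / L * n%:~R * x in cos theta +i* sin theta.

Definition fourier_partial (R : realType) (L : R) (v : int -> R[i]) (N : nat)
    (x : R) : R[i]^o :=
  bilateral_sum (fun n => v n * fourier_mode L n x) N.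

(* The sum of the Fourier series as a real function: for conj_symmetric v the
   imaginary part of the limit vanishes. *)
Definition fourier_sum (R : realType) (L : R) (v : int -> R[i]) (x : R) : R :=
  complex.Re (limn (fun N => fourier_partial L v N x)).

Definition cintegral (R : realType) (a b : R) (f : R -> R[i]) : R[i] :=
  (\int[lebesgue_measure]_(s in `[a, b]) complex.Re (f s)) +i*
  (\int[lebesgue_measure]_(s in `[a, b]) complex.Im (f s)).

(* u in C([0,oo), H); values of u at negative times are irrelevant *)
Definition continuous_in_H (R : realType) (u : R -> int -> R[i]) : Prop :=
  (forall t : R, 0 <= t -> inH (u t)) /\
  forall t : R, 0 <= t ->
    Hnorm (fun n => u s n - u t n) @[s --> within `[0, +oo[ (nbhs t)] --> (0 : R).

(* g in L_oo([0,oo), H).  As H is separable and the coordinates generate its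
   Borel sets, measurability of g is measurability of the coordinates. *)
Definition Linfty_in_H (R : realType) (g : R -> int -> R[i]) : Prop :=
  (forall n, measurable_fun (`[0, +oo[ : set R) (fun t => complex.Re (g t n)) /\
             measurable_fun (`[0, +oo[ : set R) (fun t => complex.Im (g t n))) /\
  exists M : R, {ae lebesgue_measure, forall t : R,
    0 <= t -> inH (g t) /\ Hnorm (g t) <= M}.

(* g is the coordinatewise derivative of u in t.  The integral identity excludes
   singular functions, which have an almost everywhere derivative that is not
   their derivative as elements of a function space. *)
Definition time_derivative (R : realType) (u g : R -> int -> R[i]) : Prop :=
  {ae lebesgue_measure, forall t : R, 0 < t -> forall n,
     is_derive t 1 (fun s => complex.Re (u s n)) (complex.Re (g t n)) /\
     is_derive t 1 (fun s => complex.Im (u s n)) (complex.Im (g t n))} /\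
  forall (n : int) (t : R), 0 <= t -> u t n = u 0 n + cintegral 0 t (fun s => g s n).

Record generalized_solution (R : realType) (L : R) (phi : int -> R[i])
    (u : R -> int -> R[i]) : Prop := GeneralizedSolution {
  gsol_continuous : continuous_in_H u;
  gsol_conj_symmetric : forall t : R, 0 <= t -> conj_symmetric (u t);
  gsol_derivative : exists g, time_derivative u g /\ Linfty_in_H g;
  gsol_initial : forall n, u 0 n = phi n;
  gsol_mean : forall t : R, 0 <= t -> plus_root (u t);
  gsol_modes : forall (t : R) (n : int), 0 <= t -> n != 0 ->
    u t n = phi n - 'i%C * (L / (2 * pi * n%:~R))%:C *
      cintegral 0 t (fun s => u s n - 3 * autoconv (u s) n)
}.

Definition square_integrable (R : realType) (D : set R) (f : R -> R) : Prop :=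
  measurable_fun D f /\
  (\int[lebesgue_measure]_(x in D) ((f x ^+ 2)%:E) < +oo)%E.

(* f'(t) = l for f on [0,oo); one-sided at t = 0 *)
Definition half_line_derivative (R : realType) (f : R -> R) (t l : R) : Prop :=
  (f s - f t) / (s - t) @[s --> within `[0, +oo[ t^'] --> l.

(* Main.v *)
Require Import Defs.
From HB Require Import structures.
From mathcomp Require Import all_boot all_order all_algebra.
From mathcomp Require Import all_classical all_reals all_analysis.
From mathcomp Require Import measurable_realfun ring lra zify.
Import Order.TTheory GRing.Theory Num.Theory numFieldNormedType.Exports.
Local Open Scope classical_set_scope.
Local Open Scope complex_scope.
Local Open Scope ring_scope.
Set Implicit Arguments.
Unset Strict Implicit.
Unset Printing Implicit Defensive.

(** The equation says that each oscillating mode moves along a vector field on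
    sequences, and that the mean mode is a function of the others: with [kap L
    n = - i L / (2 pi n)], the multiplier of the primitive in [x], [u_n' = kap
    L n * (u - 3 u^2)_n] for [n <> 0], while [u_0] is the plus root of the
    constraint.

    The space l1 of absolutely summable coefficients is an algebra under
    convolution, and it contains H because [|v_n|] is at most a multiple of [1
    / n^2 + n^2 |v_n|^2] ([h1_l1]). On l1 the vector field is locally
    Lipschitz once the square root is cut off near zero. Clipping its argument
    to a ball makes it globally Lipschitz and bounded, so Picard iteration in
    a norm with exponential weight in time gives a global solution, unique
    among Lipschitz curves ([picard_exists], [duhamel_unique]). The clipping
    has to be shown inactive. This rests on a conservation law: [\sum_n n^2
    |u_n|^2] is up to a factor the integral of [u_x^2] over a period, so up to
    the same factor its time derivative is the integral of the exact
    derivative [2 u_x (u - 3 u^2)], which vanishes ([cubic_cancel],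
    [energy_conserved]). The bound [1/72] is therefore preserved; it keeps the
    curve inside the ball of clipping and the discriminant of the constraint
    at least [1/2] ([flow_exists]).

    The curve so obtained is Lipschitz in H, and its mean mode is
    differentiable as a smooth function of [\sum_{n <> 0} |u_n|^2], so it is a
    generalized solution ([flow_generalized]). Conversely a generalized
    solution has an essentially bounded derivative in H, hence is Lipschitz in
    l1, hence obeys the same conservation law and is the flow
    ([generalized_flow]).

    In physical space, integrate the equation in time: [u(., t)] is [phi] plus
    a constant plus a series with coefficients [kap L n * f_n(t)], where
    [f_n(t) = \int_0^t (u - 3 u^2)_n] is absolutely summable. The last series
    can be differentiated term by term in [x] at every point
    ([is_derive_smoothed]), and its derivative is differentiable in [t] with
    derivative [u - 3 u^2]. So the only exceptional points are those at which
    [phi] itself is not differentiable, and they do not depend on [t]. That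
    [phi] is differentiable almost everywhere with derivative in L2 is
    obtained from its Fourier series: the derivatives of well chosen partial
    sums converge fast in L2, hence almost everywhere and in L1, so [phi] is
    an indefinite integral, and Lebesgue's differentiation theorem applies
    ([fourier_sum_ae_derive]). *)

(** * Symmetric sums over the integers *)

(** [bilateral_sum] with values in an arbitrary monoid, so that the same sums
    can be formed of norms; at [R[i]] the two are convertible. *)
Definition bsum (V : nmodType) (f : int -> V) (N : nat) : V :=
  \sum_(k < N.*2.+1) f (k%:Z - N%:Z).

Lemma bsum0 (V : nmodType) (f : int -> V) : bsum f 0 = f 0.
Proof. by rewrite /bsum big_ord_recl big_ord0 addr0. Qed.

Lemma bsumS (V : nmodType) (f : int -> V) N :
  bsum f N.+1 = bsum f N + (f N.+1%:Z + f (- N.+1%:Z)).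
Proof.
rewrite /bsum doubleS big_ord_recl big_ord_recr /=.
rewrite addrC -addrA; congr (_ + (_ + _)).
- by apply: eq_bigr => i _; congr f; rewrite /bump /=; lia.
- by congr f; rewrite /bump /=; lia.
- by congr f; lia.
Qed.

Lemma bsum_eq (V : nmodType) (f g : int -> V) N :
  (forall n, (`|n| <= N)%N -> f n = g n) -> bsum f N = bsum g N.
Proof.
move=> fg; apply: eq_bigr => k _; apply: fg; have := ltn_ord k; lia.
Qed.

Lemma bsumD (V : nmodType) (f g : int -> V) N :
  bsum (fun n => f n + g n) N = bsum f N + bsum g N.
Proof. exact: big_split. Qed.

Lemma bsumN (V : zmodType) (f : int -> V) N :
  bsum (fun n => - f n) N = - bsum f N.
Proof. exact: sumrN. Qed.

Lemma bsumB (V : zmodType) (f g : int -> V) N :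
  bsum (fun n => f n - g n) N = bsum f N - bsum g N.
Proof. by rewrite bsumD bsumN. Qed.

Lemma bsumZ (V : pzRingType) (a : V) (f : int -> V) N :
  bsum (fun n => a * f n) N = a * bsum f N.
Proof. by rewrite /bsum mulr_sumr. Qed.

Lemma bsum_opp (V : nmodType) (f : int -> V) N :
  bsum (fun n => f (- n)) N = bsum f N.
Proof.
by elim: N => [|N IH]; rewrite ?bsum0 ?oppr0// !bsumS IH opprK (addrC (f (- _))).
Qed.

Lemma bsum_exchange (V : nmodType) (F : int -> int -> V) N M :
  bsum (fun n => bsum (F n) M) N = bsum (fun a => bsum (F^~ a) N) M.
Proof. exact: exchange_big. Qed.

Lemma bsum_shift1 (V : zmodType) (f : int -> V) N :
  bsum (fun n => f (n + 1)) N = bsum f N + f N.+1%:Z - f (- N%:Z).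
Proof.
elim: N => [|N IH]; first by rewrite !bsum0 oppr0 addrAC subrr !add0r.
rewrite bsumS IH bsumS.
have -> : (N.+1%:Z + 1 = N.+2%:Z)%R by lia.
have -> : (- N.+1%:Z + 1 = - N%:Z)%R by lia.
by rewrite (addrC (f N.+2%:Z)) addrA subrK addrA [RHS]addrAC addrK.
Qed.

Lemma eq_ler (R : numDomainType) (x y : R) : x = y -> x <= y.
Proof. by move=> ->. Qed.

Lemma bsum_le (R : numDomainType) (f g : int -> R) N :
  (forall n, (`|n| <= N)%N -> f n <= g n) -> bsum f N <= bsum g N.
Proof.
move=> fg; apply: ler_sum => k _; apply: fg; have := ltn_ord k; lia.
Qed.

Lemma bsum_ge0 (R : numDomainType) (f : int -> R) N :
  (forall n, 0 <= f n) -> 0 <= bsum f N.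
Proof. by move=> f0; apply: sumr_ge0. Qed.

Lemma bsum_mono (R : numDomainType) (f : int -> R) N M :
  (forall n, 0 <= f n) -> (N <= M)%N -> bsum f N <= bsum f M.
Proof.
move=> f0 /subnKC <-; elim: (M - N)%N => [|k IH]; first by rewrite addn0.
by rewrite addnS bsumS (le_trans IH)// lerDl addr_ge0.
Qed.

Lemma bsum_ge_term (R : numDomainType) (f : int -> R) N n :
  (forall n, 0 <= f n) -> (`|n| <= N)%N -> f n <= bsum f N.
Proof.
move=> f0; elim: N => [|N IH] nN; first by rewrite (_ : n = 0) ?bsum0//; lia.
rewrite bsumS; case: (leqP `|n| N) => nN'.
  by rewrite (le_trans (IH nN'))// lerDl addr_ge0.
have [->|->] : n = N.+1%:Z \/ n = - N.+1%:Z by lia.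
  by rewrite addrCA lerDl addr_ge0// bsum_ge0.
by rewrite addrA lerDr addr_ge0// bsum_ge0.
Qed.

(** A shift by one moves each window into the next larger one, where the sum is
    still bounded by [B]; induction on the shift. *)
Lemma bsum_shift_le (R : numDomainType) (f : int -> R) (B : R) m :
  (forall n, 0 <= f n) -> (forall N, bsum f N <= B) ->
  forall N, bsum (fun n => f (n + m)) N <= B.
Proof.
move=> f0 fB.
have up (g : int -> R) : (forall n, 0 <= g n) -> (forall N, bsum g N <= B) ->
    forall N, bsum (fun n => g (n + 1)) N <= B.
  move=> g0 gB N; rewrite bsum_shift1 (le_trans _ (gB N.+1))//.
  rewrite bsumS -addrA lerD2l lerD2l.
  by rewrite (le_trans _ (g0 _))// oppr_le0.
have down (g : int -> R) : (forall n, 0 <= g n) -> (forall N, bsum g N <= B) ->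
    forall N, bsum (fun n => g (n - 1)) N <= B.
  move=> g0 gB N; have := up (fun n => g (- n)) (fun n => g0 _) _ N.
  rewrite -bsum_opp => h; apply: le_trans (h _); last by move=> M; rewrite bsum_opp.
  by apply: eq_ler; apply: bsum_eq => n _; congr g; lia.
elim/int_ind: m => [N|k IH N|k IH N].
- by rewrite (le_trans _ (fB N))//; apply: eq_ler; apply: bsum_eq => n _; rewrite addr0.
- have := up (fun n => f (n + k%:Z)) (fun n => f0 _) IH N.
  apply: le_trans; apply: eq_ler; apply: bsum_eq => n _.
  by congr f; lia.
- have := down (fun n => f (n - k%:Z)) (fun n => f0 _) IH N.
  apply: le_trans; apply: eq_ler; apply: bsum_eq => n _.
  by congr f; lia.
Qed.

(** * Absolutely summable complex families *)

Local Notation normc := ComplexField.Normc.normc.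

(** A real-valued norm equivalent to the modulus; real and imaginary parts are
    integrated separately, and this norm splits accordingly. *)
Definition z1 (R : realType) (z : R[i]) : R := `|complex.Re z| + `|complex.Im z|.

Section z1.
Context {R : realType}.
Implicit Types z w : R[i].

Lemma ReD z w : complex.Re (z + w) = complex.Re z + complex.Re w.
Proof. by case: z => a b; case: w. Qed.

Lemma ImD z w : complex.Im (z + w) = complex.Im z + complex.Im w.
Proof. by case: z => a b; case: w. Qed.

Lemma ReN z : complex.Re (- z) = - complex.Re z.
Proof. by case: z. Qed.

Lemma ImN z : complex.Im (- z) = - complex.Im z.
Proof. by case: z. Qed.

Lemma ReM z w : complex.Re (z * w) =
  complex.Re z * complex.Re w - complex.Im z * complex.Im w.
Proof. by case: z => a b; case: w. Qed.

Lemma ImM z w : complex.Im (z * w) =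
  complex.Re z * complex.Im w + complex.Im z * complex.Re w.
Proof. by case: z => a b; case: w. Qed.

Lemma Re_realM (x : R) z : complex.Re (x%:C * z) = x * complex.Re z.
Proof. by rewrite ReM mul0r subr0. Qed.

Lemma Im_realM (x : R) z : complex.Im (x%:C * z) = x * complex.Im z.
Proof. by rewrite ImM mul0r addr0. Qed.

Lemma conjcM z w : conjc (z * w) = conjc z * conjc w.
Proof. exact: rmorphM. Qed.

Lemma conjcD z w : conjc (z + w) = conjc z + conjc w.
Proof. exact: rmorphD. Qed.

Lemma conjcB z w : conjc (z - w) = conjc z - conjc w.
Proof. exact: rmorphB. Qed.

Lemma z1_ge0 z : 0 <= z1 z. Proof. by rewrite addr_ge0. Qed.

Lemma z1D z w : z1 (z + w) <= z1 z + z1 w.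
Proof. by rewrite /z1 ReD ImD addrACA lerD// ler_normD. Qed.

Lemma z1N z : z1 (- z) = z1 z.
Proof. by rewrite /z1 ReN ImN !normrN. Qed.

Lemma z1B z w : z1 (z - w) <= z1 z + z1 w.
Proof. by rewrite (le_trans (z1D _ _))// z1N. Qed.

Lemma z1_dist z w : z1 (z - w) = z1 (w - z).
Proof. by rewrite -z1N opprB. Qed.

Lemma z1M z w : z1 (z * w) <= z1 z * z1 w.
Proof.
rewrite /z1 ReM ImM; set a := complex.Re z; set b := complex.Im z.
set c := complex.Re w; set d := complex.Im w.
have h1 := ler_normB (a * c) (b * d); have h2 := ler_normD (a * d) (b * c).
rewrite (le_trans (lerD h1 h2))// !normrM; apply: eq_ler; ring.
Qed.

Lemma z1_conj z : z1 (conjc z) = z1 z.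
Proof. by case: z => a b; rewrite /z1 /= normrN. Qed.

Lemma z1_real (x : R) : z1 x%:C = `|x|.
Proof. by rewrite /z1 /= normr0 addr0. Qed.

Lemma z10 : z1 (0 : R[i]) = 0.
Proof. by rewrite /z1 /= normr0 addr0. Qed.

Lemma z1_realM (x : R) z : z1 (x%:C * z) = `|x| * z1 z.
Proof. by rewrite /z1 ReM ImM /= !mul0r subr0 addr0 !normrM mulrDr. Qed.

Lemma z1_le0 z : z1 z <= 0 -> z = 0.
Proof.
case: z => a b; rewrite /z1 /= => h.
by congr (_ +i* _); apply/normr0_eq0/eqP; rewrite eq_le normr_ge0 andbT;
  rewrite (le_trans _ h)// ?lerDl// lerDr.
Qed.

Lemma Re_le_z1 z : `|complex.Re z| <= z1 z.
Proof. by rewrite lerDl. Qed.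

Lemma Im_le_z1 z : `|complex.Im z| <= z1 z.
Proof. by rewrite lerDr. Qed.

Lemma normc_sq z :
  normc z ^+ 2 = complex.Re z ^+ 2 + complex.Im z ^+ 2.
Proof. by case: z => a b /=; rewrite sqr_sqrtr// addr_ge0// sqr_ge0. Qed.

Lemma normc_ge0 z : 0 <= normc z.
Proof. by case: z => a b /=; rewrite sqrtr_ge0. Qed.

Lemma normc_le_z1 z : normc z <= z1 z.
Proof.
rewrite -(ler_pXn2r (ltn0Sn 1)) ?nnegrE ?normc_ge0 ?z1_ge0//.
rewrite normc_sq /z1 sqrrD !real_normK ?num_real//.
by rewrite addrAC lerDl mulrn_wge0// mulr_ge0.
Qed.

Lemma z1_sq_le z : z1 z ^+ 2 <= 2 * normc z ^+ 2.
Proof.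
rewrite normc_sq /z1 -(real_normK (num_real (complex.Re z))).
rewrite -(real_normK (num_real (complex.Im z))).
move: `|complex.Re z| `|complex.Im z| => a b; have := sqr_ge0 (a - b); lra.
Qed.

Lemma Re_bsum (v : int -> R[i]) N :
  complex.Re (bsum v N) = bsum (fun n => complex.Re (v n)) N.
Proof. by rewrite /bsum (big_morph _ ReD (erefl _)). Qed.

Lemma Im_bsum (v : int -> R[i]) N :
  complex.Im (bsum v N) = bsum (fun n => complex.Im (v n)) N.
Proof. by rewrite /bsum (big_morph _ ImD (erefl _)). Qed.

Lemma z1_bsum (v : int -> R[i]) N : z1 (bsum v N) <= bsum (fun n => z1 (v n)) N.
Proof.
elim: N => [|N IH]; first by rewrite !bsum0.
by rewrite !bsumS (le_trans (z1D _ _))// lerD// z1D.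
Qed.

Lemma z1_bsumB (v : int -> R[i]) N M : (N <= M)%N ->
  z1 (bsum v M - bsum v N) <= bsum (fun n => z1 (v n)) M - bsum (fun n => z1 (v n)) N.
Proof.
move=> /subnKC <-; elim: (M - N)%N => [|k IH]; first by rewrite addn0 !subrr z10.
rewrite addnS !bsumS addrAC (le_trans (z1D _ _))// [leRHS]addrAC lerD//.
exact: z1D.
Qed.

End z1.

(** Stated by coordinates to reduce limits to real ones; [zcvg_cvg] passes to
    the topology of [R[i]^o]. *)
Definition zcvg (R : realType) (z : nat -> R[i]) (l : R[i]) : Prop :=
  ((fun n => complex.Re (z n)) @ \oo --> complex.Re l) /\
  ((fun n => complex.Im (z n)) @ \oo --> complex.Im l).

Section zcvg.
Context {R : realType}.
Implicit Types (z w : nat -> R[i]) (l m : R[i]).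

Lemma zcvg_cst l : zcvg (fun=> l) l.
Proof. by split; exact: cvg_cst. Qed.

Lemma zcvgD z w l m : zcvg z l -> zcvg w m -> zcvg (fun n => z n + w n) (l + m).
Proof.
move=> [h1 h2] [h3 h4]; split; rewrite ?ReD ?ImD.
- by under eq_fun do rewrite ReD; exact: cvgD.
- by under eq_fun do rewrite ImD; exact: cvgD.
Qed.

Lemma zcvgN z l : zcvg z l -> zcvg (fun n => - z n) (- l).
Proof.
move=> [h1 h2]; split; rewrite ?ReN ?ImN.
- by under eq_fun do rewrite ReN; exact: cvgN.
- by under eq_fun do rewrite ImN; exact: cvgN.
Qed.

Lemma zcvgB z w l m : zcvg z l -> zcvg w m -> zcvg (fun n => z n - w n) (l - m).
Proof. by move=> h1 h2; apply: zcvgD => //; exact: zcvgN. Qed.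

Lemma zcvgM z w l m : zcvg z l -> zcvg w m -> zcvg (fun n => z n * w n) (l * m).
Proof.
move=> [h1 h2] [h3 h4]; split; rewrite ?ReM ?ImM.
- by under eq_fun do rewrite ReM; apply: cvgB; exact: cvgM.
- by under eq_fun do rewrite ImM; apply: cvgD; exact: cvgM.
Qed.

Lemma zcvg_conj z l : zcvg z l -> zcvg (fun n => conjc (z n)) (conjc l).
Proof.
move=> [h1 h2]; split.
- have E x : complex.Re (conjc x) = complex.Re x :> R by case: x.
  by rewrite E; under eq_fun do rewrite E.
- have E x : complex.Im (conjc x) = - complex.Im x :> R by case: x.
  by rewrite E; under eq_fun do rewrite E; exact: cvgN.
Qed.

Lemma zcvg_z1 z l : zcvg z l -> (fun n => z1 (z n)) @ \oo --> z1 l.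
Proof. by move=> [h1 h2]; apply: cvgD; exact: cvg_norm. Qed.

Lemma zcvg_bsum (F : nat -> int -> R[i]) (f : int -> R[i]) N :
  (forall n, zcvg (F^~ n) (f n)) -> zcvg (fun M => bsum (F M) N) (bsum f N).
Proof.
move=> h; elim: N => [|N IH].
  by rewrite bsum0; under eq_fun do rewrite bsum0; exact: h.
rewrite bsumS; under eq_fun do rewrite bsumS.
by apply: zcvgD => //; exact: zcvgD.
Qed.

Lemma zcvg_le z l (w : R[i]) (e : R) : zcvg z l -> (\forall n \near \oo, z1 (z n - w) <= e) ->
  z1 (l - w) <= e.
Proof.
move=> h1 h2; apply: (cvgr_to_le (zcvg_z1 (zcvgB h1 (zcvg_cst w)))).
exact: h2.
Qed.

Lemma zcvg_ext z w l : z =1 w -> zcvg z l -> zcvg w l.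
Proof. by move=> /funext ->. Qed.

Lemma zcvg_z1P z l : (fun n => z1 (z n - l)) @ \oo --> (0 : R) -> zcvg z l.
Proof.
move=> h; split; apply/cvgrPdist_le => e e0; move/cvgrPdist_le : h => /(_ _ e0);
  apply: filterS => n; rewrite sub0r normrN ger0_norm ?z1_ge0// => h.
- by rewrite distrC -ReN -ReD (le_trans (Re_le_z1 _)).
- by rewrite distrC -ImN -ImD (le_trans (Im_le_z1 _)).
Qed.

Lemma zcvg_cvg z l : zcvg z l -> (z : nat -> R[i]^o) @ \oo --> (l : R[i]^o).
Proof.
move=> h; apply/cvgrPdist_le => e; rewrite ltcE /= => /andP[/eqP ei e0].
have : (fun n => z1 (z n - l)) @ \oo --> (0 : R).
  rewrite -z10 -(subrr l); exact: (zcvg_z1 (zcvgB h (zcvg_cst l))).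
move=> /cvgrPdist_le /(_ _ e0); apply: filterS => n.
rewrite sub0r normrN ger0_norm ?z1_ge0// => hn.
rewrite distrC lecE ei /= eqxx /=.
rewrite (le_trans _ hn)//; exact: normc_le_z1.
Qed.

Lemma zcvg_lim z l : zcvg z l -> limn (z : nat -> R[i]^o) = l.
Proof. by move=> /zcvg_cvg; exact: cvg_lim. Qed.

End zcvg.

(** Explicit bounds stand for the l1 norm, so that estimates compose without a
    side condition of summability. *)
Definition l1b (R : realType) (v : int -> R[i]) (B : R) : Prop :=
  forall N, bsum (fun n => z1 (v n)) N <= B.

Definition csum (R : realType) (v : int -> R[i]) : R[i] :=
  limn (bilateral_sum v).

Section l1.
Context {R : realType}.
Implicit Types (v w : int -> R[i]) (A B : R).

Lemma l1b_ge0 v B : l1b v B -> 0 <= B.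
Proof. by move=> h; apply: le_trans (h 0%N); apply: bsum_ge0 => n; exact: z1_ge0. Qed.

Lemma l1b_term v B n : l1b v B -> z1 (v n) <= B.
Proof.
move=> h; apply: le_trans (h `|n|%N).
by apply: (@bsum_ge_term _ (fun n => z1 (v n))) => // k; exact: z1_ge0.
Qed.

Lemma l1b_le v A B : A <= B -> l1b v A -> l1b v B.
Proof. by move=> AB h N; exact: le_trans AB. Qed.

Lemma l1b_dom v w B : (forall n, z1 (v n) <= z1 (w n)) -> l1b w B -> l1b v B.
Proof. by move=> vw h N; rewrite (le_trans _ (h N))// bsum_le. Qed.

Lemma l1b_ext v w B : v =1 w -> l1b v B -> l1b w B.
Proof. by move=> /funext ->. Qed.

Lemma l1bD v w A B : l1b v A -> l1b w B -> l1b (fun n => v n + w n) (A + B).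
Proof.
move=> hv hw N; apply: le_trans (lerD (hv N) (hw N)).
by rewrite -bsumD bsum_le// => n _; exact: z1D.
Qed.

Lemma l1bN v A : l1b v A -> l1b (fun n => - v n) A.
Proof. by move=> h; apply: l1b_dom h => n; rewrite z1N. Qed.

Lemma l1bB v w A B : l1b v A -> l1b w B -> l1b (fun n => v n - w n) (A + B).
Proof. by move=> hv hw; apply: l1bD => //; exact: l1bN. Qed.

Lemma l1b0 : l1b (fun=> 0 : R[i]) 0.
Proof. by move=> N; rewrite (bsum_eq (g := fun=> 0)) ?[leLHS]big1// => n _; rewrite z10. Qed.

Lemma l1bB_refl v : l1b (fun n => v n - v n) 0.
Proof. by apply: l1b_ext l1b0 => n; rewrite subrr. Qed.

Lemma l1bB_sym v w A : l1b (fun n => v n - w n) A -> l1b (fun n => w n - v n) A.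
Proof. by move=> h; apply: l1b_dom h => n; rewrite z1_dist. Qed.

Lemma l1bB_trans v w x A B : l1b (fun n => v n - w n) A ->
  l1b (fun n => w n - x n) B -> l1b (fun n => v n - x n) (A + B).
Proof.
move=> h1 h2; apply: l1b_ext (l1bD h1 h2) => n.
by rewrite addrA subrK.
Qed.

Lemma l1b_mul (c : int -> R[i]) v C A : (forall n, z1 (c n) <= C) -> l1b v A ->
  l1b (fun n => c n * v n) (C * A).
Proof.
move=> cC hv N; have C0 : 0 <= C by apply: le_trans (cC 0); exact: z1_ge0.
apply: le_trans (ler_wpM2l C0 (hv N)); rewrite -bsumZ bsum_le// => n _.
by rewrite (le_trans (z1M _ _))// ler_wpM2r// z1_ge0.
Qed.

Lemma l1b_opp v A : l1b v A -> l1b (fun n => v (- n)) A.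
Proof. by move=> h N; rewrite (bsum_opp (fun n => z1 (v n))). Qed.

Lemma l1b_conj v A : l1b v A -> l1b (fun n => conjc (v n)) A.
Proof. by move=> h; apply: l1b_dom h => n; rewrite z1_conj. Qed.

Lemma l1b_shift v A m : l1b v A -> l1b (fun n => v (n + m)) A.
Proof.
by move=> h; apply: (@bsum_shift_le _ (fun n => z1 (v n))) => // n; exact: z1_ge0.
Qed.

(** [f] is the difference of [|f| + f] and [|f|], whose partial sums increase. *)
Lemma bsum_is_cvg (f : int -> R) B :
  (forall N, bsum (fun n => `|f n|) N <= B) -> cvgn (bsum f).
Proof.
move=> fB; have c1 : cvgn (bsum (fun n => `|f n|)).
  apply: nondecreasing_is_cvgn => [n m nm|]; first exact: bsum_mono.
  by exists B => _ [N _ <-].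
have c2 : cvgn (bsum (fun n => `|f n| + f n)).
  apply: nondecreasing_is_cvgn => [n m nm|].
    by apply: bsum_mono => // k; have := ler_norm (- f k); rewrite normrN; lra.
  exists (B + B) => _ [N _ <-]; rewrite bsumD lerD// (le_trans _ (fB N))//.
  by apply: bsum_le => n _; exact: ler_norm.
have -> : bsum f = (fun N => bsum (fun n => `|f n| + f n) N - bsum (fun n => `|f n|) N).
  by apply/funext => N; rewrite bsumD addrAC subrr add0r.
exact: is_cvgB.
Qed.

Lemma csum_cvg v B : l1b v B -> zcvg (bsum v) (csum v).
Proof.
move=> h.
have c1 : cvgn (bsum (fun n => complex.Re (v n))).
  by apply: (@bsum_is_cvg _ B) => N; rewrite (le_trans _ (h N))// bsum_le// => n _; exact: Re_le_z1.
have c2 : cvgn (bsum (fun n => complex.Im (v n))).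
  by apply: (@bsum_is_cvg _ B) => N; rewrite (le_trans _ (h N))// bsum_le// => n _; exact: Im_le_z1.
have c : zcvg (bsum v) (limn (bsum (fun n => complex.Re (v n))) +i*
                        limn (bsum (fun n => complex.Im (v n)))).
  split => /=.
  - by under eq_fun do rewrite Re_bsum.
  - by under eq_fun do rewrite Im_bsum.
by rewrite /csum; have -> := zcvg_lim c.
Qed.

Lemma csum_eq v l : zcvg (bsum v) l -> csum v = l.
Proof. exact: zcvg_lim. Qed.

Lemma csum_bound v B : l1b v B -> z1 (csum v) <= B.
Proof.
move=> h; rewrite -[csum v]subr0; apply: (zcvg_le (csum_cvg h)).
by apply: nearW => N; rewrite subr0 (le_trans (z1_bsum _ _)).
Qed.

Lemma csum_ext v w : v =1 w -> csum v = csum w.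
Proof. by move=> /funext ->. Qed.

Lemma csumD v w A B : l1b v A -> l1b w B ->
  csum (fun n => v n + w n) = csum v + csum w.
Proof.
move=> hv hw; apply: csum_eq; have := zcvgD (csum_cvg hv) (csum_cvg hw).
by apply: zcvg_ext => N; rewrite bsumD.
Qed.

Lemma csumB v w A B : l1b v A -> l1b w B ->
  csum (fun n => v n - w n) = csum v - csum w.
Proof.
move=> hv hw; apply: csum_eq; have := zcvgB (csum_cvg hv) (csum_cvg hw).
by apply: zcvg_ext => N; rewrite bsumB.
Qed.

Lemma csumZ c v B : l1b v B -> csum (fun n => c * v n) = c * csum v.
Proof.
move=> hv; apply: csum_eq; have := zcvgM (zcvg_cst c) (csum_cvg hv).
by apply: zcvg_ext => N; rewrite bsumZ.
Qed.

Lemma csumN v B : l1b v B -> csum (fun n => - v n) = - csum v.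
Proof.
move=> hv; apply: csum_eq; have := zcvgN (csum_cvg hv).
by apply: zcvg_ext => N; rewrite bsumN.
Qed.

Lemma csum_conj v B : l1b v B -> csum (fun n => conjc (v n)) = conjc (csum v).
Proof.
move=> hv; apply: csum_eq; have := zcvg_conj (csum_cvg hv).
by apply: zcvg_ext => N; rewrite /bsum rmorph_sum.
Qed.

Lemma csum_opp v : csum (fun n => v (- n)) = csum v.
Proof.
rewrite /csum; suff -> : bilateral_sum (fun n => v (- n)) = bilateral_sum v by [].
by apply/funext => N; exact: bsum_opp.
Qed.

Lemma csum_finite v N : (forall n, (N < `|n|)%N -> v n = 0) -> csum v = bsum v N.
Proof.
move=> h; apply: csum_eq; apply: (@zcvg_z1P _ _ _).
apply/cvgrPdist_le => e e0; exists N => // M /= /subnKC <-.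
suff -> : bsum v (N + (M - N)) = bsum v N by rewrite subrr z10 subrr normr0 ltW.
elim: (M - N)%N => [|k IH]; first by rewrite addn0.
by rewrite addnS bsumS IH !h ?addr0//; lia.
Qed.

(** The shift changes a symmetric partial sum by two boundary terms, which tend
    to zero. *)
Lemma csum_shift1 v B : l1b v B -> csum (fun n => v (n + 1)) = csum v.
Proof.
move=> h; apply: csum_eq; apply: (@zcvg_ext _ (fun N => bsum v N + (v N.+1%:Z - v (- N%:Z)))).
  by move=> N; rewrite bsum_shift1 addrA.
rewrite -[csum v]addr0; apply: zcvgD; first exact: csum_cvg h.
have c : cvgn (bsum (fun n => z1 (v n))).
  by apply: (@bsum_is_cvg _ B) => N; rewrite (le_trans _ (h N))// bsum_le// => n _; rewrite ger0_norm ?z1_ge0.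
have d : (fun N => bsum (fun n => z1 (v n)) N.+1 - bsum (fun n => z1 (v n)) N) @ \oo --> (0 : R).
  rewrite -(subrr (limn (bsum (fun n => z1 (v n))))); apply: cvgB => //.
  by rewrite (cvg_shiftS (bsum (fun n => z1 (v n)))).
have t1 : (fun N : nat => z1 (v N%:Z)) @ \oo --> (0 : R).
  rewrite -(cvg_shiftS (fun N : nat => z1 (v N%:Z))) /=; apply: (squeeze_cvgr _ (cvg_cst 0) d).
  by apply: nearW => N; rewrite z1_ge0 /= bsumS addrAC subrr add0r lerDl z1_ge0.
have t2 : (fun N : nat => z1 (v (- N%:Z))) @ \oo --> (0 : R).
  rewrite -(cvg_shiftS (fun N : nat => z1 (v (- N%:Z)))) /=; apply: (squeeze_cvgr _ (cvg_cst 0) d).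
  by apply: nearW => N; rewrite z1_ge0 /= bsumS addrAC subrr add0r lerDr z1_ge0.
apply: zcvg_z1P; have t : (fun N : nat => z1 (v N.+1%:Z) + z1 (v (- N%:Z))) @ \oo --> (0 : R).
  rewrite -(addr0 (0 : R)); apply: cvgD => //.
  by rewrite (cvg_shiftS (fun N : nat => z1 (v N%:Z))).
apply: (squeeze_cvgr _ (cvg_cst 0) t).
by apply: nearW => N; rewrite subr0 z1_ge0 z1B.
Qed.

Lemma csum_shift v B m : l1b v B -> csum (fun n => v (n + m)) = csum v.
Proof.
elim/int_ind: m v => [v _|k IH v h|k IH v h].
- by apply: csum_ext => n; rewrite addr0.
- rewrite -(IH _ h) -(csum_shift1 (l1b_shift k%:Z h)).
  by apply: csum_ext => n; congr v; lia.
- rewrite -(IH _ h) -(csum_shift1 (l1b_shift (- k.+1%:Z) h)).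
  by apply: csum_ext => n; congr v; lia.
Qed.

Lemma csum_refl v B m : l1b v B -> csum (fun n => v (m - n)) = csum v.
Proof.
move=> h; rewrite -(csum_shift m h) -(csum_opp (fun n => v (n + m))).
by apply: csum_ext => n; congr v; lia.
Qed.

End l1.

(** * Interchange of sums and convolution *)

Section fubini.
Context {R : realType}.

Lemma bsum_tail (f : int -> R) B e : (forall n, 0 <= f n) ->
  (forall N, bsum f N <= B) -> 0 < e ->
  exists N, forall M, bsum f M - bsum f N <= e.
Proof.
move=> f0 fB e0.
have c : cvgn (bsum f).
  by apply: (@bsum_is_cvg _ _ B) => N; rewrite (le_trans _ (fB N))// bsum_le// => n _; rewrite ger0_norm.
move/cvgrPdist_le : (c) => /(_ _ e0)[N _ h]; exists N => M.
have /= := h N (leqnn N); apply: le_trans; apply: le_trans (ler_norm _).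
rewrite lerD2r; apply: (@cvgr_to_ge _ \oo _ _ (bsum f) _ _ c).
by exists M => // k /= Mk; exact: bsum_mono.
Qed.

Lemma l1b_tail (v : int -> R[i]) B e : l1b v B -> 0 < e ->
  exists N, forall M, bsum (fun n => z1 (v n)) M - bsum (fun n => z1 (v n)) N <= e.
Proof. by move=> h; apply: (bsum_tail (B := B)) => // n; exact: z1_ge0. Qed.

Lemma cvg_bsum (F : nat -> int -> R) (f : int -> R) N :
  (forall n, F^~ n @ \oo --> f n) -> (fun M => bsum (F M) N) @ \oo --> bsum f N.
Proof.
move=> h; elim: N => [|N IH].
  by rewrite bsum0; under eq_fun do rewrite bsum0; exact: h.
rewrite bsumS; under eq_fun do rewrite bsumS.
by apply: cvgD => //; exact: cvgD.
Qed.

Variables (F : int -> int -> R[i]) (B : R).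
Hypothesis FB : forall N M, bsum (fun n => bsum (fun a => z1 (F n a)) M) N <= B.

Lemma l1b_row n : l1b (F n) B.
Proof.
move=> M; apply: le_trans (FB `|n|%N M).
apply: (@bsum_ge_term _ (fun n => bsum (fun a => z1 (F n a)) M)) => // k.
by apply: bsum_ge0 => a; exact: z1_ge0.
Qed.

Lemma l1b_csum : l1b (fun n => csum (F n)) B.
Proof.
move=> N; apply: (@cvgr_to_le _ \oo _ _ (fun M => bsum (fun n => z1 (bsum (F n) M)) N)).
  by apply: cvg_bsum => n; apply: zcvg_z1; exact: csum_cvg (l1b_row n).
apply: nearW => M; rewrite (le_trans _ (FB N M))// bsum_le// => n _.
exact: z1_bsum.
Qed.

Lemma box_dist N0 N M : (N0 <= N)%N -> (N0 <= M)%N ->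
  z1 (bsum (fun n => bsum (F n) M) N - bsum (fun n => bsum (F n) N0) N0) <=
  bsum (fun n => bsum (fun a => z1 (F n a)) M) N
  - bsum (fun n => bsum (fun a => z1 (F n a)) N0) N0.
Proof.
move=> hN hM; set g := fun n => bsum (F n) M; set g0 := fun n => bsum (F n) N0.
set G := fun n => bsum (fun a => z1 (F n a)) M.
set G0 := fun n => bsum (fun a => z1 (F n a)) N0.
have -> : bsum g N - bsum g0 N0 = (bsum g N - bsum g N0) + bsum (fun n => g n - g0 n) N0.
  by rewrite bsumB addrA subrK.
have -> : bsum G N - bsum G0 N0 = (bsum G N - bsum G N0) + bsum (fun n => G n - G0 n) N0.
  by rewrite bsumB addrA subrK.
apply: le_trans (z1D _ _) _; apply: lerD.
  apply: le_trans (z1_bsumB _ hN) _.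
  have : bsum (fun n => G n - z1 (g n)) N0 <= bsum (fun n => G n - z1 (g n)) N.
    by apply: bsum_mono => // n; rewrite subr_ge0; exact: z1_bsum.
  rewrite !bsumB; lra.
apply: le_trans (z1_bsum _ _) _; apply: bsum_le => n _; exact: z1_bsumB.
Qed.

Lemma box_tail e : 0 < e -> exists N0, forall N M,
  bsum (fun n => bsum (fun a => z1 (F n a)) M) N
  - bsum (fun n => bsum (fun a => z1 (F n a)) N0) N0 <= e.
Proof.
move=> e0; set D := fun N => bsum (fun n => bsum (fun a => z1 (F n a)) N) N.
have mono N N' M M' : (N <= N')%N -> (M <= M')%N ->
    bsum (fun n => bsum (fun a => z1 (F n a)) M) N <=
    bsum (fun n => bsum (fun a => z1 (F n a)) M') N'.
  move=> hN hM; apply: (@le_trans _ _ (bsum (fun n => bsum (fun a => z1 (F n a)) M) N')).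
    by apply: bsum_mono => // n; apply: bsum_ge0 => a; exact: z1_ge0.
  by apply: bsum_le => n _; apply: bsum_mono => // a; exact: z1_ge0.
have c : cvgn D.
  apply: nondecreasing_is_cvgn => [n m nm|]; first exact: mono.
  by exists B => _ [N _ <-]; exact: FB.
move/cvgrPdist_le : (c) => /(_ _ e0)[N0 _ h]; exists N0 => N M.
have /= := h N0 (leqnn N0); apply: le_trans; apply: le_trans (ler_norm _).
rewrite lerD2r; apply: (@cvgr_to_ge _ \oo _ _ D _ _ c).
exists (maxn N M) => // k /=; rewrite geq_max => /andP[Nk Mk]; exact: mono.
Qed.

Lemma csum_box N0 e :
  (forall N M, bsum (fun n => bsum (fun a => z1 (F n a)) M) N
  - bsum (fun n => bsum (fun a => z1 (F n a)) N0) N0 <= e) ->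
  z1 (csum (fun n => csum (F n)) - bsum (fun n => bsum (F n) N0) N0) <= e.
Proof.
move=> h; apply: (zcvg_le (csum_cvg l1b_csum)); exists N0 => // N /= hN.
apply: (@zcvg_le _ (fun M => bsum (fun n => bsum (F n) M) N)).
  by apply: (@zcvg_bsum _ (fun M n => bsum (F n) M)) => n; exact: csum_cvg (l1b_row n).
by exists N0 => // M /= hM; exact: le_trans (box_dist hN hM) (h _ _).
Qed.

End fubini.

(** Both iterated sums are within [e] of one and the same square partial sum, as
    soon as the mass outside the square is at most [e]. *)
Lemma csum_fubini (R : realType) (F : int -> int -> R[i]) (B : R) :
  (forall N M, bsum (fun n => bsum (fun a => z1 (F n a)) M) N <= B) ->
  csum (fun n => csum (F n)) = csum (fun a => csum (F^~ a)).
Proof.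
move=> FB; apply/eqP; rewrite -subr_eq0; apply/eqP/z1_le0.
have FB' N M : bsum (fun n => bsum (fun a => z1 (F a n)) M) N <= B.
  by rewrite bsum_exchange.
apply/ler_addgt0Pl => e e0; rewrite addr0.
have e2 : 0 < e / 2 by lra.
have [N0 h] := box_tail FB e2.
have h1 := csum_box FB h.
have h2 : z1 (csum (fun a => csum (F^~ a)) - bsum (fun n => bsum (F n) N0) N0) <= e / 2.
  rewrite bsum_exchange; apply: (csum_box FB') => N M.
  by rewrite bsum_exchange [X in _ - X]bsum_exchange; exact: h.
have := z1B (csum (fun n => csum (F n)) - bsum (fun n => bsum (F n) N0) N0)
  (csum (fun a => csum (F^~ a)) - bsum (fun n => bsum (F n) N0) N0).
by rewrite opprB addrA subrK; lra.
Qed.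

Definition conv (R : realType) (v w : int -> R[i]) (n : int) : R[i] :=
  csum (fun a => v a * w (n - a)).

Section conv.
Context {R : realType}.
Implicit Types (v w p : int -> R[i]) (A B : R).

Lemma conv_row v w A B n : l1b v A -> l1b w B ->
  l1b (fun a => v a * w (n - a)) (A * B).
Proof.
move=> hv hw; rewrite mulrC; apply: l1b_ext (l1b_mul (c := fun a => w (n - a)) _ hv).
  by move=> a; rewrite mulrC.
by move=> a; exact: l1b_term hw.
Qed.

Lemma conv_box v w A B N M : l1b v A -> l1b w B ->
  bsum (fun n => bsum (fun a => z1 (v a * w (n - a))) M) N <= A * B.
Proof.
move=> hv hw; rewrite bsum_exchange.
have B0 := l1b_ge0 hw.
apply: (@le_trans _ _ (bsum (fun a => B * z1 (v a)) M)); last first.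
  by rewrite bsumZ mulrC ler_wpM2r.
apply: bsum_le => a _.
apply: (@le_trans _ _ (bsum (fun n => z1 (v a) * z1 (w (n - a))) N)).
  by apply: bsum_le => n _; exact: z1M.
rewrite bsumZ mulrC ler_wpM2r ?z1_ge0//; exact: (l1b_shift (- a) hw).
Qed.

Lemma l1b_convM v w A B : l1b v A -> l1b w B -> l1b (conv v w) (A * B).
Proof. by move=> hv hw; apply: l1b_csum => N M; exact: conv_box. Qed.

Lemma convC v w A B n : l1b v A -> l1b w B -> conv v w n = conv w v n.
Proof.
move=> hv hw; rewrite /conv -(csum_refl n (conv_row n hv hw)).
by apply: csum_ext => a; rewrite opprB addrCA subrr addr0 mulrC.
Qed.

Lemma convBl v v' w A A' B n : l1b v A -> l1b v' A' -> l1b w B ->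
  conv (fun k => v k - v' k) w n = conv v w n - conv v' w n.
Proof.
move=> hv hv' hw; rewrite /conv -(csumB (conv_row n hv hw) (conv_row n hv' hw)).
by apply: csum_ext => a; rewrite mulrBl.
Qed.

Lemma convBr v w w' A B B' n : l1b v A -> l1b w B -> l1b w' B' ->
  conv v (fun k => w k - w' k) n = conv v w n - conv v w' n.
Proof.
move=> hv hw hw'; rewrite /conv -(csumB (conv_row n hv hw) (conv_row n hv hw')).
by apply: csum_ext => a; rewrite mulrBr.
Qed.

Lemma convZ v w A B c d n : l1b v A -> l1b w B ->
  conv (fun k => c * v k) (fun k => d * w k) n = c * d * conv v w n.
Proof.
move=> hv hw; rewrite /conv -(csumZ (c * d) (conv_row n hv hw)).
by apply: csum_ext => a; rewrite mulrACA.
Qed.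

Lemma conv_sqB v w A B n : l1b v A -> l1b w B ->
  conv v v n - conv w w n =
  conv (fun k => v k - w k) v n + conv w (fun k => v k - w k) n.
Proof.
move=> hv hw; rewrite (convBl n hv hw hv) (convBr n hw hv hw).
by rewrite addrA subrK.
Qed.

Lemma conv_sq_dist v w A B D : l1b v A -> l1b w B ->
  l1b (fun k => v k - w k) D ->
  l1b (fun n => conv v v n - conv w w n) (D * (A + B)).
Proof.
move=> hv hw hd; apply: (@l1b_ext _ (fun n => conv (fun k => v k - w k) v n
    + conv w (fun k => v k - w k) n)).
  by move=> n; rewrite (conv_sqB n hv hw).
by rewrite mulrDr (mulrC D B); apply: l1bD; exact: l1b_convM.
Qed.

Lemma conv_flip v w A B n : l1b v A -> l1b w B ->
  conv (fun k => conjc (v (- k))) (fun k => conjc (w (- k))) n =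
  conjc (conv v w (- n)).
Proof.
move=> hv hw; rewrite /conv -(csum_conj (conv_row (- n) hv hw)).
rewrite -csum_opp; apply: csum_ext => a; rewrite rmorphM opprK /=.
by congr (_ * conjc (w _)); lia.
Qed.

Lemma csum_conv v w A B : l1b v A -> l1b w B ->
  csum (conv v w) = csum v * csum w.
Proof.
move=> hv hw; rewrite (csum_fubini (fun N M => conv_box N M hv hw)).
rewrite mulrC -(csumZ _ hv); apply: csum_ext => a.
rewrite (csumZ _ (l1b_shift (- a) hw)) mulrC; congr (_ * _).
exact: (csum_shift (- a) hw).
Qed.

(** For a character [e] this is the convolution theorem: with [csum_conv], the
    product of two Fourier series has the convolved coefficients. *)
Lemma conv_char v w (e : int -> R[i]) A B n : l1b v A -> l1b w B ->
  (forall a b, e (a + b) = e a * e b) ->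
  conv (fun k => v k * e k) (fun k => w k * e k) n = conv v w n * e n.
Proof.
move=> hv hw he; rewrite mulrC /conv -(csumZ _ (conv_row n hv hw)).
apply: csum_ext => a; rewrite mulrACA mulrC; congr (_ * _).
by rewrite -he; congr e; lia.
Qed.

(** By symmetry the sum is a third of [- \sum_{a+b+c=0} (a + b + c) p_a p_b p_c],
    which vanishes term by term.  In physical space it is the integral of a
    multiple of the derivative of [p^3] over a period. *)
Lemma cubic_cancel p A A' : l1b p A -> l1b (fun n => n%:~R * p n) A' ->
  csum (fun n => n%:~R * p (- n) * conv p p n) = 0.
Proof.
move=> hp hdp.
pose F (m a : int) : R[i] := m%:~R * p m * (p a * p (- m - a)).
have FB N M : bsum (fun m => bsum (fun a => z1 (F m a)) M) N <= A' * (A * A).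
  have AA : 0 <= A * A by rewrite mulr_ge0// (l1b_ge0 hp).
  apply: (@le_trans _ _ (bsum (fun m => (A * A) * z1 (m%:~R * p m)) N)).
    apply: bsum_le => m _; rewrite mulrC.
    apply: (@le_trans _ _ (bsum (fun a => z1 (m%:~R * p m) * z1 (p a * p (- m - a))) M)).
      by apply: bsum_le => a _; exact: z1M.
    by rewrite bsumZ ler_wpM2l ?z1_ge0//; exact: (conv_row (- m) hp hp).
  by rewrite bsumZ mulrC ler_wpM2r.
have rowF m : l1b (F m) (A' * (A * A)) := l1b_row FB m.
have hF := csum_fubini FB; set S := csum (fun n => csum (F n)) in hF.
have swap : S = csum (fun m => csum (fun a => F a m)) by [].
have rowG m : l1b (fun a => F a m) (A' * (A * A)).
  by apply: (@l1b_row _ (fun m a => F a m)) => N M; rewrite bsum_exchange.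
have lG : l1b (fun m => csum (fun a => F a m)) (A' * (A * A)).
  by apply: (@l1b_csum _ (fun m a => F a m)) => N M; rewrite bsum_exchange.
(* the three weights of a triple with sum zero add up to zero *)
have S3 : S = - S - S.
  rewrite {1}swap {2}swap -(csumN (l1b_csum FB)) -(csumB (l1bN (l1b_csum FB)) lG).
  apply: csum_ext => m; rewrite -(csumN (rowF m)) -(csumB (l1bN (rowF m)) (rowG m)).
  rewrite -(csum_refl (- m) (rowG m)); apply: csum_ext => a.
  rewrite /F; have -> : - (- m - a) - m = a by lia.
  have -> : - a - m = - m - a by lia.
  rewrite !rmorphB rmorphN /=; ring.
have S0 : S = 0.
  have : S * 3%:R = S - (- S - S) by ring.
  rewrite -S3 subrr.
  by move/eqP; rewrite mulf_eq0 pnatr_eq0 orbF => /eqP.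
rewrite -csum_opp -[RHS]oppr0 -S0 -(csumN (l1b_csum FB)); apply: csum_ext => m.
rewrite opprK rmorphN mulNr mulNr; congr (- _).
by rewrite -(csumZ _ (conv_row (- m) hp hp)).
Qed.

Definition trunc N v (n : int) : R[i] := if (`|n| <= N)%N then v n else 0.

Lemma trunc_in N v n : (`|n| <= N)%N -> trunc N v n = v n.
Proof. by rewrite /trunc => ->. Qed.

Lemma trunc_out N v n : (N < `|n|)%N -> trunc N v n = 0.
Proof. by rewrite ltnNge /trunc => /negbTE ->. Qed.

Lemma l1b_trunc N v A : l1b v A -> l1b (trunc N v) A.
Proof.
move=> h; apply: l1b_dom h => n; rewrite /trunc; case: ifP => // _.
by rewrite z10 z1_ge0.
Qed.

Lemma z1_int (m : int) (z : R[i]) : z1 (m%:~R * z) = `|m%:~R| * z1 z.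
Proof. by rewrite -z1_realM; congr (z1 (_ * _)); rewrite rmorph_int. Qed.

(** [cubic_cancel] applies to the truncated sequence, so only the tail [v -
    trunc N v] contributes. *)
Lemma cubic_small v A C D N : l1b v A -> (forall n, `|n%:~R| * z1 (v n) <= C) ->
  l1b (fun n => v n - trunc N v n) D ->
  z1 (bsum (fun n => n%:~R * v (- n) * conv v v n) N) <= C * (D * (A + A)).
Proof.
move=> hv hC hD; set p := trunc N v.
have hp : l1b p A by exact: l1b_trunc.
have hdp : l1b (fun n => n%:~R * p n) (N%:R * A).
  move=> M; rewrite (le_trans _ (ler_wpM2l _ (hp M)))// -bsumZ bsum_le// => n _.
  rewrite z1_int; rewrite /p /trunc; case: ifP => [nN|]; last by rewrite z10 !mulr0.
  rewrite ler_wpM2r ?z1_ge0// -intr_norm -(pmulrn 1) ler_nat; exact: nN.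
have c0 : bsum (fun n => n%:~R * v (- n) * conv p p n) N = 0.
  rewrite -(cubic_cancel hp hdp) (@csum_finite _ _ N) => [|n hn].
    by apply: bsum_eq => n hn; rewrite /p trunc_in// abszN.
  by rewrite /p trunc_out ?mulr0 ?mul0r// abszN.
rewrite -[X in z1 X]subr0 -c0 -bsumB.
apply: le_trans (z1_bsum _ _) _.
apply: (l1b_dom (w := fun n => n%:~R * v (- n) * (conv v v n - conv p p n))).
  by move=> n; rewrite mulrBr.
apply: l1b_mul; last exact: conv_sq_dist.
by move=> n; rewrite z1_int; have := hC (- n); rewrite rmorphN normrN.
Qed.

End conv.

(** * Integrals over segments *)

Section time_integrals.
Context {R : realType}.
Notation mu := (@lebesgue_measure R).
Implicit Types (f g : R -> R) (a b c s t : R).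

Definition integrable_segments f : Prop :=
  forall a b, mu.-integrable `[a, b] (EFin \o f).

Lemma continuous_integrable_segments f : continuous f -> integrable_segments f.
Proof.
move=> cf a b; apply: continuous_compact_integrable; first exact: segment_compact.
exact: continuous_subspaceT.
Qed.

Lemma Rintegral_segment_neg f t : t < 0 -> \int[mu]_(x in `[0, t]) f x = 0.
Proof. by move=> t0; rewrite set_itv_ge ?Rintegral_set0// bnd_simp -ltNge. Qed.

Lemma Rintegral_segment0 f a : \int[mu]_(x in `[a, a]) f x = 0.
Proof. by rewrite set_itv1 Rintegral_set1. Qed.

Lemma Rintegral_segmentB f a s t : integrable_segments f -> a <= s -> s <= t ->
  \int[mu]_(x in `[a, t]) f x - \int[mu]_(x in `[a, s]) f x =
  \int[mu]_(x in `[s, t]) f x.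
Proof.
move=> intf as_ st; rewrite Rintegral_itvB; [|exact: intf|by rewrite bnd_simp|by rewrite bnd_simp].
rewrite Rintegral_itv_obnd_cbnd//; apply: integrableS (intf s t) => //.
by apply: subset_itvr; rewrite bnd_simp.
Qed.

Lemma Rintegral_bsum (f : int -> R -> R) a b N :
  (forall n, integrable_segments (f n)) ->
  mu.-integrable `[a, b] (EFin \o (fun x => bsum (fun n => f n x) N)) /\
  \int[mu]_(x in `[a, b]) (bsum (fun n => f n x) N) =
  bsum (fun n => \int[mu]_(x in `[a, b]) f n x) N.
Proof.
move=> hf; elim: N => [|N [IH1 IH2]].
  split; last by rewrite bsum0; apply: eq_Rintegral => x _; rewrite bsum0.
  rewrite (_ : (fun x => _) = f 0); first exact: hf.
  by apply/funext => x; rewrite bsum0.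
have i2 n m : mu.-integrable `[a, b] (EFin \o (fun x => f n x + f m x)).
  exact: (integrableD _ (hf n a b) (hf m a b)).
split.
  rewrite (_ : (fun x => _) = fun x => bsum (fun n => f n x) N + (f N.+1%:Z x + f (- N.+1%:Z) x)).
    exact: (integrableD _ IH1 (i2 _ _)).
  by apply/funext => x; rewrite bsumS.
rewrite bsumS -IH2 -RintegralD// -?RintegralD//.
- by apply: eq_Rintegral => x _; rewrite bsumS.
- exact: hf.
- exact: hf.
Qed.

Lemma lebesgue_ae_imply (P Q : R -> Prop) : (forall x, P x -> Q x) ->
  {ae mu, forall x, P x} -> {ae mu, forall x, Q x}.
Proof. by move=> PQ; apply: negligibleS => x /= nQ /PQ. Qed.

Lemma le_Rintegral_ae f g a b : (forall x, 0 <= f x) -> (forall x, 0 <= g x) ->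
  mu.-integrable `[a, b] (EFin \o f) -> mu.-integrable `[a, b] (EFin \o g) ->
  {ae mu, forall x, a <= x <= b -> f x <= g x} ->
  \int[mu]_(x in `[a, b]) f x <= \int[mu]_(x in `[a, b]) g x.
Proof.
move=> f0 g0 intf intg fg; rewrite /Rintegral fine_le//.
- exact: integrable_fin_num.
- exact: integrable_fin_num.
apply: ae_ge0_le_integral => //.
- by move=> x _; rewrite lee_fin.
- exact: measurable_int intf.
- by move=> x _; rewrite lee_fin.
- exact: measurable_int intg.
Qed.

(** Minkowski's inequality for the l1 norm, at the level of partial sums. *)
Lemma cintegral_l1 (f : R -> int -> R[i]) g a b N :
  (forall n, integrable_segments (fun x => complex.Re (f x n))) ->
  (forall n, integrable_segments (fun x => complex.Im (f x n))) ->
  (forall x, 0 <= g x) -> mu.-integrable `[a, b] (EFin \o g) ->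
  {ae mu, forall x, a <= x <= b -> bsum (fun n => z1 (f x n)) N <= g x} ->
  bsum (fun n => z1 (cintegral a b (f^~ n))) N <= \int[mu]_(x in `[a, b]) g x.
Proof.
move=> hRe hIm g0 intg fg.
have nRe n : integrable_segments (fun x => `|complex.Re (f x n)|).
  by move=> c d; exact: integrable_norm (hRe n c d).
have nIm n : integrable_segments (fun x => `|complex.Im (f x n)|).
  by move=> c d; exact: integrable_norm (hIm n c d).
have nz n : integrable_segments (fun x => z1 (f x n)).
  by move=> c d; exact: (integrableD _ (nRe n c d) (nIm n c d)).
have [i1 e1] := Rintegral_bsum a b N nz.
apply: (@le_trans _ _ (\int[mu]_(x in `[a, b]) (bsum (fun n => z1 (f x n)) N))).
  rewrite e1; apply: bsum_le => n _; rewrite /z1 /= RintegralD//; last 2 first.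
  - exact: nRe.
  - exact: nIm.
  by apply: lerD; apply: le_normr_Rintegral => //; [exact: hRe|exact: hIm].
apply: le_Rintegral_ae => // x; by apply: bsum_ge0 => n; exact: z1_ge0.
Qed.

Lemma Rintegral_segment_cst a b c : a <= b -> \int[mu]_(x in `[a, b]) c = c * (b - a).
Proof.
move=> ab; rewrite Rintegral_cst//; congr (_ * _).
have := lebesgue_measure_itv `[a, b].
rewrite /= lte_fin => ->; move: ab; rewrite le_eqVlt => /predU1P[->|->] //.
by rewrite ltxx subrr.
Qed.

Lemma integrable_segments_cst c : integrable_segments (fun=> c).
Proof. by apply: continuous_integrable_segments => x; exact: cvg_cst. Qed.

Lemma is_derive_continuous (F f : R -> R) :
  (forall x : R, is_derive x 1 F (f x)) -> continuous F.
Proof.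
move=> h x; apply: differentiable_continuous; apply/derivable1_diffP.
by case: (h x).
Qed.

Lemma Rintegral_derivative (F f : R -> R) (a b : R) : a <= b ->
  (forall x : R, is_derive x 1 F (f x)) -> continuous f ->
  \int[mu]_(x in `[a, b]) f x = F b - F a.
Proof.
rewrite le_eqVlt => /predU1P[<- _ _|ab dF cf].
  by rewrite Rintegral_segment0 subrr.
rewrite /Rintegral (@continuous_FTC2 _ _ F)//.
- exact: continuous_subspaceT.
- have cF := is_derive_continuous dF; split.
  + by move=> x _; case: (dF x).
  + exact/cvg_at_right_filter/cF.
  + exact/cvg_at_left_filter/cF.
- by move=> x _; rewrite derive1E; apply: derive_val.
Qed.

Lemma le_Rintegral_segments (f g : R -> R) (a b : R) :
  integrable_segments f -> integrable_segments g -> (forall x, f x <= g x) ->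
  \int[mu]_(x in `[a, b]) f x <= \int[mu]_(x in `[a, b]) g x.
Proof.
move=> hf hg fg; apply: (@le_Rintegral _ _ R mu _ _ _ (measurable_itv `[a, b])).
- exact: hf.
- exact: hg.
- by move=> x _; exact: fg.
Qed.

Lemma Rintegral_expR c t : 0 < c -> 0 <= t ->
  \int[mu]_(x in `[0, t]) (expR (c * x)) = (expR (c * t) - 1) / c.
Proof.
move=> c0 t0; pose F x := expR (c * x) / c.
have cE : continuous (fun x => expR (c * x)).
  move=> x; apply: continuous_comp; last exact: continuous_expR.
  by apply: cvgM; [exact: cvg_cst|exact: cvg_id].
have dF (x : R) : is_derive x 1 F (expR (c * x)).
  rewrite /F; have h : is_derive x 1 (fun y => c * y) c.
    have := is_deriveZ c (is_derive_id x (1 : R)).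
    by rewrite /GRing.scale /= mulr1; apply.
  have := @is_derive1_comp _ expR (fun y => c * y) x _ _ (is_derive_expR _) h.
  move=> h2; have := is_deriveZ c^-1 h2.
  rewrite /GRing.scale /= mulrCA mulVf ?mulr1 ?gt_eqF// => h3.
  by rewrite (_ : (fun _ => _) = c^-1 *: (expR \o (fun y => c * y)))//;
    apply/funext => y; rewrite /= mulrC.
by rewrite (Rintegral_derivative t0 dF cE) /F mulr0 expR0 -mulrBl.
Qed.

Lemma is_derive_congr f g (t d d' : R) : is_derive t 1 f d -> f =1 g -> d = d' ->
  is_derive t 1 g d'.
Proof. by move=> h /funext <- <-. Qed.

Lemma is_derive_Rintegral f t : continuous f -> 0 < t ->
  is_derive t 1 (fun x => \int[mu]_(s in `[0, x]) f s) (f t).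
Proof.
move=> cf t0; have tt : t < t + 1 by rewrite ltrDl.
have [d e] := continuous_FTC1_closed tt
  (continuous_integrable_segments cf 0 (t + 1)) t0 (cf t).
by rewrite -e derive1E; exact: derivableP.
Qed.

Lemma lipschitz_continuous f c : (forall s t, `|f s - f t| <= c * `|s - t|) ->
  continuous f.
Proof.
move=> h x; apply/cvgrPdist_le => e e0.
have c0 : 0 <= c by have := h 1 0; rewrite subr0 normr1 mulr1; apply: le_trans.
have c1 : 0 < c + 1 by rewrite ltr_wpDl.
near=> y; apply: le_trans (h _ _) _.
apply: (@le_trans _ _ ((c + 1) * `|x - y|)); first by rewrite ler_wpM2r// lerDl.
rewrite mulrC -ler_pdivlMr//; near: y.
have /cvgrPdist_le : (fun y : R => y) @ x --> x by exact: cvg_id.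
by apply; rewrite divr_gt0.
Unshelve. all: by end_near. Qed.

End time_integrals.

(** * Lipschitz curves in l1 *)

Lemma half_pow_cvg (R : realType) (c : R) : (fun k => c / 2 ^+ k) @ \oo --> (0 : R).
Proof.
have h : `|2^-1 : R| < 1 by rewrite ger0_norm; lra.
have := cvg_geometric c h; apply: cvg_trans; apply: near_eq_cvg; apply: nearW => k.
by rewrite /geometric /= exprVn.
Qed.

Section l1_complete.
Context {R : realType}.
Variables (x : nat -> int -> R[i]) (c : R).
Hypothesis xc : forall k, l1b (fun n => x k.+1 n - x k n) (c / 2 ^+ k).

Lemma l1_cauchy k m : (k <= m)%N -> l1b (fun n => x m n - x k n) (2 * c / 2 ^+ k).
Proof.
move=> /subnKC <-; set j := (m - k)%N.
have c0 : 0 <= c by have := l1b_ge0 (xc 0); rewrite expr0 divr1.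
have : l1b (fun n => x (k + j)%N n - x k n) (2 * c / 2 ^+ k - 2 * c / 2 ^+ (k + j)).
  elim: j => [|j IH]; first by rewrite addn0 subrr; exact: l1bB_refl.
  rewrite addnS; have := l1bB_trans (xc (k + j)) IH; apply: l1b_le.
  apply: eq_ler.
  have p0 : 2 ^+ (k + j) != 0 :> R by rewrite expf_neq0.
  rewrite exprS; field; by rewrite p0 expf_neq0.
apply: l1b_le; rewrite gerBl divr_ge0 ?exprn_ge0// mulr_ge0//.
Qed.

(** The limit is taken coordinatewise; the l1 bounds survive because they only
    involve finite windows. *)
Lemma l1_complete : exists l : int -> R[i],
  forall k, l1b (fun n => l n - x k n) (2 * c / 2 ^+ k).
Proof.
have coord (p : R[i] -> R) : (forall z, `|p z| <= z1 z) ->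
    (forall z w, p (z - w) = p z - p w) -> forall n, cvgn (fun k => p (x k n)).
  move=> pz pB n; apply/cauchy_cvgP/cauchyP => e e0.
  have e2 : 0 < e / 2 by rewrite divr_gt0.
  have /cvgrPdist_lt /(_ _ e0)[N _ h] := half_pow_cvg (2 * c).
  exists (p (x N n)), N => // m /= Nm; rewrite /ball /= distrC -pB.
  apply: le_lt_trans (pz _) _; apply: le_lt_trans (l1b_term n (l1_cauchy Nm)) _.
  have := h N (leqnn N); rewrite /= sub0r normrN; apply: le_lt_trans; exact: ler_norm.
have cRe := coord (@complex.Re R) Re_le_z1 (fun z w => etrans (ReD z (- w)) (congr1 _ (ReN w))).
have cIm := coord (@complex.Im R) Im_le_z1 (fun z w => etrans (ImD z (- w)) (congr1 _ (ImN w))).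
exists (fun n => limn (fun k => complex.Re (x k n)) +i* limn (fun k => complex.Im (x k n))).
move=> k N.
apply: (@cvgr_to_le _ \oo _ _ (fun m => bsum (fun n => z1 (x m n - x k n)) N)).
  apply: cvg_bsum => n; apply: zcvg_z1; apply: zcvgB; last exact: zcvg_cst.
  by split; [exact: cRe|exact: cIm].
by exists k => // m /= km; exact: l1_cauchy.
Qed.

End l1_complete.

(** Lipschitz continuity for the l1 norm, on the whole line: curves on the half
    line are extended by their initial value, in agreement with integrals over
    empty segments. *)
Definition lipc (R : realType) (u : R -> int -> R[i]) (B : R) : Prop :=
  forall s t, l1b (fun n => u s n - u t n) (B * `|s - t|).

Definition l1 (R : realType) (v : int -> R[i]) : Prop := exists A, l1b v A.

Definition coord_continuous (R : realType) (f : R -> int -> R[i]) : Prop :=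
  forall n, continuous (fun s => complex.Re (f s n)) /\
            continuous (fun s => complex.Im (f s n)).

Section curves.
Context {R : realType}.
Notation mu := (@lebesgue_measure R).
Implicit Types (u w f : R -> int -> R[i]) (phi : int -> R[i]).

Lemma lipc_continuous u B : lipc u B -> coord_continuous u.
Proof.
move=> h n; split; apply: (@lipschitz_continuous _ _ B) => s t.
- rewrite -ReN -ReD; apply: le_trans (Re_le_z1 _) _.
  exact: (l1b_term n (h s t)).
- rewrite -ImN -ImD; apply: le_trans (Im_le_z1 _) _.
  exact: (l1b_term n (h s t)).
Qed.

Lemma lipc_l1 u B t : lipc u B -> l1 (u 0) -> l1 (u t).
Proof.
move=> h [A hA]; exists (B * `|t - 0| + A).
apply: l1b_ext (l1bD (h t 0) hA) => n; by rewrite subrK.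
Qed.

Lemma cintegral_neg (f : R -> R[i]) t : t < 0 -> cintegral 0 t f = 0.
Proof. by move=> t0; rewrite /cintegral !Rintegral_segment_neg. Qed.

Lemma cintegral0 (f : R -> R[i]) : cintegral 0 0 f = 0.
Proof. by rewrite /cintegral !Rintegral_segment0. Qed.

Lemma cintegral_max (f : R -> R[i]) t : cintegral 0 t f = cintegral 0 (Num.max t 0) f.
Proof. by case: ltP => // t0; rewrite cintegral_neg// cintegral0. Qed.

Lemma cintegral_segmentB (f : R -> R[i]) a s t :
  integrable_segments (fun x => complex.Re (f x)) ->
  integrable_segments (fun x => complex.Im (f x)) -> a <= s -> s <= t ->
  cintegral a t f - cintegral a s f = cintegral s t f.
Proof.
move=> h1 h2 as_ st; rewrite /cintegral; simpc.
by rewrite !Rintegral_segmentB.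
Qed.

Lemma cintegralB (f g : R -> R[i]) a b :
  integrable_segments (fun x => complex.Re (f x)) ->
  integrable_segments (fun x => complex.Im (f x)) ->
  integrable_segments (fun x => complex.Re (g x)) ->
  integrable_segments (fun x => complex.Im (g x)) ->
  cintegral a b (fun x => f x - g x) = cintegral a b f - cintegral a b g.
Proof.
move=> h1 h2 h3 h4; rewrite /cintegral; simpc.
rewrite -!RintegralB//.
by congr (_ +i* _); apply: eq_Rintegral => x _; [rewrite ReD ReN|rewrite ImD ImN].
Qed.

(** The bound on [f] is required almost everywhere only, because the time
    derivative of a generalized solution is only essentially bounded. *)
Lemma lipc_primitive f phi B :
  (forall n, integrable_segments (fun x => complex.Re (f x n))) ->
  (forall n, integrable_segments (fun x => complex.Im (f x n))) ->
  0 <= B -> {ae mu, forall x, 0 <= x -> l1b (f x) B} ->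
  lipc (fun t n => phi n + cintegral 0 t (f^~ n)) B.
Proof.
move=> h1 h2 B0 hB.
have key s t : 0 <= s -> s <= t ->
    l1b (fun n => cintegral 0 t (f^~ n) - cintegral 0 s (f^~ n)) (B * (t - s)).
  move=> s0 st N; rewrite -Rintegral_segment_cst//.
  rewrite (_ : bsum _ N = bsum (fun n => z1 (cintegral s t (f^~ n))) N); last first.
    by apply: bsum_eq => n _; rewrite cintegral_segmentB.
  apply: cintegral_l1 => //; first exact: integrable_segments_cst.
  apply: lebesgue_ae_imply hB => x hx /andP[sx _]; apply: hx; exact: le_trans sx.
have key2 s t : s <= t ->
    l1b (fun n => cintegral 0 t (f^~ n) - cintegral 0 s (f^~ n)) (B * (t - s)).
  move=> st; apply: l1b_le (l1b_ext _ (key (Num.max s 0) (Num.max t 0) _ _)).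
  - by rewrite ler_wpM2l//; case: (ltP t 0); case: (ltP s 0) => *; lra.
  - by move=> n; rewrite -!cintegral_max.
  - by rewrite le_max lexx orbT.
  - by case: (ltP t 0); case: (ltP s 0) => *; lra.
move=> s t; case: (leP s t) => st.
- apply: l1bB_sym; have := key2 _ _ st; rewrite -normrN opprB ger0_norm ?subr_ge0//.
  by apply: l1b_ext => n; rewrite opprD addrACA subrr add0r.
- have := key2 _ _ (ltW st); rewrite ger0_norm ?subr_ge0 1?ltW//.
  by apply: l1b_ext => n; rewrite opprD addrACA subrr add0r.
Qed.

End curves.

(** * Global Picard iteration in l1 *)

Lemma coord_segments (R : realType) (f : R -> int -> R[i]) : coord_continuous f ->
  (forall n, integrable_segments (fun x => complex.Re (f x n))) /\
  (forall n, integrable_segments (fun x => complex.Im (f x n))).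
Proof.
by move=> h; split=> n; apply: continuous_integrable_segments; case: (h n).
Qed.

Lemma le_small (R : realType) (a b : R) : (forall k, a <= b / 2 ^+ k) -> a <= 0.
Proof.
by move=> h; apply: (@cvgr_to_ge _ \oo _ _ _ _ _ (half_pow_cvg b)); exact: nearW.
Qed.

Section picard.
Context {R : realType}.
Notation mu := (@lebesgue_measure R).
Implicit Types (u w : R -> int -> R[i]).
Variables (G : (int -> R[i]) -> int -> R[i]) (phi : int -> R[i]) (K B : R).
Hypothesis K0 : 0 < K.
Hypothesis phi1 : l1 phi.
Hypothesis GB : forall v : int -> R[i], l1 v -> l1b (G v) B.
Hypothesis GK : forall (v w : int -> R[i]) (D : R), l1 v -> l1 w -> l1b (fun n => v n - w n) D ->
  l1b (fun n => G v n - G w n) (K * D).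

Definition duhamel u (t : R) (n : int) : R[i] :=
  phi n + cintegral 0 t (fun s => G (u s) n).

Lemma lipc_field u C : lipc u C -> l1 (u 0) -> lipc (fun s => G (u s)) (K * C).
Proof.
by move=> h h0 s t; rewrite -mulrA; apply: GK => //; exact: lipc_l1 h0.
Qed.

Lemma field_segments u C : lipc u C -> l1 (u 0) ->
  (forall n, integrable_segments (fun x => complex.Re (G (u x) n))) /\
  (forall n, integrable_segments (fun x => complex.Im (G (u x) n))).
Proof. by move=> h h0; exact: (coord_segments (lipc_continuous (lipc_field h h0))). Qed.

Lemma lipc_duhamel u C : lipc u C -> l1 (u 0) -> lipc (duhamel u) B.
Proof.
move=> h h0; have [h1 h2] := field_segments h h0.
apply: (lipc_primitive (f := fun s => G (u s))) => //.
  exact: l1b_ge0 (GB h0).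
by apply: aeW => x _; apply: GB; exact: lipc_l1 h0.
Qed.

Lemma duhamel0 u : duhamel u 0 = phi.
Proof. by apply/funext => n; rewrite /duhamel cintegral0 addr0. Qed.

(** In the norm weighted by [expR (2 * K * t)] the integral operator contracts
    by one half on the whole half line, whatever [K]; no gluing of local
    solutions is needed. *)
Lemma duhamel_contract u w C C' D t : lipc u C -> lipc w C' -> l1 (u 0) -> l1 (w 0) ->
  0 <= D -> (forall s, 0 <= s -> l1b (fun n => u s n - w s n) (D * expR (2 * K * s))) ->
  l1b (fun n => duhamel u t n - duhamel w t n) (D / 2 * expR (2 * K * `|t|)).
Proof.
move=> hu hw u0 w0 D0 huw.
have E0 : 0 <= D / 2 * expR (2 * K * `|t|) by rewrite mulr_ge0 ?divr_ge0 ?expR_ge0.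
case: (ltP t 0) => t0.
  apply: l1b_le E0 (l1b_ext _ l1b0) => n.
  by rewrite /duhamel !cintegral_neg// subrr.
have [u1 u2] := field_segments hu u0; have [w1 w2] := field_segments hw w0.
have K2 : 0 < 2 * K by rewrite mulr_gt0.
have cE : continuous (fun s => K * D * expR (2 * K * s)).
  move=> x; apply: cvgM; first exact: cvg_cst.
  apply: continuous_comp; last exact: continuous_expR.
  by apply: cvgM; [exact: cvg_cst|exact: cvg_id].
move=> N; apply: (@le_trans _ _ (\int[mu]_(s in `[0, t]) (K * D * expR (2 * K * s)))).
  rewrite (_ : bsum _ N = bsum (fun n =>
      z1 (cintegral 0 t (fun s => G (u s) n - G (w s) n))) N); last first.
    by apply: bsum_eq => n _; rewrite cintegralB// /duhamel opprD addrACA subrr add0r.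
  apply: (cintegral_l1 (f := fun s n => G (u s) n - G (w s) n)).
  - move=> n a b; have := integrableB _ (u1 n a b) (w1 n a b).
    rewrite (_ : EFin \o (fun x => complex.Re (G (u x) n - G (w x) n)) =
      (fun x => (complex.Re (G (u x) n))%:E - (complex.Re (G (w x) n))%:E)%E); first exact.
    by apply/funext => x /=; rewrite ReD ReN.
  - move=> n a b; have := integrableB _ (u2 n a b) (w2 n a b).
    rewrite (_ : EFin \o (fun x => complex.Im (G (u x) n - G (w x) n)) =
      (fun x => (complex.Im (G (u x) n))%:E - (complex.Im (G (w x) n))%:E)%E); first exact.
    by apply/funext => x /=; rewrite ImD ImN.
  - by move=> x; rewrite !mulr_ge0 ?expR_ge0// ltW.
  - exact: (continuous_integrable_segments cE).
  - apply: aeW => s /andP[s0 _]; rewrite -mulrA; apply: GK; last exact: huw.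
    + exact: lipc_l1 u0.
    + exact: lipc_l1 w0.
have iE : integrable_segments (fun s => expR (2 * K * s)).
  apply: continuous_integrable_segments => x.
  apply: continuous_comp; last exact: continuous_expR.
  by apply: cvgM; [exact: cvg_cst|exact: cvg_id].
rewrite RintegralZl//.
rewrite Rintegral_expR// ger0_norm//.
rewrite (_ : K * D * _ = D / 2 * (expR (2 * K * t) - 1)); last first.
  by field; rewrite gt_eqF.
by rewrite ler_wpM2l ?divr_ge0// gerBl.
Qed.

(** Two Lipschitz curves with the same initial value are at finite distance in
    the weighted norm, which starts the iteration of [duhamel_contract]. *)
Lemma le_lin_expR (C s : R) : 0 <= C -> 0 <= s -> C * s <= C / (2 * K) * expR (2 * K * s).
Proof.
move=> C0 s0; have K2 : 0 < 2 * K by rewrite mulr_gt0.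
rewrite -mulrA ler_wpM2l// mulrC ler_pdivlMr// mulrC.
by rewrite (le_trans _ (expR_ge1Dx _))// lerDr.
Qed.

Lemma duhamel_unique u w C C' : lipc u C -> lipc w C' ->
  (forall t, 0 <= t -> u t = duhamel u t) -> (forall t, 0 <= t -> w t = duhamel w t) ->
  forall t, 0 <= t -> u t = w t.
Proof.
move=> hu hw eu ew.
have u0 : u 0 = phi by rewrite eu// duhamel0.
have w0 : w 0 = phi by rewrite ew// duhamel0.
have pos (v : R -> int -> R[i]) c : lipc v c -> 0 <= c.
  by move=> /(_ 1 0) /l1b_ge0; rewrite subr0 normr1 mulr1.
have C0 := pos _ _ hu; have C0' := pos _ _ hw.
set D := (C + C') / (2 * K).
have D0 : 0 <= D by rewrite divr_ge0 ?addr_ge0 ?mulr_ge0// ltW.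
have main k s : 0 <= s -> l1b (fun n => u s n - w s n) (D / 2 ^+ k * expR (2 * K * s)).
  elim: k s => [|k IH] s s0.
    rewrite expr0 divr1; apply: l1b_le (le_lin_expR _ s0) _; first by rewrite addr_ge0.
    have := hu s 0; have := l1bB_sym (hw s 0); rewrite u0 w0 => h1 h2.
    by have := l1bB_trans h2 h1; rewrite -mulrDl subr0 ger0_norm.
  rewrite exprSr invfM mulrA.
  have -> : expR (2 * K * s) = expR (2 * K * `|s|) by rewrite ger0_norm.
  rewrite (eu _ s0) (ew _ s0).
  apply: duhamel_contract hu hw _ _ _ _ => //; rewrite ?u0 ?w0//.
  by rewrite divr_ge0 ?exprn_ge0.
move=> t t0; apply/funext => n; apply/eqP; rewrite -subr_eq0; apply/eqP/z1_le0.
apply: (@le_small _ _ (D * expR (2 * K * t))) => k.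
by rewrite mulrAC; exact: (l1b_term n (main k t t0)).
Qed.

Fixpoint picard_iter (k : nat) : R -> int -> R[i] :=
  if k is k'.+1 then duhamel (picard_iter k') else fun=> phi.

Lemma picard_exists : exists u, lipc u B /\ forall t, u t = duhamel u t.
Proof.
have B0 : 0 <= B := l1b_ge0 (GB phi1).
have lip k : lipc (picard_iter k) B /\ picard_iter k 0 = phi.
  elim: k => [|k [IH1 IH2]] /=.
    split=> // s t; apply: l1b_le (l1bB_refl _); by rewrite mulr_ge0.
  split; last exact: duhamel0.
  by apply: lipc_duhamel IH1 _; rewrite IH2.
have l10 k : l1 (picard_iter k 0) by rewrite (lip k).2.
pose D := B / (2 * K).
have D0 : 0 <= D by rewrite divr_ge0// mulr_ge0// ltW.
have step k t : l1b (fun n => picard_iter k.+1 t n - picard_iter k t n)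
    (D * expR (2 * K * `|t|) / 2 ^+ k).
  elim: k t => [|k IH] t.
    rewrite expr0 divr1; apply: l1b_le (le_lin_expR B0 (normr_ge0 t)) _.
    have := (lip 1%N).1 t 0; rewrite subr0.
    by apply: l1b_ext => n; rewrite (lip 1%N).2.
  have := @duhamel_contract (picard_iter k.+1) (picard_iter k) B B (D / 2 ^+ k) t
    (lip _).1 (lip _).1 (l10 _) (l10 _).
  have -> : D / 2 ^+ k / 2 * expR (2 * K * `|t|) = D * expR (2 * K * `|t|) / 2 ^+ k.+1.
    by rewrite exprSr invfM; ring.
  apply; first by rewrite divr_ge0 ?exprn_ge0.
  by move=> s s0; have := IH s; rewrite ger0_norm// mulrAC.
have [u hu] := choice (fun t => l1_complete (fun k => step k t)).
pose E (t : R) := D * expR (2 * K * `|t|).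
have lipu : lipc u B.
  move=> s t N; apply/ler_addgt0Pr => e e0.
  have /cvgrPdist_le /(_ _ e0)[k _ /(_ k (leqnn k))] := half_pow_cvg (2 * E s + 2 * E t).
  rewrite /= sub0r normrN => /(le_trans (ler_norm _)) he.
  have := l1bB_trans (l1bB_trans (hu s k) ((lip k).1 s t)) (l1bB_sym (hu t k)).
  move=> /(_ N) h; apply: le_trans h _.
  by move: he; rewrite /E mulrDl; lra.
have u0 : u 0 = phi.
  apply/funext => n; apply/eqP; rewrite -subr_eq0; apply/eqP/z1_le0.
  apply: le_small => k; rewrite -(lip k).2; exact: (l1b_term n (hu 0 k)).
exists u; split => // t; apply/funext => n.
apply/eqP; rewrite -subr_eq0; apply/eqP/z1_le0.
apply: (@le_small _ _ (2 * E t)) => k.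
have h1 := hu t k.+1.
have h2 : l1b (fun n => duhamel (picard_iter k) t n - duhamel u t n)
    (2 * D / 2 ^+ k / 2 * expR (2 * K * `|t|)).
  have l1u : l1 (u 0) by rewrite u0.
  apply: (@duhamel_contract (picard_iter k) u B B (2 * D / 2 ^+ k) t (lip k).1 lipu (l10 k) l1u) => [|s s0].
    by rewrite divr_ge0 ?exprn_ge0// mulr_ge0.
  apply: l1bB_sym; have := hu s k; rewrite ger0_norm//.
  by apply: l1b_le; rewrite mulrA mulrAC.
have := l1b_term n (l1bB_trans h1 h2); rewrite /= => h; apply: le_trans h _.
apply: eq_ler; rewrite /E exprSr invfM; field.
by rewrite expf_neq0.
Qed.

End picard.

(** * The nonlinearity as a vector field on l1 *)

Lemma z13 (R : realType) (z : R[i]) : z1 (3 * z) = 3 * z1 z.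
Proof. by rewrite -(ger0_norm (ler0n R 3)) -z1_realM rmorph_nat. Qed.

Lemma max_dist (R : realType) (c a b : R) :
  `|Num.max c a - Num.max c b| <= `|a - b|.
Proof.
wlog ba : a b / b <= a.
  by move=> h; case: (leP b a) => ab; [exact: h|rewrite distrC (distrC a) h// ltW].
rewrite [leRHS]ger0_norm ?subr_ge0//.
case: (leP c a); case: (leP c b) => h1 h2; rewrite ger0_norm; lra.
Qed.

Section field.
Context {R : realType}.
Implicit Types (v w : int -> R[i]) (A B D M : R).

Definition nrm v : R := sup (range (bsum (fun n => z1 (v n)))).

Lemma l1b_nrm v : l1 v -> l1b v (nrm v).
Proof.
move=> [A hA] N; apply: ub_le_sup; last by exists N.
by exists A => _ [k _ <-]; exact: hA.
Qed.

Lemma nrm_le v B : l1b v B -> nrm v <= B.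
Proof.
move=> h; apply: ge_sup; first by exists (bsum (fun n => z1 (v n)) 0%N), 0%N.
by move=> _ [k _ <-]; exact: h.
Qed.

Lemma nrm_ge0 v : l1 v -> 0 <= nrm v.
Proof. by move=> /l1b_nrm; exact: l1b_ge0. Qed.

Lemma nrm_dist v w D : l1 v -> l1 w -> l1b (fun n => v n - w n) D ->
  `|nrm v - nrm w| <= D.
Proof.
move=> hv hw hD; rewrite ler_norml; apply/andP; split.
- have := nrm_le (l1bD (l1bB_sym hD) (l1b_nrm hv)).
  by under eq_fun do rewrite subrK; lra.
- have := nrm_le (l1bD hD (l1b_nrm hw)).
  by under eq_fun do rewrite subrK; lra.
Qed.

(** Radial retraction onto the ball of radius [M] of l1. *)
Definition cutoff M v : R := M / Num.max M (nrm v).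

Definition clip M v (n : int) : R[i] := (cutoff M v)%:C * v n.

Lemma cutoff_gt0 M v : 0 < M -> 0 < cutoff M v.
Proof. by move=> M0; rewrite divr_gt0// lt_max M0. Qed.

Lemma cutoff_le1 M v : 0 < M -> cutoff M v <= 1.
Proof. by move=> M0; rewrite ler_pdivrMr ?lt_max ?M0// mul1r le_max lexx. Qed.

Lemma cutoff1 M v : 0 < M -> l1b v M -> cutoff M v = 1.
Proof.
by move=> M0 h; rewrite /cutoff max_l ?divff ?gt_eqF//; exact: nrm_le.
Qed.

Lemma clip_id M v : 0 < M -> l1b v M -> clip M v = v.
Proof. by move=> M0 h; apply/funext => n; rewrite /clip cutoff1// mul1r. Qed.

Lemma l1b_clip M v : 0 < M -> l1 v -> l1b (clip M v) M.
Proof.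
move=> M0 hv; have c0 := cutoff_gt0 v M0.
have := @l1b_mul _ (fun=> (cutoff M v)%:C) _ (cutoff M v) _ _ (l1b_nrm hv).
move=> h; apply: l1b_le (h _); last by move=> n; rewrite z1_real ger0_norm// ltW.
have m0 : 0 < Num.max M (nrm v) by rewrite lt_max M0.
by rewrite /cutoff mulrAC ler_pdivrMr// ler_wpM2l ?(ltW M0)// le_max lexx orbT.
Qed.

Lemma clip_dist M v w D : 0 < M -> l1 v -> l1 w -> l1b (fun n => v n - w n) D ->
  l1b (fun n => clip M v n - clip M w n) (2 * D).
Proof.
move=> M0 hv hw hD; have D0 := l1b_ge0 hD.
have h1 : l1b (fun n => (cutoff M v)%:C * (v n - w n)) (1 * D).
  apply: l1b_mul hD => n; rewrite z1_real ger0_norm ?cutoff_le1//.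
  by rewrite ltW// cutoff_gt0.
have h2 : l1b (fun n => (cutoff M v - cutoff M w)%:C * w n) D.
  apply: l1b_le (l1b_mul (C := `|cutoff M v - cutoff M w|) _ (l1b_nrm hw)); last first.
    by move=> n; rewrite z1_real.
  set a := Num.max M (nrm v); set b := Num.max M (nrm w).
  have a0 : 0 < a by rewrite lt_max M0.
  have b0 : 0 < b by rewrite lt_max M0.
  have Ma : M <= a by rewrite le_max lexx.
  have nb : nrm w <= b by rewrite le_max lexx orbT.
  have ab : `|b - a| <= D.
    rewrite distrC; exact: le_trans (max_dist _ _ _) (nrm_dist hv hw hD).
  have -> : cutoff M v - cutoff M w = M / a * ((b - a) / b).
    by rewrite /cutoff -/a -/b; field; rewrite ?gt_eqF.
  rewrite !normrM !normfV (gtr0_norm M0) (gtr0_norm a0) (gtr0_norm b0).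
  rewrite -!mulrA mulrA -[leRHS]mul1r.
  have nb1 : b^-1 * nrm w <= 1 by rewrite mulrC ler_pdivrMr// mul1r.
  have nb0 : 0 <= b^-1 * nrm w by rewrite mulr_ge0 ?nrm_ge0// invr_ge0 ltW.
  apply: ler_pM.
  - by rewrite divr_ge0// ltW.
  - by rewrite mulr_ge0.
  - by rewrite ler_pdivrMr ?mul1r.
  - by rewrite -[leRHS]mulr1; apply: ler_pM.
have := l1bD h1 h2; rewrite mul1r (_ : D + D = 2 * D); last lra.
by apply: l1b_ext => n; rewrite /clip rmorphB /=; ring.
Qed.

(** [\sum_n v_n v_{-n}], which is [\sum_n |v_n|^2] when [v_{-n}] is the
    conjugate of [v_n]. *)
Definition osq v : R := complex.Re (conv v v 0).

(** The plus root of the constraint.  The [max] keeps the square root Lipschitz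
    for every [v]; it is inactive where the solutions live. *)
Definition mean v : R := 6^-1 * (1 + Num.sqrt (Num.max 2^-1 (1 - 36 * osq v))).

(** The unknown of the evolution is the oscillating part; its mean mode is
    restored from the constraint. *)
Definition ext v (n : int) : R[i] := if n == 0 then (mean v)%:C else v n.

(** The Fourier coefficients of [u - 3 u^2]. *)
Definition quad v (n : int) : R[i] := v n - 3 * conv v v n.

Lemma osq_dist v w A B D : l1b v A -> l1b w B -> l1b (fun n => v n - w n) D ->
  `|osq v - osq w| <= D * (A + B).
Proof.
move=> hv hw hD; rewrite /osq -ReN -ReD; apply: le_trans (Re_le_z1 _) _.
exact: (l1b_term 0 (conv_sq_dist hv hw hD)).
Qed.

Lemma sqrt_dist (a b : R) : 2^-1 <= a -> 2^-1 <= b ->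
  `|Num.sqrt a - Num.sqrt b| <= `|a - b|.
Proof.
move=> ha hb; have a0 : 0 <= a by lra. have b0 : 0 <= b by lra.
have half : 2^-1 <= Num.sqrt (2^-1) :> R.
  rewrite -[leLHS]ger0_norm ?invr_ge0// -sqrtr_sqr ler_sqrt ?invr_gt0//.
  by rewrite expr2; lra.
have sa : 2^-1 <= Num.sqrt a by apply: le_trans half _; rewrite ler_sqrt// lt_le_trans ?ha.
have sb : 2^-1 <= Num.sqrt b by apply: le_trans half _; rewrite ler_sqrt// lt_le_trans ?hb.
have -> : a - b = (Num.sqrt a - Num.sqrt b) * (Num.sqrt a + Num.sqrt b).
  by rewrite -subr_sqr !sqr_sqrtr.
rewrite normrM ler_peMr// ger0_norm; lra.
Qed.

Lemma mean_dist v w : `|mean v - mean w| <= 6 * `|osq v - osq w|.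
Proof.
have h : `|Num.sqrt (Num.max 2^-1 (1 - 36 * osq v)) -
    Num.sqrt (Num.max 2^-1 (1 - 36 * osq w))| <= 36 * `|osq v - osq w|.
  apply: le_trans (sqrt_dist _ _) _; rewrite ?le_max ?lexx//.
  apply: le_trans (max_dist _ _ _) _.
  rewrite opprD addrACA subrr add0r opprK addrC -mulrBr normrM distrC.
  by rewrite ger0_norm.
rewrite /mean -mulrBr opprD addrACA subrr add0r normrM ger0_norm ?invr_ge0//.
by move: h; lra.
Qed.

Lemma mean_bound v A : l1b v A -> `|mean v| <= 3^-1 + 6 * A ^+ 2.
Proof.
move=> hv; have m0 : mean (fun=> 0 : R[i]) = 3^-1.
  rewrite /mean /osq (_ : conv _ _ 0 = 0) /=.
    rewrite mulr0 subr0 max_r ?invf_le1//; last lra.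
    by rewrite sqrtr1; lra.
  by apply/z1_le0; rewrite -[leRHS](mulr0 0); apply: (l1b_term 0 (l1b_convM l1b0 l1b0)).
have hd : l1b (fun n => v n - (fun=> 0 : R[i]) n) A.
  by apply: l1b_ext hv => n; rewrite subr0.
have := le_trans (mean_dist v (fun=> 0)) (ler_wpM2l _ (osq_dist hv l1b0 hd)).
rewrite m0 addr0 -expr2 => /(_ ltac:(lra)) h.
have := ler_normD (mean v - 3^-1) 3^-1; rewrite subrK [X in _ + X]ger0_norm; lra.
Qed.

Lemma l1b_single (a : R[i]) : l1b (fun n => if n == 0 then a else 0) (z1 a).
Proof.
elim=> [|N IH]; first by rewrite bsum0 eqxx.
rewrite bsumS (_ : (N.+1%:Z == 0) = false)// (_ : (- N.+1%:Z == 0) = false)//.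
by rewrite z10 !addr0.
Qed.

Lemma l1b_mean_ext v w A B : (forall n, n != 0 -> z1 (v n) <= z1 (w n)) ->
  z1 (v 0) <= B -> l1b w A -> l1b v (A + B).
Proof.
move=> vw v0 hw N; apply: le_trans (lerD (hw N) (l1b_le v0 (l1b_single (v 0)) N)).
rewrite -bsumD; apply: bsum_le => n _; case: eqP => [->|/eqP n0].
  by rewrite lerDr z1_ge0.
by rewrite z10 addr0 vw.
Qed.

Lemma l1b_extM v A : l1b v A -> l1b (ext v) (A + (3^-1 + 6 * A ^+ 2)).
Proof.
move=> hv; apply: (l1b_mean_ext _ _ hv) => [n n0|]; first by rewrite /ext (negbTE n0).
by rewrite /ext eqxx z1_real; exact: mean_bound.
Qed.

Lemma ext_dist v w A D : l1b v A -> l1b w A -> l1b (fun n => v n - w n) D ->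
  l1b (fun n => ext v n - ext w n) (D + 6 * (D * (A + A))).
Proof.
move=> hv hw hD; apply: (l1b_mean_ext _ _ hD) => [n n0|]; first by rewrite /ext (negbTE n0).
rewrite /ext eqxx -rmorphB z1_real; apply: le_trans (mean_dist v w) _.
by rewrite ler_wpM2l//; exact: osq_dist hv hw _.
Qed.

Lemma l1b_quad v A : l1b v A -> l1b (quad v) (A + 3 * (A * A)).
Proof.
move=> hv; apply: l1bB => //; apply: l1b_mul (l1b_convM hv hv) => _.
by rewrite -[3]mulr1 z13 (z1_real 1) normr1 mulr1.
Qed.

Lemma quad_dist v w A B D : l1b v A -> l1b w B -> l1b (fun n => v n - w n) D ->
  l1b (fun n => quad v n - quad w n) (D + 3 * (D * (A + B))).
Proof.
move=> hv hw hD.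
have h : l1b (fun n => 3 * (conv v v n - conv w w n)) (3 * (D * (A + B))).
  apply: l1b_mul (conv_sq_dist hv hw hD) => _.
  by rewrite -[3]mulr1 z13 (z1_real 1) normr1 mulr1.
by apply: l1b_ext (l1bB hD h) => n; rewrite /quad; ring.
Qed.

(** The nonlinearity, truncated far from the origin of l1 and with the mean
    mode replaced by its value on the constraint. *)
Definition tquad M v : int -> R[i] := quad (ext (clip M v)).

(** On the ball that contains the range of [clip] every factor is Lipschitz and
    bounded. *)
Lemma tquad_lipschitz M : 0 < M -> exists B K, [/\ 0 < B, 0 < K,
  forall v, l1 v -> l1b (tquad M v) B &
  forall v w D, l1 v -> l1 w -> l1b (fun n => v n - w n) D ->
    l1b (fun n => tquad M v n - tquad M w n) (K * D)].
Proof.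
move=> M0; set A := M + (3^-1 + 6 * M ^+ 2).
have A0 : 0 < A by rewrite addr_gt0// ltr_wpDr// mulr_ge0// sqr_ge0.
pose C := 1 + 6 * (M + M).
have C0 : 0 < C by rewrite ltr_wpDr// mulr_ge0// addr_ge0// ltW.
exists (A + 3 * (A * A)), (2 * C * (1 + 3 * (A + A))); split.
- by rewrite addr_gt0// !mulr_gt0.
- by rewrite !mulr_gt0// ltr_wpDr// mulr_ge0// addr_ge0// ltW.
- by move=> v hv; apply: l1b_quad; apply: l1b_extM; exact: l1b_clip.
move=> v w D hv hw hD.
have h1 := clip_dist M0 hv hw hD.
have h2 := ext_dist (l1b_clip M0 hv) (l1b_clip M0 hw) h1.
have := quad_dist (l1b_extM (l1b_clip M0 hv)) (l1b_extM (l1b_clip M0 hw)) h2.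
rewrite -/A; apply: l1b_le; apply: eq_ler.
rewrite /C; ring.
Qed.

(** The coefficients of the complex conjugate function; a fixed point is the
    Fourier series of a real function. *)
Definition flip v (n : int) : R[i] := conjc (v (- n)).

Lemma nrm_flip v : nrm (flip v) = nrm v.
Proof.
rewrite /nrm (_ : bsum (fun n => z1 (flip v n)) = bsum (fun n => z1 (v n)))//.
apply/funext => N; rewrite -bsum_opp; apply: bsum_eq => n _.
by rewrite z1_conj opprK.
Qed.

Lemma tquad_flip M v n : 0 < M -> l1 v -> tquad M (flip v) n = conjc (tquad M v (- n)).
Proof.
move=> M0 hv; set w := clip M v; have hw : l1b w M by exact: l1b_clip.
have cf : clip M (flip v) = flip w.
  apply/funext => k; rewrite /clip /cutoff nrm_flip /flip /w /clip /cutoff.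
  by rewrite conjcM conjc_real.
have mf : mean (flip w) = mean w.
  rewrite /mean /osq /flip (conv_flip 0 hw hw) oppr0; by case: (conv w w 0).
have ef : ext (flip w) = flip (ext w).
  apply/funext => k; rewrite /ext /flip oppr_eq0; case: eqP => // _.
  by rewrite mf conjc_real.
have he := l1b_extM hw.
rewrite /tquad cf ef /quad {2 3}/flip (conv_flip n he he).
by rewrite conjcB conjcM conjc_nat.
Qed.

End field.

(** The multiplier of the primitive in [x]: the inverse of [2 pi i n / L], and
    zero for the mean mode because the inverse of zero is zero. *)
Definition kap (R : realType) (L : R) (n : int) : R[i] :=
  - ('i%C * (L / (2 * pi * n%:~R))%:C).

Section kap.
Context {R : realType}.
Variable L : R.
Hypothesis L0 : 0 < L.

Lemma z1_kap n : z1 (kap L n) = L / (2 * pi) * `|n%:~R|^-1.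
Proof.
rewrite /kap z1N /z1 ReM ImM /= !mul0r mul1r subrr normr0 add0r add0r.
have pi0 := pi_gt0 R.
have pi2 : 0 < 2 * pi :> R by rewrite mulr_gt0.
rewrite mul1r invfM mulrA normrM normfV (gtr0_norm (x := L / _))//.
by rewrite divr_gt0.
Qed.

Lemma kap0 : kap L 0 = 0.
Proof. by rewrite /kap mulr0z mulr0 invr0 mulr0 mulr0 oppr0. Qed.

Lemma kap_conj n : conjc (kap L (- n)) = kap L n.
Proof.
rewrite /kap mulrNz mulrN invrN mulrN; set r := L / _.
by apply/eqP; rewrite eq_complex /=; apply/andP; split; apply/eqP; ring.
Qed.

Lemma abs_int_inv (n : int) : n != 0 -> `|n%:~R : R|^-1 <= 1.
Proof.
move=> n0; rewrite invf_le1 ?normr_gt0 ?intr_eq0//.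
by rewrite -intr_norm ler1z; lia.
Qed.

Lemma z1_kap_le n : z1 (kap L n) <= L / (2 * pi).
Proof.
have c0 : 0 <= L / (2 * pi) by rewrite divr_ge0 ?mulr_ge0 ?pi_ge0// ltW.
case: (eqVneq n 0) => [->|n0]; first by rewrite kap0 z10.
by rewrite z1_kap ler_piMr//; exact: abs_int_inv.
Qed.

Lemma z1_kapM n : `|n%:~R| * z1 (kap L n) <= L / (2 * pi).
Proof.
have c0 : 0 <= L / (2 * pi) by rewrite divr_ge0 ?mulr_ge0 ?pi_ge0// ltW.
case: (eqVneq n 0) => [->|n0]; first by rewrite normr0 mul0r.
by rewrite z1_kap mulrCA divff ?mulr1// normr_eq0 intr_eq0.
Qed.

End kap.

(** * Conservation of the energy *)

(** The partial sums of [sumsq_deriv]; working with them keeps the whole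
    argument in [R]. *)
Definition energy (R : realType) (N : nat) (v : int -> R[i]) : R :=
  bsum (fun n => n%:~R ^+ 2 * normc (v n) ^+ 2) N.

Section energy.
Context {R : realType}.
Notation mu := (@lebesgue_measure R).

Lemma energy_term_ge0 (v : int -> R[i]) n :
  0 <= n%:~R ^+ 2 * normc (v n) ^+ 2.
Proof. by rewrite mulr_ge0// sqr_ge0. Qed.

Lemma energy_mono (v : int -> R[i]) N M : (N <= M)%N -> energy N v <= energy M v.
Proof. by move=> NM; apply: bsum_mono => // n; exact: energy_term_ge0. Qed.

Lemma energy_term (v : int -> R[i]) P n : (forall N, energy N v <= P) ->
  `|n%:~R| * z1 (v n) <= 1 + 2 * P.
Proof.
move=> h; have h1 : n%:~R ^+ 2 * normc (v n) ^+ 2 <= P.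
  apply: le_trans (h `|n|%N).
  apply: (@bsum_ge_term _ (fun n => n%:~R ^+ 2 * normc (v n) ^+ 2)) => // k.
  exact: energy_term_ge0.
have h2 : (`|n%:~R| * z1 (v n)) ^+ 2 <= 2 * P.
  rewrite exprMn real_normK ?num_real//.
  by have := ler_wpM2l (sqr_ge0 (n%:~R : R)) (z1_sq_le (v n)); rewrite mulrCA; lra.
by set x := _ * _ in h2 *; nra.
Qed.

Lemma trunc_tail (v : int -> R[i]) N e :
  (forall M, bsum (fun n => z1 (v n)) M - bsum (fun n => z1 (v n)) N <= e) ->
  l1b (fun n => v n - trunc N v n) e.
Proof.
move=> h M; have : bsum (fun n => z1 (v n - trunc N v n)) (maxn M N) <= e.
  apply: le_trans (h (maxn M N)).
  rewrite (_ : bsum (fun n => z1 (v n)) N = bsum (fun n => z1 (trunc N v n)) (maxn M N)).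
    rewrite -bsumB; apply: bsum_le => n _; rewrite /trunc; case: ifP => _.
      by rewrite !subrr z10.
    by rewrite subr0 z10 subr0.
  have /subnKC <- := leq_maxr M N; elim: (_ - _)%N => [|k IH].
    by rewrite addn0; apply: bsum_eq => n nN; rewrite trunc_in.
  by rewrite addnS bsumS IH !trunc_out ?z10 ?addr0//; lia.
by apply: le_trans; apply: bsum_mono; rewrite ?leq_maxl// => n; exact: z1_ge0.
Qed.

Lemma is_derive_bsum (f : int -> R -> R) (df : int -> R) (t : R) N :
  (forall n, is_derive t 1 (f n) (df n)) ->
  is_derive t 1 (fun s => bsum (f^~ s) N) (bsum df N).
Proof.
move=> h; elim: N => [|N IH].
  by rewrite bsum0; under eq_fun do rewrite bsum0.
rewrite bsumS; under eq_fun do rewrite bsumS.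
exact: (is_deriveD IH (is_deriveD (h N.+1%:Z) (h (- N.+1%:Z)))).
Qed.

Variables (L : R) (L0 : 0 < L) (T : R) (T0 : 0 <= T).
Variables (y q : R -> int -> R[i]) (phi : int -> R[i]) (ka m : R -> R).
Variables (A B D P Aphi : R).
Hypothesis yA : forall t, l1b (y t) A.
Hypothesis qB : forall t, l1b (q t) B.
Hypothesis qc : coord_continuous q.
Hypothesis ysym : forall t n, y t (- n) = conjc (y t n).
(* the coefficients [ka] and [m] absorb the mean mode and the cutoff *)
Hypothesis qE : forall t n, n != 0 ->
  q t n = (ka t)%:C * y t n - (m t)%:C * conv (y t) (y t) n.
Hypothesis mD : forall t, `|m t| <= D.
Hypothesis yE : forall t, 0 <= t <= T -> forall n,
  y t n = phi n + kap L n * cintegral 0 t (q^~ n).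
Hypothesis phiA : l1b phi Aphi.
Hypothesis phiP : forall N, energy N phi <= P.

Let c0 := L / (2 * pi).
Let c0_ge0 : 0 <= c0.
Proof. by rewrite divr_ge0 ?mulr_ge0 ?pi_ge0// ltW. Qed.

Let B0 : 0 <= B := l1b_ge0 (qB 0).
Let A0 : 0 <= A := l1b_ge0 (yA 0).
Let D0 : 0 <= D := le_trans (normr_ge0 _) (mD 0).

Let z (t : R) (n : int) : R[i] := phi n + kap L n * cintegral 0 t (q^~ n).

Let l1_int t : 0 <= t <= T -> l1b (fun n => cintegral 0 t (q^~ n)) (B * T).
Proof.
move=> /andP[t0 tT].
have [h1 h2] := coord_segments qc.
have := lipc_primitive (fun=> 0) h1 h2 B0 (aeW mu (fun x _ => qB x)) t 0.
rewrite subr0 ger0_norm// => h.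
apply: l1b_le (ler_wpM2l B0 tT) _; apply: l1b_ext h => n.
by rewrite cintegral0 addr0 subr0 add0r.
Qed.

Let weighted_bound t n : 0 <= t <= T ->
  `|n%:~R| * z1 (y t n) <= 1 + 2 * P + c0 * (B * T).
Proof.
move=> tT; rewrite yE//.
have := ler_wpM2l (normr_ge0 (n%:~R : R)) (z1D (phi n) (kap L n * cintegral 0 t (q^~ n))).
move=> h; apply: le_trans h _; rewrite mulrDr lerD ?energy_term//.
have := ler_wpM2l (normr_ge0 (n%:~R : R)) (z1M (kap L n) (cintegral 0 t (q^~ n))).
move=> h; apply: le_trans h _; rewrite [leLHS]mulrA.
apply: ler_pM; rewrite ?mulr_ge0 ?z1_ge0//; first exact: z1_kapM.
exact: (l1b_term n (l1_int tT)).
Qed.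

(** The tail of [y t] is small uniformly in [t], since the multiplier decays
    like [1 / n]. *)
Let tail_bound t N e : 0 <= t <= T -> l1b (fun n => phi n - trunc N phi n) e ->
  l1b (fun n => y t n - trunc N (y t) n) (e + c0 / N.+1%:R * (B * T)).
Proof.
move=> tT hphi.
have h : l1b (fun n => (if (`|n| <= N)%N then 0 else kap L n) * cintegral 0 t (q^~ n))
    (c0 / N.+1%:R * (B * T)).
  apply: l1b_mul (l1_int tT) => n; case: ifP => [_|/negbT nN].
    by rewrite z10 divr_ge0.
  rewrite z1_kap// ler_wpM2l// lef_pV2 ?posrE ?ltr0n//; last first.
    by rewrite normr_gt0 intr_eq0; lia.
  by rewrite -intr_norm -(pmulrn 1) ler_nat; lia.
apply: l1b_ext (l1bD hphi h) => n; rewrite /trunc yE//.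
by case: ifP => _; rewrite ?subrr ?mul0r ?addr0// !subr0.
Qed.

Let is_derive_z (t : R) n : 0 < t ->
  is_derive t 1 (fun s => complex.Re (z s n)) (complex.Re (kap L n * q t n)) /\
  is_derive t 1 (fun s => complex.Im (z s n)) (complex.Im (kap L n * q t n)).
Proof.
move=> t0; have [cr ci] := qc n.
have dr := is_derive_Rintegral cr t0; have di := is_derive_Rintegral ci t0.
rewrite ReM ImM; split.
- have := is_deriveD (is_derive_cst (complex.Re (phi n)) t 1)
    (is_deriveB (is_deriveZ (complex.Re (kap L n)) dr) (is_deriveZ (complex.Im (kap L n)) di)).
  move=> h; apply: (is_derive_congr h) => [s|]; first by rewrite /z ReD ReM.
  by rewrite add0r.
- have := is_deriveD (is_derive_cst (complex.Im (phi n)) t 1)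
    (is_deriveD (is_deriveZ (complex.Re (kap L n)) di) (is_deriveZ (complex.Im (kap L n)) dr)).
  move=> h; apply: (is_derive_congr h) => [s|]; first by rewrite /z ImD ImM.
  by rewrite add0r.
Qed.

Let flux N t : R :=
  bsum (fun n => n%:~R ^+ 2 * (2 * (complex.Re (z t n) * complex.Re (kap L n * q t n) +
    complex.Im (z t n) * complex.Im (kap L n * q t n)))) N.

Let is_derive_energy N (t : R) : 0 < t ->
  is_derive t 1 (fun s => energy N (z s)) (flux N t).
Proof.
move=> t0; rewrite /energy /flux; apply: (@is_derive_bsum (fun n s =>
  n%:~R ^+ 2 * normc (z s n) ^+ 2)) => n.
have [dr di] := is_derive_z n t0.
have := is_deriveZ (n%:~R ^+ 2) (is_deriveD (is_deriveM dr dr) (is_deriveM di di)).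
move=> h; apply: (is_derive_congr h) => [s|]; first by rewrite normc_sq.
by rewrite /GRing.scale /=; ring.
Qed.

(** The linear part of [q] only rotates each mode, as [kap] is imaginary, so the
    flux is cubic. *)
Let flux_cubic N t : 0 <= t <= T ->
  flux N t = - (2 * c0 * m t) *
    complex.Im (bsum (fun n => n%:~R * y t (- n) * conv (y t) (y t) n) N).
Proof.
move=> tT; rewrite Im_bsum -bsumZ; apply: bsum_eq => n _.
have [->|n0] := eqVneq n 0; first by rewrite /= !mul0r mulr0 expr0n /= mul0r.
have -> : z t n = y t n by rewrite yE.
rewrite ysym qE//; set a := y t n; set b := conv _ _ n.
have n0' : n%:~R != 0 :> R by rewrite intr_eq0.
have -> : kap L n = - ('i%C * (c0 / n%:~R)%:C) by rewrite /kap /c0 invfM mulrA.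
have -> : (n%:~R : R[i]) = (n%:~R : R)%:C by rewrite rmorph_int.
case: a => a1 a2; case: b => b1 b2; move: (n%:~R : R) n0' => r r0 /=.
by field.
Qed.

Let flux_small N t e : 0 <= t <= T -> l1b (fun n => phi n - trunc N phi n) e ->
  `|flux N t| <= 2 * c0 * D * ((1 + 2 * P + c0 * (B * T)) *
    ((e + c0 / N.+1%:R * (B * T)) * (A + A))).
Proof.
move=> tT hphi; rewrite flux_cubic// normrM normrN normrM.
apply: ler_pM; rewrite ?mulr_ge0//.
- have c2 : 0 <= 2 * c0 by rewrite mulr_ge0.
  by rewrite (ger0_norm c2) ler_wpM2l.
- apply: le_trans (Im_le_z1 _) _; apply: cubic_small => //.
  + by move=> n; exact: weighted_bound.
  + exact: tail_bound.
Qed.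

Let continuous_energy N : continuous (fun s => energy N (z s)).
Proof.
have [h1 h2] := coord_segments qc.
have lz : lipc z (c0 * B).
  have lp := lipc_primitive (fun=> 0) h1 h2 B0 (aeW mu (fun x _ => qB x)).
  move=> s t; rewrite -mulrA; have := l1b_mul (z1_kap_le L0) (lp s t).
  by apply: l1b_ext => n; rewrite /z !add0r mulrBr opprD addrACA subrr add0r.
elim: N => [|N IH] s; rewrite /energy.
  under eq_fun do rewrite bsum0 mulr0z expr0n mul0r.
  exact: cvg_cst.
have term n : continuous (fun s => n%:~R ^+ 2 * normc (z s n) ^+ 2).
  have [cr ci] := lipc_continuous lz n.
  move=> x; under eq_fun do rewrite normc_sq.
  apply: cvgM; first exact: cvg_cst.
  exact: (cvgD (cvgM (cr x) (cr x)) (cvgM (ci x) (ci x))).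
under eq_fun do rewrite bsumS.
exact: (cvgD (IH s) (cvgD (term N.+1%:Z s) (term (- N.+1%:Z) s))).
Qed.

(** The energy of the modes [|n| <= M] varies at a rate given by a truncated
    cubic sum, which is small for large [M] because the full sum cancels.  The
    mean value inequality on [[0, T]] and [M -> oo] give the bound. *)
Lemma energy_conserved N : energy N (y T) <= P.
Proof.
have [<-|T00] := eqVneq 0 T.
  rewrite (_ : y 0 = phi)//; apply/funext => n.
  by rewrite yE ?lexx// cintegral0 mulr0 addr0.
have Tp : 0 < T by rewrite lt_neqAle T00.
have zT : y T = z T by apply/funext => n; rewrite yE// T0 lexx.
have z0 : z 0 = phi by apply/funext => n; rewrite /z cintegral0 mulr0 addr0.
have main M e : l1b (fun n => phi n - trunc M phi n) e ->
    energy M (y T) <= P + T * (2 * c0 * D * ((1 + 2 * P + c0 * (B * T)) *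
    ((e + c0 / M.+1%:R * (B * T)) * (A + A)))).
  move=> hphi.
  have dE x : x \in `]0, T[ -> is_derive x 1 (fun s => energy M (z s)) (flux M x).
    by rewrite in_itv /= => /andP[x0 _]; exact: is_derive_energy.
  have [c] := MVT Tp dE (continuous_subspaceT (@continuous_energy M)).
  rewrite in_itv /= z0 -zT subr0 => /andP[c1 c2] eE.
  have cT : 0 <= c <= T by rewrite !ltW.
  have -> : energy M (y T) = energy M phi + flux M c * T by rewrite -eE addrC subrK.
  apply: lerD => //; rewrite mulrC ler_wpM2l//.
  exact: le_trans (ler_norm _) (flux_small cT hphi).
apply/ler_addgt0Pr => e e0.
have P0 : 0 <= P by apply: le_trans (phiP 0); apply: bsum_ge0 => n; exact: energy_term_ge0.
pose X := T * (2 * c0 * D * (1 + 2 * P + c0 * (B * T)) * (A + A)).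
have BT : 0 <= B * T by rewrite mulr_ge0.
have X0 : 0 <= X.
  have q1 : 0 <= 2 * c0 * D by rewrite mulr_ge0// mulr_ge0.
  have q2 : 0 <= 1 + 2 * P + c0 * (B * T) by have := mulr_ge0 c0_ge0 BT; lra.
  have q3 : 0 <= A + A by rewrite addr_ge0.
  by apply: mulr_ge0 => //; apply: mulr_ge0 => //; apply: mulr_ge0.
have d0 : 0 < e / (2 * (X + 1)) by rewrite divr_gt0// mulr_gt0// ltr_wpDl.
set d := e / _ in d0.
have [N0 hN0] := l1b_tail phiA d0.
have := @archi_boundP _ (c0 * (B * T) / d) (divr_ge0 (mulr_ge0 c0_ge0 BT) (ltW d0)).
set k := Num.bound _ => hk.
pose M := maxn N (maxn N0 k).
have hphi : l1b (fun n => phi n - trunc M phi n) d.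
  apply: trunc_tail => M'; apply: le_trans (hN0 M'); rewrite lerD2l lerN2.
  apply: bsum_mono; first by move=> n; exact: z1_ge0.
  by rewrite /M !leq_max leqnn orbT.
have small : c0 / M.+1%:R * (B * T) <= d.
  rewrite mulrAC ler_pdivrMr ?ltr0n// -ler_pdivrMl// [leLHS]mulrC.
  apply: le_trans (ltW hk) _; rewrite ler_nat.
  by rewrite /M (leq_trans _ (leqnSn _))// !leq_max leqnn !orbT.
apply: le_trans (energy_mono _ (leq_maxl N (maxn N0 k))) _.
apply: le_trans (main M d hphi) _; rewrite lerD2l.
have -> : T * (2 * c0 * D * ((1 + 2 * P + c0 * (B * T)) *
    ((d + c0 / M.+1%:R * (B * T)) * (A + A)))) = X * (d + c0 / M.+1%:R * (B * T)).
  by rewrite /X; ring.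
apply: (@le_trans _ _ (X * (2 * d))).
  by rewrite ler_wpM2l// mulr_natl mulr2n lerD2l.
have X1 : 0 < X + 1 by rewrite ltr_wpDl.
have -> : X * (2 * d) = e * (X / (X + 1)) by rewrite /d; field; rewrite gt_eqF.
by rewrite ler_piMr ?(ltW e0)// ler_pdivrMr// mul1r lerDl.
Qed.

End energy.

(** * Sums over the nonzero integers and the space H *)

Section esum_bilateral.
Context {R : realType}.

Lemma int_window (N : nat) :
  [set n : int | (`|n| <= N)%N] = [set` [seq k%:Z - N%:Z | k <- iota 0 N.*2.+1]].
Proof.
have : N.*2.+1 = (N + N).+1 by rewrite addnn.
move: (N.*2.+1) => m hm; apply/seteqP; split => n /= h.
  apply/mapP; exists (absz (n + N%:Z)); last lia.
  by rewrite mem_iota; lia.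
by move/mapP : h => [k]; rewrite mem_iota => hk ->; lia.
Qed.

Lemma fsbig_bsum (f : int -> R) N :
  (\sum_(n \in [set n : int | (`|n| <= N)%N]) (f n)%:E)%E = (bsum f N)%:E.
Proof.
rewrite int_window -fsbig_seq; last first.
  by rewrite map_inj_uniq ?iota_uniq// => a b /= h; lia.
rewrite big_map; transitivity (\sum_(0 <= k < N.*2.+1) (f (k%:Z - N%:Z))%:E)%E.
  by rewrite /index_iota subn0.
by rewrite big_mkord sumEFin.
Qed.

Lemma finite_window N : finite_set [set n : int | (`|n| <= N)%N].
Proof. by rewrite int_window; exact: finite_seq. Qed.

Variable f : int -> R.
Hypothesis f0 : forall n, 0 <= f n.
Hypothesis f00 : f 0 = 0.

Lemma bsum_le_esum N : ((bsum f N)%:E <= \esum_(n in [set n : int | n != 0%R]) (f n)%:E)%E.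
Proof.
rewrite -fsbig_bsum esum_mkcond; apply: esum_ge.
exists [set n : int | (`|n| <= N)%N]; first by split => //; exact: finite_window.
apply: lee_fsum => [|n _]; first exact: finite_window.
case: ifPn => //; rewrite notin_setE /= => /negP; rewrite negbK => /eqP ->.
by rewrite f00.
Qed.

Lemma esum_le_bsum (P : R) : (forall N, bsum f N <= P) ->
  (\esum_(n in [set n : int | n != 0%R]) (f n)%:E <= P%:E)%E.
Proof.
move=> h; apply: ge_ereal_sup => _ [A [fA _] <-].
have [N AN] : exists N, A `<=` [set n : int | (`|n| <= N)%N].
  have [r ->] := (finite_seqP _).1 fA.
  exists (\max_(n <- r) absz n)%N => n /= nr.
  exact: (@leq_bigmax_seq _ r predT absz n).
apply: (@le_trans _ _ (bsum f N)%:E); last by rewrite lee_fin.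
rewrite -fsbig_bsum; apply: lee_fsum_nneg_subset => //.
- exact: finite_window.
- by move=> n /set_mem /AN; rewrite inE.
- by move=> n _; rewrite lee_fin.
Qed.

Lemma esum_lim (S : R) : bsum f @ \oo --> S ->
  (\esum_(n in [set n : int | n != 0%R]) (f n)%:E)%E = S%:E.
Proof.
move=> h; have bS N : bsum f N <= S.
  by apply: (@cvgr_to_ge _ \oo _ _ _ _ _ h); exists N => // M /= NM; exact: bsum_mono.
apply/eqP; rewrite eq_le esum_le_bsum//= leNgt; apply/negP => lt.
set E := esum _ _ in lt *.
have Efin : E \is a fin_num.
  rewrite ge0_fin_numE; first exact: lt_trans lt (ltry _).
  by apply: esum_ge0 => n _; rewrite lee_fin.
have : S <= fine E.
  apply: (@cvgr_to_le _ \oo _ _ _ _ _ h); apply: nearW => N.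
  by rewrite -lee_fin fineK//; exact: bsum_le_esum.
by rewrite -lee_fin fineK// leNgt lt.
Qed.

End esum_bilateral.

Section H_space.
Context {R : realType}.
Implicit Types v : int -> R[i].

Lemma sumsq_deriv_le v (P : R) :
  (sumsq_deriv v <= P%:E)%E <-> forall N, energy N v <= P.
Proof.
have h0 : (0 : int)%:~R ^+ 2 * normc (v 0) ^+ 2 = 0 :> R.
  by rewrite mulr0z expr0n mul0r.
split=> [h N|]; last exact: (esum_le_bsum (energy_term_ge0 v)).
by rewrite -lee_fin; apply: le_trans h; exact: bsum_le_esum h0 N.
Qed.

(** By induction through the telescoping majorant [2 N / (N + 1)]. *)
Lemma inv_sq_bsum N : bsum (fun n : int => (n%:~R ^+ 2)^-1 / 2 : R) N <= 2.
Proof.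
suff : bsum (fun n : int => (n%:~R ^+ 2)^-1 / 2 : R) N <= 2 * (N%:R / N.+1%:R).
  move=> h; apply: le_trans h _; rewrite ler_piMr// ler_pdivrMr ?ltr0n//.
  by rewrite mul1r ler_nat.
elim: N => [|N IH]; first by rewrite bsum0 mulr0z expr0n invr0 !mul0r mulr0.
rewrite bsumS; apply: le_trans (lerD IH (lexx _)) _.
have -> : (N.+1%:Z)%:~R = N.+1%:R :> R by [].
have -> : (- N.+1%:Z)%:~R = - N.+1%:R :> R by rewrite mulrNz.
rewrite sqrrN -[N.+2%:R]natr1 -[N.+1%:R]natr1.
have : 0 <= N%:R :> R by []; move: (N%:R : R) => x x0.
rewrite -subr_ge0.
have x1 : 0 < x + 1 by lra. have x2 : 0 < x + 1 + 1 by lra.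
have -> : 2 * ((x + 1) / (x + 1 + 1)) - (2 * (x / (x + 1)) +
   (((x + 1) ^+ 2)^-1 / 2 + ((x + 1) ^+ 2)^-1 / 2)) =
   x / ((x + 1) ^+ 2 * (x + 1 + 1)).
  by field; rewrite !gt_eqF.
by rewrite divr_ge0// mulr_ge0// ?sqr_ge0// ltW.
Qed.

(** Termwise, [z1 (v n) <= 1 / (2 n^2) + n^2 z1 (v n)^2 / 2], and
    [z1 (v n)^2] is at most twice the squared modulus. *)
Lemma h1_l1 v P : v 0 = 0 -> (forall N, energy N v <= P) -> l1b v (2 + P).
Proof.
move=> v0 h N; apply: le_trans (lerD (inv_sq_bsum N) (h N)).
rewrite /energy -bsumD; apply: bsum_le => n _.
have [->|n0] := eqVneq n 0.
  by rewrite v0 z10 mulr0z expr0n /= invr0 !mul0r addr0.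
have r0 : 0 < n%:~R ^+ 2 :> R by rewrite exprn_even_gt0// intr_eq0.
have := z1_sq_le (v n); move: (z1 (v n)) (normc _ ^+ 2) => x c.
move: (n%:~R ^+ 2 : R) r0 => r r0 hc.
have : 0 <= (r * x - 1) ^+ 2 by exact: sqr_ge0.
move=> h1; rewrite -subr_ge0.
have -> : r^-1 / 2 + r * c - x = ((r * x - 1) ^+ 2 + r ^+ 2 * (2 * c - x ^+ 2)) / (2 * r).
  by field; rewrite gt_eqF.
rewrite divr_ge0 ?mulr_ge0 ?(ltW r0)// addr_ge0// mulr_ge0 ?sqr_ge0// subr_ge0//.
Qed.

Lemma osq_bsum v A : v 0 = 0 -> l1b v A -> conj_symmetric v ->
  bsum (fun n => normc (v n) ^+ 2) @ \oo --> osq v.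
Proof.
move=> v0 hv sv; have [h _] := csum_cvg (conv_row 0 hv hv).
rewrite /osq /conv; apply: cvg_trans h; apply: near_eq_cvg; apply: nearW => N.
rewrite Re_bsum; apply: bsum_eq => n _.
by rewrite sub0r sv ReM normc_sq; case: (v n) => a b /=; ring.
Qed.

Definition osc v (n : int) : R[i] := if n == 0 then 0 else v n.

Lemma osc0 v : osc v 0 = 0. Proof. by rewrite /osc eqxx. Qed.

Lemma osc_sym v : conj_symmetric v -> conj_symmetric (osc v).
Proof.
by move=> h n; rewrite /osc oppr_eq0; case: eqP => // _; rewrite conjc0.
Qed.

Lemma energy_eq (v w : int -> R[i]) N : (forall n, n != 0 -> v n = w n) ->
  energy N v = energy N w.
Proof.
move=> h; apply: bsum_eq => n _; have [->|n0] := eqVneq n 0; last by rewrite h.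
by rewrite mulr0z expr0n !mul0r.
Qed.

Lemma energy_osc N v : energy N (osc v) = energy N v.
Proof. by apply: energy_eq => n n0; rewrite /osc (negbTE n0). Qed.

Lemma sumsq_osc_osq v A : l1b (osc v) A -> conj_symmetric v ->
  sumsq_osc v = (osq (osc v))%:E.
Proof.
move=> hv sv.
rewrite -(esum_lim _ _ (osq_bsum (osc0 v) hv (osc_sym sv))); last 2 first.
- by move=> n; rewrite sqr_ge0.
- by rewrite osc0 ComplexField.Normc.normc0 expr0n.
apply: eq_esum => n /= n0; by rewrite /osc (negbTE n0).
Qed.

Lemma osq_le_energy v P : v 0 = 0 -> conj_symmetric v ->
  (forall N, energy N v <= P) -> 0 <= osq v <= P.
Proof.
move=> v0 sv h; have hv := h1_l1 v0 h; have c := osq_bsum v0 hv sv.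
apply/andP; split.
  apply: (@cvgr_to_ge _ \oo _ _ _ _ _ c); apply: nearW => N.
  by apply: bsum_ge0 => n; exact: sqr_ge0.
apply: (@cvgr_to_le _ \oo _ _ _ _ _ c); apply: nearW => N.
apply: le_trans (h N); apply: bsum_le => n _.
have [->|n0] := eqVneq n 0; first by rewrite v0 ComplexField.Normc.normc0 expr0n mulr0.
rewrite ler_peMl ?sqr_ge0// -(real_normK (num_real _)) exprn_ege1// -intr_norm ler1z; lia.
Qed.

End H_space.

(** * Energy bounds for the evolution *)

Section flow.
Context {R : realType}.
Notation mu := (@lebesgue_measure R).

Lemma cintegralZ (c : R[i]) (f : R -> R[i]) a b :
  integrable_segments (fun x => complex.Re (f x)) ->
  integrable_segments (fun x => complex.Im (f x)) ->
  cintegral a b (fun s => c * f s) = c * cintegral a b f.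
Proof.
move=> h1 h2; case: c => c d.
have e1 (x : R) g : integrable_segments g -> integrable_segments (fun s => x * g s).
  by move=> hg u v; have := integrableZl _ x (hg u v); apply.
have -> : (c +i* d) * cintegral a b f = (c * \int[mu]_(s in `[a, b]) complex.Re (f s) -
   d * \int[mu]_(s in `[a, b]) complex.Im (f s)) +i*
   (c * \int[mu]_(s in `[a, b]) complex.Im (f s) +
   d * \int[mu]_(s in `[a, b]) complex.Re (f s)) by [].
have i1 := h1 a b; have i2 := h2 a b.
rewrite -!RintegralZl// -RintegralB//; [|exact: e1|exact: e1].
rewrite -RintegralD//; [|exact: e1|exact: e1].
by congr (_ +i* _); apply: eq_Rintegral => x _; [rewrite ReM|rewrite ImM].
Qed.

Lemma cintegral_conj (f : R -> R[i]) a b :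
  integrable_segments (fun x => complex.Im (f x)) ->
  cintegral a b (fun s => conjc (f s)) = conjc (cintegral a b f).
Proof.
move=> h2; rewrite /cintegral /= -mulN1r -RintegralZl//.
by congr (_ +i* _); apply: eq_Rintegral => x _; case: (f x) => p q //=; rewrite mulN1r.
Qed.

Lemma eq_cintegral (f g : R -> R[i]) a b : (forall s, a <= s <= b -> f s = g s) ->
  cintegral a b f = cintegral a b g.
Proof.
move=> h; rewrite /cintegral; congr (_ +i* _); apply: eq_Rintegral => x;
  by rewrite inE /= in_itv /= => /h ->.
Qed.

Definition single (a : R[i]) (n : int) : R[i] := if n == 0 then a else 0.

Lemma conv_single (a : R[i]) w n : conv (single a) w n = a * w n.
Proof.
rewrite /conv (@csum_finite _ _ 0) => [|k k0].
  by rewrite bsum0 /single eqxx subr0.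
by rewrite /single (_ : (k == 0) = false) ?mul0r//; lia.
Qed.

(** If [w] has mean mode [r] and is elsewhere a real multiple of [y], its
    nonlinearity is off the mean mode a real combination of [y] and [y * y], the
    form for which the energy is conserved. *)
Lemma quad_split (w y : int -> R[i]) lam r A n : l1b y A -> y 0 = 0 ->
  w 0 = r%:C -> (forall k, k != 0 -> w k = lam%:C * y k) -> n != 0 ->
  quad w n = (lam * (1 - 6 * r))%:C * y n - (3 * lam ^+ 2)%:C * conv y y n.
Proof.
move=> hy y0 w0 wE n0.
pose w' k := lam%:C * y k.
have hw' : l1b w' (`|lam| * A) by apply: l1b_mul hy => k; rewrite z1_real.
have ws k : w k - w' k = single r%:C k.
  rewrite /single /w'; case: eqP => [->|/eqP k0]; first by rewrite w0 y0 mulr0 subr0.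
  by rewrite wE// subrr.
have hs : l1b (single r%:C) (z1 r%:C) by exact: l1b_single.
have hw : l1b w (z1 r%:C + `|lam| * A).
  by apply: l1b_ext (l1bD hs hw') => k; rewrite -ws subrK.
have := conv_sqB n hw hw'.
rewrite (_ : (fun k => w k - w' k) = single r%:C); last by apply/funext.
rewrite conv_single (convC n hw' hs) conv_single.
rewrite (convZ lam%:C lam%:C n hy hy) => h.
rewrite /quad -[conv w w n](subrK (lam%:C * lam%:C * conv y y n)) h /w' wE//.
have h3 : (3 : R[i]) = (3 : R)%:C by rewrite rmorph_nat.
rewrite h3; case: (y n) => a b; case: (conv y y n) => c d.
by apply/eqP; rewrite eq_complex /=; apply/andP; split; apply/eqP; ring.
Qed.

(** Composing a curve with [clamp T] turns bounds on [[0, T]] into the bounds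
    for all times that [energy_conserved] asks for. *)
Definition clamp (T t : R) : R := Num.max 0 (Num.min t T).

Lemma clamp_in T t : 0 <= T -> 0 <= clamp T t <= T.
Proof. by move=> T0; rewrite /clamp le_max lexx ge_max T0 ge_min lexx orbT. Qed.

Lemma clamp_id T t : 0 <= t <= T -> clamp T t = t.
Proof. by move=> /andP[t0 tT]; rewrite /clamp min_l// max_r. Qed.

Lemma clamp_dist T s t : `|clamp T s - clamp T t| <= `|s - t|.
Proof.
apply: le_trans (max_dist _ _ _) _.
have := max_dist (- T) (- s) (- t); rewrite -!oppr_min opprK.
by rewrite opprK -normrN opprD opprK -[leRHS]normrN opprD opprK !(minC T).
Qed.

(** The factor [lam] is the cutoff for the truncated evolution, and [1] for a
    generalized solution. *)
Lemma energy_flow (L : R) (y w : R -> int -> R[i]) (phi : int -> R[i])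
    (lam r : R -> R) (Cy Cw P : R) : 0 < L ->
  lipc y Cy -> l1 (y 0) -> lipc w Cw -> l1 (w 0) ->
  (forall t, y t 0 = 0) -> (forall t, conj_symmetric (y t)) ->
  (forall t n, n != 0 -> w t n = (lam t)%:C * y t n) ->
  (forall t, w t 0 = (r t)%:C) -> (forall t, 0 <= lam t <= 1) ->
  (forall t, 0 <= t -> forall n,
     y t n = phi n + kap L n * cintegral 0 t (fun s => quad (w s) n)) ->
  (forall N, energy N phi <= P) ->
  forall T, 0 <= T -> forall N, energy N (y T) <= P.
Proof.
move=> L0 ly y1 lw w1 y0 ysym wE w0 lam1 yE phiP T T0 N.
have Cpos (u : R -> int -> R[i]) c : lipc u c -> 0 <= c.
  by move=> /(_ 1 0) /l1b_ge0; rewrite subr0 normr1 mulr1.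
have bnd (u : R -> int -> R[i]) c : lipc u c -> l1 (u 0) ->
    exists A, forall t, l1b (u (clamp T t)) A.
  move=> hu [A hA]; exists (c * T + A) => t; have /andP[c1 c2] := clamp_in t T0.
  apply: l1b_le (l1b_ext _ (l1bD (hu (clamp T t) 0) hA)).
    by rewrite lerD2r subr0 ger0_norm// ler_wpM2l// (Cpos _ _ hu).
  by move=> n; rewrite subrK.
have [A hA] := bnd _ _ ly y1; have [Aw hw] := bnd _ _ lw w1.
have [Aphi hphi] : l1 phi.
  case: y1 => a ha; exists a; apply: l1b_ext ha => n.
  by rewrite yE// cintegral0 mulr0 addr0.
have qlip : lipc (fun t => quad (w (clamp T t))) (Cw * (1 + 3 * (Aw + Aw))).
  move=> s t; have h : l1b (fun n => w (clamp T s) n - w (clamp T t) n) (Cw * `|s - t|).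
    apply: l1b_le (lw _ _); rewrite ler_wpM2l ?(Cpos _ _ lw)//; exact: clamp_dist.
  apply: l1b_le (quad_dist (hw s) (hw t) h).
  by apply: eq_ler; ring.
rewrite -(clamp_id (t := T) (T := T)) ?T0 ?lexx//.
apply: (@energy_conserved R L L0 T T0 (fun t => y (clamp T t))
  (fun t => quad (w (clamp T t))) phi
  (fun t => lam (clamp T t) * (1 - 6 * r (clamp T t)))
  (fun t => 3 * lam (clamp T t) ^+ 2) A (Aw + 3 * (Aw * Aw)) 3 P Aphi) => //.
- by move=> t; apply: l1b_quad; exact: hw.
- exact: lipc_continuous qlip.
- by move=> t n; exact: ysym.
- move=> t n n0; apply: quad_split (hA t) _ _ _ n0 => // k k0; exact: wE.
- move=> t; have /andP[l0 l1'] := lam1 (clamp T t).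
  by rewrite ger0_norm ?mulr_ge0 ?sqr_ge0// ler_piMr// exprn_ile1.
- move=> t tT n; rewrite clamp_id//; case/andP: (tT) => t0 tT'.
  rewrite (yE t t0 n).
  suff -> : cintegral 0 t (fun s => quad (w s) n) =
    cintegral 0 t (fun s => quad (w (clamp T s)) n) by [].
  apply: eq_cintegral => s /andP[s0 st].
  by rewrite clamp_id// s0 (le_trans st).
Qed.

End flow.

(** * Existence and uniqueness of the flow *)

Section small_data.
Context {R : realType}.
Implicit Types v : int -> R[i].

(** The invariant region.  In it [\sum_n |v_n|^2 <= 72^-1], so that the
    discriminant [1 - 36 * osq v] is at least [2^-1]. *)
Definition small v : Prop :=
  [/\ v 0 = 0, conj_symmetric v & forall N, energy N v <= 72^-1].

Lemma small_l1 v : small v -> l1b v 3.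
Proof. by move=> [v0 _ h]; apply: l1b_le (h1_l1 v0 h); lra. Qed.

Lemma small_osq v : small v -> 0 <= osq v <= 72^-1.
Proof. by move=> [v0 sv h]; exact: osq_le_energy. Qed.

Lemma small_mean v : small v -> mean v = 6^-1 * (1 + Num.sqrt (1 - 36 * osq v)).
Proof. by move=> /small_osq h; rewrite /mean max_r//; lra. Qed.

Lemma small_tquad v : small v -> tquad 3 v = quad (ext v).
Proof. by move=> /small_l1 h; rewrite /tquad clip_id. Qed.

Lemma osc_small v : conj_symmetric v -> (forall N, energy N v <= 72^-1) ->
  small (osc v).
Proof.
move=> sv h; split; [exact: osc0|exact: osc_sym|].
by move=> N; rewrite energy_osc.
Qed.

Lemma plus_root_mean v : conj_symmetric v -> (forall N, energy N v <= 72^-1) ->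
  plus_root v <-> v 0 = (mean (osc v))%:C.
Proof.
move=> sv h; have so := osc_small sv h.
rewrite /plus_root (sumsq_osc_osq (small_l1 so) sv) small_mean//= lee_fin.
split=> [[]//|->]; split=> //.
by have := small_osq so; lra.
Qed.

Lemma ext_osc v : v 0 = (mean (osc v))%:C -> ext (osc v) = v.
Proof.
by move=> h; apply/funext => n; rewrite /ext /osc; case: eqP => // ->; rewrite h.
Qed.

Lemma osc_ext v : v 0 = 0 -> osc (ext v) = v.
Proof. by move=> h; apply/funext => n; rewrite /ext /osc; case: eqP => // ->. Qed.

Lemma ext_sym v : conj_symmetric v -> conj_symmetric (ext v).
Proof.
move=> h n; rewrite /ext oppr_eq0; case: eqP => // _; by rewrite conjc_real.
Qed.

Lemma lipc_ext (u : R -> int -> R[i]) B A : lipc u B -> (forall t, l1b (u t) A) ->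
  lipc (fun t => ext (u t)) (B * (1 + 6 * (A + A))).
Proof.
move=> lu uA s t; apply: l1b_le (ext_dist (uA s) (uA t) (lu s t)).
by apply: eq_ler; ring.
Qed.

Lemma lipc_quad (u : R -> int -> R[i]) B A : lipc u B -> (forall t, l1b (u t) A) ->
  lipc (fun t => quad (u t)) (B * (1 + 3 * (A + A))).
Proof.
move=> lu uA s t; apply: l1b_le (quad_dist (uA s) (uA t) (lu s t)).
by apply: eq_ler; ring.
Qed.

Variables (L : R) (phi : int -> R[i]).
Hypothesis L0 : 0 < L.
Hypothesis phi_small : small phi.

Let G v (n : int) : R[i] := kap L n * tquad 3 v n.

Let c0 := L / (2 * pi).
Let c0_gt0 : 0 < c0.
Proof. by rewrite divr_gt0// mulr_gt0// pi_gt0. Qed.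

Let G_props : exists B K, [/\ 0 < K, forall v, l1 v -> l1b (G v) B &
  forall v w D, l1 v -> l1 w -> l1b (fun n => v n - w n) D ->
    l1b (fun n => G v n - G w n) (K * D)].
Proof.
have [B [K [B0 K0 hB hK]]] := tquad_lipschitz (ltr0Sn R 2).
exists (c0 * B), (c0 * K); split; first by rewrite mulr_gt0.
  by move=> v hv; exact: l1b_mul (z1_kap_le L0) (hB _ hv).
move=> v w D hv hw hD; rewrite -mulrA.
have := l1b_mul (z1_kap_le L0) (hK _ _ _ hv hw hD).
by apply: l1b_ext => n; rewrite /G mulrBr.
Qed.

(** The truncated evolution exists for all times.  It commutes with [flip], so
    by uniqueness it stays real; then [energy_flow] keeps it in the region
    [small], where the l1 norm is at most [3] and clipping at radius [3] does
    nothing. *)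
Lemma flow_exists : exists (u : R -> int -> R[i]) (C : R),
  [/\ lipc u C, forall t, small (u t) &
  forall t n, u t n = phi n + kap L n * cintegral 0 t (fun s => quad (ext (u s)) n)].
Proof.
have [B [K [K0 GB GK]]] := G_props.
have phi1 : l1 phi by exists 3; exact: small_l1.
have [u [lu uE]] := picard_exists K0 phi1 GB GK.
have [phi0 phis phiP] := phi_small.
have u0 : u 0 = phi by rewrite uE duhamel0.
have u1 t : l1 (u t) by apply: lipc_l1 lu _; rewrite u0.
have [B' [K' [_ _ tB tK]]] := tquad_lipschitz (ltr0Sn R 2).
have lt : lipc (fun s => tquad 3 (u s)) (K' * B).
  by move=> s t; rewrite -mulrA; apply: tK => //; exact: lu.
have [seg1 seg2] := coord_segments (lipc_continuous lt).
have uE' t n : u t n = phi n + kap L n * cintegral 0 t (fun s => tquad 3 (u s) n).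
  by rewrite {1}uE /duhamel cintegralZ.
have uneg t : t < 0 -> u t = phi.
  by move=> t0; apply/funext => n; rewrite uE' cintegral_neg// mulr0 addr0.
have uz t : u t 0 = 0 by rewrite uE' kap0 mul0r addr0.
have usym t : conj_symmetric (u t).
  case: (ltP t 0) => [/uneg -> //|t0].
  have lf : lipc (fun s => flip (u s)) B.
    move=> s s'; have := l1b_conj (l1b_opp (lu s s')).
    by apply: l1b_ext => n; rewrite conjcB.
  have fE s : 0 <= s -> flip (u s) = duhamel G phi (fun s' => flip (u s')) s.
    move=> _; apply/funext => n; rewrite {1}/flip uE' /duhamel.
    have -> : cintegral 0 s (fun s' => G (flip (u s')) n) =
        cintegral 0 s (fun s' => kap L n * conjc (tquad 3 (u s') (- n))).
      by apply: eq_cintegral => s' _; rewrite /G tquad_flip.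
    have cs1 : integrable_segments (fun x => complex.Re (conjc (tquad 3 (u x) (- n)))).
      rewrite (_ : (fun x => _) = fun x => complex.Re (tquad 3 (u x) (- n))); first exact: seg1.
      by apply/funext => x; case: (tquad 3 (u x) (- n)).
    have cs2 : integrable_segments (fun x => complex.Im (conjc (tquad 3 (u x) (- n)))).
      move=> a b; have := integrableZl _ (-1) (seg2 (- n) a b).
      move=> h; rewrite (_ : EFin \o _ = (fun x => (-1)%:E * (complex.Im (tquad 3 (u x) (- n)))%:E)%E).
        exact: h.
      by apply/funext => x /=; rewrite -EFinM mulN1r; case: (tquad 3 (u x) (- n)).
    rewrite cintegralZ// cintegral_conj//.
    by rewrite conjcD conjcM kap_conj phis conjcK.
  have e := duhamel_unique K0 phi1 GK lu lf (fun s _ => uE s) fE t0.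
  by move=> n; rewrite {2}e /flip conjcK.
pose w s := ext (clip 3 (u s)).
have lw : lipc w (2 * B * (1 + 6 * (3 + 3))).
  move=> s t; have h1 := clip_dist (ltr0Sn R 2) (u1 s) (u1 t) (lu s t).
  have c3 x := l1b_clip (ltr0Sn R 2) (u1 x).
  apply: l1b_le (ext_dist (c3 s) (c3 t) h1).
  by apply: eq_ler; ring.
have uen t N : energy N (u t) <= 72^-1.
  case: (ltP t 0) => [/uneg -> //|t0].
  apply: (energy_flow (w := w) (phi := phi) (lam := fun s => cutoff 3 (u s))
    (r := fun s => mean (clip 3 (u s))) L0 lu (u1 0) lw) => //.
  - by exists (3 + (3^-1 + 6 * 3 ^+ 2)); apply: l1b_extM; apply: l1b_clip.
  - by move=> s n n0; rewrite /w /ext (negbTE n0).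
  - by move=> s; rewrite cutoff_le1// ltW// cutoff_gt0.
exists u, B; split; [exact: lu|by move=> t; split; [exact: uz|exact: usym|exact: uen]|].
move=> t n; rewrite (uE' t n).
suff -> : cintegral 0 t (fun s => tquad 3 (u s) n) =
    cintegral 0 t (fun s => quad (ext (u s)) n) by [].
by apply: eq_cintegral => s _; rewrite small_tquad.
Qed.

Lemma flow_unique (u v : R -> int -> R[i]) C C' : lipc u C -> lipc v C' ->
  (forall t, small (u t)) -> (forall t, small (v t)) ->
  (forall t, 0 <= t -> forall n,
    u t n = phi n + kap L n * cintegral 0 t (fun s => quad (ext (u s)) n)) ->
  (forall t, 0 <= t -> forall n,
    v t n = phi n + kap L n * cintegral 0 t (fun s => quad (ext (v s)) n)) ->
  forall t, 0 <= t -> u t = v t.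
Proof.
have [B [K [K0 GB GK]]] := G_props.
have phi1 : l1 phi by exists 3; exact: small_l1.
have main w B' : lipc w B' -> (forall t, small (w t)) ->
    (forall t, 0 <= t -> forall n,
      w t n = phi n + kap L n * cintegral 0 t (fun s => quad (ext (w s)) n)) ->
    forall t, 0 <= t -> w t = duhamel G phi w t.
  move=> lw sw wE t t0; apply/funext => n; rewrite (wE t t0 n) /duhamel.
  have w3 s := small_l1 (sw s).
  have [h1 h2] := coord_segments (lipc_continuous
    (lipc_quad (lipc_ext lw w3) (fun s => l1b_extM (w3 s)))).
  rewrite -cintegralZ; [|exact: h1|exact: h2].
  apply: (congr1 (fun z => phi n + z)); apply: eq_cintegral => s _.
  by rewrite /G small_tquad.
move=> lu lv su sv uE vE; apply: (duhamel_unique K0 phi1 GK lu lv).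
- exact: main lu su uE.
- exact: main lv sv vE.
Qed.

End small_data.

(** * Taylor estimates in time *)

Section time_regularity.
Context {R : realType}.
Notation mu := (@lebesgue_measure R).

Lemma cintegral_cst (z : R[i]) a b : a <= b -> cintegral a b (fun=> z) = (b - a)%:C * z.
Proof.
move=> ab; rewrite /cintegral !Rintegral_segment_cst//; case: z => c d /=.
by apply/eqP; rewrite eq_complex /=; apply/andP; split; apply/eqP; ring.
Qed.

(** Between [s] and [t], [f] differs from [f t] by at most [K * |s - t|] in l1;
    integrate with [cintegral_l1]. *)
Lemma l1_taylor (f : R -> int -> R[i]) K s t : lipc f K -> 0 <= s -> 0 <= t ->
  l1b (fun n => cintegral 0 s (f^~ n) - cintegral 0 t (f^~ n) - (s - t)%:C * f t n)
    (K * (s - t) ^+ 2).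
Proof.
move=> lf; have K0 : 0 <= K by have /l1b_ge0 := lf 1 0; rewrite subr0 normr1 mulr1.
have [h1 h2] := coord_segments (lipc_continuous lf).
have key a b c : 0 <= a -> a <= b -> a <= c <= b ->
    l1b (fun n => cintegral 0 b (f^~ n) - cintegral 0 a (f^~ n) - (b - a)%:C * f c n)
    (K * (b - a) ^+ 2).
  move=> a0 ab /andP[ac cb] N.
  rewrite (_ : bsum _ N = bsum (fun n => z1 (cintegral a b (fun x => f x n - f c n))) N); last first.
    apply: bsum_eq => n _.
    rewrite (cintegralB _ _ (h1 n) (h2 n)) ?cintegral_cst//.
    - by rewrite (cintegral_segmentB (h1 n) (h2 n) a0 ab).
    - exact: integrable_segments_cst.
    - exact: integrable_segments_cst.
  have -> : K * (b - a) ^+ 2 = \int[mu]_(x in `[a, b]) (K * (b - a)).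
    by rewrite Rintegral_segment_cst// expr2 mulrA.
  have lc : lipc (fun x n => f x n - f c n) K.
    by move=> x y; apply: l1b_ext (lf x y) => n; rewrite opprB addrA subrK.
  have [d1 d2] := coord_segments (lipc_continuous lc).
  apply: (cintegral_l1 (f := fun x n => f x n - f c n)) => //.
  - by move=> x; rewrite mulr_ge0// subr_ge0.
  - exact: integrable_segments_cst.
  apply: aeW => x /andP[ax xb]; apply: le_trans (lf x c N) _.
  by rewrite ler_wpM2l// ler_norml; apply/andP; split; lra.
case: (leP t s) => [ts _ t0|st s0 _].
  by apply: key => //; rewrite lexx.
have := l1bN (key s t t s0 (ltW st) _); rewrite lexx (ltW st) => /(_ isT).
rewrite (_ : (t - s) ^+ 2 = (s - t) ^+ 2); last ring.
apply: l1b_ext => n; rewrite opprB opprB -[s - t]opprB rmorphN mulNr opprK.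
by rewrite addrC.
Qed.

Lemma remainder_derive (f : R -> R) (t l : R) :
  (forall e, 0 < e -> \forall s \near t, `|f s - f t - (s - t) * l| <= e * `|s - t|) ->
  is_derive t 1 f l.
Proof.
move=> h.
have dq : h^-1 *: (f (h + t) - f t) @[h --> 0^'] --> l.
  apply/cvgrPdist_le => e e0.
  have h' : \forall s \near (0 : R), `|f (s + t) - f t - s * l| <= e * `|s|.
    move/nbhs_ballP : (h e e0) => [d d0 hd]; apply/nbhs_ballP; exists d => // s.
    rewrite /ball /= sub0r normrN => sd.
    have := hd (s + t); rewrite /ball /= opprD addrCA subrr addr0 normrN => /(_ sd).
    by rewrite addrK.
  near=> x.
  have x0 : x != 0 by near: x; exact: nbhs_dnbhs_neq.
  have hx : `|f (x + t) - f t - x * l| <= e * `|x|.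
    near: x; exact: (@nbhs_dnbhs _ _ _ h').
  rewrite distrC (_ : _ - l = x^-1 * (f (x + t) - f t - x * l)); last first.
    by rewrite mulrBr mulrA mulVf// mul1r.
  by rewrite normrM normfV ler_pdivrMl ?normr_gt0// [leRHS]mulrC.
have dt : derivable f t 1.
  apply/cvg_ex; exists l; apply: cvg_trans dq; apply: near_eq_cvg; apply: nearW => x.
  by rewrite /= /GRing.scale /= mulr1.
apply: DeriveDef => //; apply: cvg_lim => //.
apply: cvg_trans dq; apply: near_eq_cvg; apply: nearW => x.
by rewrite /= /GRing.scale /= mulr1.
Unshelve. all: by end_near. Qed.

Lemma near_dist_le (t e : R) : 0 < e -> \forall s \near t, `|s - t| <= e.
Proof.
move=> e0; have /cvgrPdist_le /(_ _ e0) : (fun y : R => y) @ t --> t by exact: cvg_id.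
by apply: filterS => s; rewrite distrC.
Qed.

Lemma quadratic_derive (f : R -> R) (t l C : R) :
  (\forall s \near t, `|f s - f t - (s - t) * l| <= C * (s - t) ^+ 2) ->
  is_derive t 1 f l.
Proof.
move=> h; apply: remainder_derive => e e0.
have C1 : 0 < `|C| + 1 by rewrite ltr_wpDl.
have := near_dist_le t (divr_gt0 e0 C1); apply: filterS2 h => s h1 h2.
apply: le_trans h1 _; rewrite -(real_normK (num_real (s - t))) expr2 mulrA.
rewrite ler_wpM2r//; apply: le_trans (_ : (`|C| + 1) * `|s - t| <= _).
  by rewrite ler_wpM2r// (le_trans (ler_norm _))// lerDl.
by rewrite mulrC -ler_pdivlMr.
Qed.

Lemma quadratic_half_line (f : R -> R) (t l C : R) :
  (forall s, 0 <= s -> `|f s - f t - (s - t) * l| <= C * (s - t) ^+ 2) ->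
  half_line_derivative f t l.
Proof.
move=> h; apply/cvgrPdist_le => e e0.
have C1 : 0 < `|C| + 1 by rewrite ltr_wpDl.
have /cvgrPdist_le ball_e : (fun y : R => y) @ t --> t by exact: cvg_id.
have near_e := nbhs_dnbhs (ball_e (e / (`|C| + 1)) (divr_gt0 e0 C1)).
have neq : \forall s \near t^', s != t by exact: nbhs_dnbhs_neq.
suff H : \forall s \near t^', 0 <= s -> `|l - (f s - f t) / (s - t)| <= e.
  by apply: filterS H => s H /=; rewrite in_itv /= andbT.
near=> s => s0.
have st : s - t != 0 by rewrite subr_eq0; near: s.
have se : `|s - t| <= e / (`|C| + 1) by rewrite distrC; near: s.
have hs : `|f s - f t - (s - t) * l| <= C * (s - t) ^+ 2.
  exact: h.
rewrite distrC (_ : _ - l = (s - t)^-1 * (f s - f t - (s - t) * l)); last first.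
  by rewrite mulrBr mulrA mulVf// mul1r mulrC.
rewrite normrM normfV ler_pdivrMl ?normr_gt0//.
apply: le_trans hs _; rewrite -(real_normK (num_real (s - t))) expr2.
rewrite mulrCA ler_wpM2l//.
apply: le_trans (_ : (`|C| + 1) * `|s - t| <= _).
  by rewrite ler_wpM2r// (le_trans (ler_norm _))// lerDl.
by rewrite mulrC -ler_pdivlMr.
Unshelve. all: by end_near. Qed.

End time_regularity.

(** * Velocity of the flow *)

Section solution.
Context {R : realType}.
Notation mu := (@lebesgue_measure R).
Variables (L : R) (phi : int -> R[i]) (u : R -> int -> R[i]) (C : R).
Hypothesis L0 : 0 < L.
Hypothesis lu : lipc u C.
Hypothesis su : forall t, small (u t).
Hypothesis uE : forall t n,
  u t n = phi n + kap L n * cintegral 0 t (fun s => quad (ext (u s)) n).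

Let u3 t : l1b (u t) 3 := small_l1 (su t).

Definition velocity (t : R) (n : int) : R[i] := kap L n * quad (ext (u t)) n.

Let c0 := L / (2 * pi).
Let K1 := C * (1 + 6 * (3 + 3)).
Let A1 : R := 3 + (3^-1 + 6 * 3 ^+ 2).

Lemma ext_lipschitz : lipc (fun t => ext (u t)) K1.
Proof. exact: lipc_ext lu u3. Qed.

Lemma ext_bound t : l1b (ext (u t)) A1.
Proof. exact: l1b_extM (u3 t). Qed.

Let Kq := K1 * (1 + 3 * (A1 + A1)).
Let Bq : R := A1 + 3 * (A1 * A1).

Lemma quad_lipschitz : lipc (fun t => quad (ext (u t))) Kq.
Proof. exact: lipc_quad ext_lipschitz ext_bound. Qed.

Lemma quad_bound t : l1b (quad (ext (u t))) Bq.
Proof. exact: l1b_quad (ext_bound t). Qed.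

Lemma velocity_lipschitz : lipc velocity (c0 * Kq).
Proof.
move=> s t; rewrite -mulrA; have := l1b_mul (z1_kap_le L0) (quad_lipschitz s t).
by apply: l1b_ext => n; rewrite /velocity mulrBr.
Qed.

Lemma velocity_bound t : l1b (velocity t) (c0 * Bq).
Proof. exact: l1b_mul (z1_kap_le L0) (quad_bound t). Qed.

Lemma u_taylor s t : 0 <= s -> 0 <= t ->
  l1b (fun n => u s n - u t n - (s - t)%:C * velocity t n) (c0 * (Kq * (s - t) ^+ 2)).
Proof.
move=> s0 t0; have := l1b_mul (z1_kap_le L0) (l1_taylor quad_lipschitz s0 t0).
apply: l1b_ext => n; rewrite (uE s n) (uE t n) /velocity; ring.
Qed.

Lemma ext0 v : ext v 0 = (mean v)%:C :> R[i].
Proof. by rewrite /ext eqxx. Qed.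

Lemma extN0 (v : int -> R[i]) n : n != 0 -> ext v n = v n.
Proof. by rewrite /ext => /negbTE ->. Qed.

Definition osq_velocity (t : R) : R := 2 * complex.Re (conv (u t) (velocity t) 0).

(** The convolution square of the increment is of second order, because [u] is
    Lipschitz in l1. *)
Lemma osq_taylor s t : 0 <= s -> 0 <= t ->
  `|osq (u s) - osq (u t) - (s - t) * osq_velocity t| <=
  (6 * (c0 * Kq) + C ^+ 2) * (s - t) ^+ 2.
Proof.
move=> s0 t0; set d := fun n => u s n - u t n.
have hd : l1b d (C * `|s - t|) by exact: lu.
set h := (s - t)%:C; have hr := u_taylor s0 t0; rewrite -/h in hr.
have hv := velocity_bound t.
have hhv : l1b (fun n => h * velocity t n) (`|s - t| * (c0 * Bq)).
  by apply: l1b_mul hv => n; rewrite z1_real.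
have e1 : conv (u s) (u s) 0 - conv (u t) (u t) 0 =
    2 * conv (u t) d 0 + conv d d 0.
  rewrite (conv_sqB 0 (u3 s) (u3 t)) (convC 0 hd (u3 s)).
  by rewrite (convBl 0 (u3 s) (u3 t) hd); ring.
have e2 : conv (u t) (fun n => d n - h * velocity t n) 0 =
    conv (u t) d 0 - h * conv (u t) (velocity t) 0.
  rewrite (convBr 0 (u3 t) hd hhv); congr (_ - _).
  have := convZ 1 h 0 (u3 t) hv; rewrite mul1r => <-.
  suff -> : (fun k => 1 * u t k) = u t by [].
  by apply/funext => n; rewrite mul1r.
have b1 := le_trans (Re_le_z1 _) (l1b_term 0 (l1b_convM (u3 t) hr)).
have b2 := le_trans (Re_le_z1 _) (l1b_term 0 (l1b_convM hd hd)).
have -> : osq (u s) - osq (u t) - (s - t) * osq_velocity t =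
    2 * complex.Re (conv (u t) (fun n => d n - h * velocity t n) 0) +
    complex.Re (conv d d 0).
  rewrite e2 /osq -ReN -ReD e1 /osq_velocity /h.
  case: (conv (u t) d 0) => a b; case: (conv d d 0) => c c'.
  by case: (conv (u t) (velocity t) 0) => x y /=; ring.
apply: le_trans (ler_normD _ _) _.
rewrite normrM ger0_norm// [X in _ <= X]mulrDl; apply: lerD.
  by move: b1; lra.
apply: le_trans b2 _; rewrite mulrACA -expr2 -[`|_| * _]expr2.
by rewrite real_normK ?num_real.
Qed.

Lemma is_derive_u (t : R) n : 0 < t ->
  is_derive t 1 (fun s => complex.Re (u s n)) (complex.Re (velocity t n)) /\
  is_derive t 1 (fun s => complex.Im (u s n)) (complex.Im (velocity t n)).
Proof.
move=> t0.
have pos : \forall s \near t, 0 <= s.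
  by near=> s; apply: ltW; near: s; exact: lt_nbhsr.
split; apply: (quadratic_derive (C := c0 * Kq)); apply: filterS pos => s s0;
  rewrite -mulrA.
- apply: le_trans _ (l1b_term n (u_taylor s0 (ltW t0))); apply: le_trans (Re_le_z1 _).
  by rewrite !ReD !ReN Re_realM.
- apply: le_trans _ (l1b_term n (u_taylor s0 (ltW t0))); apply: le_trans (Im_le_z1 _).
  by rewrite !ImD !ImN Im_realM.
Unshelve. all: by end_near. Qed.

Definition mean_velocity (t : R) : R :=
  - 3 * osq_velocity t / Num.sqrt (1 - 36 * osq (u t)).

Let disc t : 2^-1 <= 1 - 36 * osq (u t).
Proof. by have := small_osq (su t); lra. Qed.

Lemma is_derive_mean (t : R) : 0 < t ->
  is_derive t 1 (fun s => mean (u s)) (mean_velocity t).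
Proof.
move=> t0.
have pos : \forall s \near t, 0 <= s.
  by near=> s; apply: ltW; near: s; exact: lt_nbhsr.
have d1 : is_derive t 1 (fun s => osq (u s)) (osq_velocity t).
  apply: (quadratic_derive (C := 6 * (c0 * Kq) + C ^+ 2)).
  by apply: filterS pos => s s0; apply: osq_taylor => //; exact: ltW.
have d2 : is_derive t 1 (fun s => 1 - 36 * osq (u s)) (- (36 * osq_velocity t)).
  have := is_deriveB (is_derive_cst (1 : R) t 1) (is_deriveZ 36 d1).
  move=> h; apply: (is_derive_congr h) => //; by rewrite sub0r.
have p0 : 0 < 1 - 36 * osq (u t) by have := disc t; lra.
have d3 := @is_derive1_comp _ (@Num.sqrt R) _ t _ _ (is_derive1_sqrt p0) d2.
have := is_deriveZ 6^-1 (is_deriveD (is_derive_cst (1 : R) t 1) d3).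
move=> h; apply: (is_derive_congr h) => [s|].
  by rewrite small_mean.
rewrite /GRing.scale /= add0r /mean_velocity.
have s0 : Num.sqrt (1 - 36 * osq (u t)) != 0 by rewrite gt_eqF// sqrtr_gt0.
by field.
Unshelve. all: by end_near. Qed.

Lemma continuous_osq : continuous (fun t => osq (u t)).
Proof.
apply: (@lipschitz_continuous _ _ (6 * C)) => s t.
by apply: le_trans (osq_dist (u3 s) (u3 t) (lu s t)) _; rewrite mulrAC; lra.
Qed.

Lemma continuous_mean_velocity : continuous mean_velocity.
Proof.
have c1 : continuous osq_velocity.
  apply: (@lipschitz_continuous _ _ (2 * (C * (c0 * Bq) + 3 * (c0 * Kq)))) => s t.
  rewrite /osq_velocity -mulrBr normrM ger0_norm// -mulrA ler_wpM2l//.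
  have hd := lu s t; have hv := velocity_lipschitz s t.
  have -> : complex.Re (conv (u s) (velocity s) 0) - complex.Re (conv (u t) (velocity t) 0) =
      complex.Re (conv (fun n => u s n - u t n) (velocity s) 0 +
        conv (u t) (fun n => velocity s n - velocity t n) 0).
    rewrite (convBl 0 (u3 s) (u3 t) (velocity_bound s)).
    rewrite (convBr 0 (u3 t) (velocity_bound s) (velocity_bound t)).
    by rewrite addrA subrK ReD ReN.
  apply: le_trans (Re_le_z1 _) _; apply: le_trans (z1D _ _) _.
  rewrite mulrDl; apply: lerD.
    rewrite mulrAC; exact: (l1b_term 0 (l1b_convM hd (velocity_bound s))).
  rewrite -mulrA; exact: (l1b_term 0 (l1b_convM (u3 t) hv)).
move=> t; apply: cvgM; first by apply: cvgM; [exact: cvg_cst|exact: c1].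
apply: cvgV; first by rewrite gt_eqF// sqrtr_gt0; have := disc t; lra.
apply: continuous_comp; last exact: sqrt_continuous.
apply: cvgB; first exact: cvg_cst.
by apply: cvgM; [exact: cvg_cst|exact: continuous_osq].
Qed.

Lemma mean_velocity_bound t : `|mean_velocity t| <= 36 * (c0 * Bq).
Proof.
have v0 := velocity_bound t.
have b := le_trans (Re_le_z1 _) (l1b_term 0 (l1b_convM (u3 t) v0)).
have s2 : 2^-1 <= Num.sqrt (1 - 36 * osq (u t)).
  have h := disc t; rewrite -[leLHS]ger0_norm ?invr_ge0// -sqrtr_sqr ler_sqrt; lra.
rewrite /mean_velocity normrM normfV ler_pdivrMr; last by rewrite normr_gt0; lra.
rewrite [X in _ <= _ * X]ger0_norm; last lra.
rewrite /osq_velocity (_ : - 3 * (2 * _) = - (6 * complex.Re (conv (u t) (velocity t) 0))); last by ring.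
rewrite normrN normrM ger0_norm//.
have B0 := l1b_ge0 v0; move: b s2 B0.
set X := `|complex.Re _|; set Y := c0 * Bq; set S := Num.sqrt _ => b s2 B0.
by apply: (@le_trans _ _ (36 * Y * 2^-1)); [lra|rewrite ler_wpM2l// mulr_ge0].
Qed.

End solution.

(** * Generalized solutions are flows *)

Section H_norm.
Context {R : realType}.
Implicit Types v : int -> R[i].

Lemma Hnormsq_ge0 v : (0 <= Hnormsq v)%E.
Proof.
rewrite /Hnormsq adde_ge0// ?lee_fin ?sqr_ge0//.
by apply: esum_ge0 => n _; rewrite lee_fin energy_term_ge0.
Qed.

Lemma Hnormsq_le v (a b : R) : normc (v 0) <= a -> 0 <= b ->
  (forall N, energy N v <= b ^+ 2) -> (Hnormsq v <= ((a + b) ^+ 2)%:E)%E.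
Proof.
move=> ha b0 /sumsq_deriv_le hb.
have a0 : 0 <= a by apply: le_trans ha; exact: normc_ge0.
rewrite /Hnormsq; apply: (@le_trans _ _ ((a ^+ 2)%:E + (b ^+ 2)%:E)%E).
  by rewrite leeD// lee_fin ler_pXn2r// nnegrE// normc_ge0.
by rewrite -EFinD lee_fin sqrrD addrAC lerDl mulrn_wge0// mulr_ge0.
Qed.

Lemma Hnorm_le v (a b : R) : normc (v 0) <= a -> 0 <= b ->
  (forall N, energy N v <= b ^+ 2) -> inH v /\ Hnorm v <= a + b.
Proof.
move=> ha b0 hb; have h := Hnormsq_le ha b0 hb.
have a0 : 0 <= a by apply: le_trans ha; exact: normc_ge0.
have fin : (Hnormsq v < +oo)%E by apply: le_lt_trans h (ltry _).
split=> //; rewrite /Hnorm -(ger0_norm (addr_ge0 a0 b0)) -sqrtr_sqr.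
rewrite ler_wsqrtr// -lee_fin fineK// ge0_fin_numE//; exact: Hnormsq_ge0.
Qed.

Lemma inH_energy v (P : R) : inH v -> Hnorm v <= P ->
  normc (v 0) ^+ 2 <= P ^+ 2 /\ forall N, energy N v <= P ^+ 2.
Proof.
move=> fin hP; have H0 := Hnormsq_ge0 v.
have e : Hnormsq v = (fine (Hnormsq v))%:E by rewrite fineK// ge0_fin_numE.
have hP2 : fine (Hnormsq v) <= P ^+ 2.
  rewrite -(sqr_sqrtr (fine_ge0 H0)); rewrite ler_pXn2r ?nnegrE ?sqrtr_ge0//.
  by apply: le_trans hP; exact: sqrtr_ge0.
have hP3 : (Hnormsq v <= (P ^+ 2)%:E)%E by rewrite e lee_fin.
have s0 : (0 <= sumsq_deriv v)%E.
  by apply: esum_ge0 => n _; rewrite lee_fin energy_term_ge0.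
split.
  rewrite -lee_fin; apply: le_trans hP3; rewrite /Hnormsq leeDl//.
by apply/sumsq_deriv_le; apply: le_trans hP3; rewrite /Hnormsq leeDr// lee_fin sqr_ge0.
Qed.

Lemma bsum_sq_le (f : int -> R) N : (forall n, 0 <= f n) ->
  bsum (fun n => f n ^+ 2) N <= bsum f N ^+ 2.
Proof.
move=> f0; elim: N => [|N IH]; first by rewrite !bsum0.
rewrite !bsumS; have := bsum_ge0 N f0; have := f0 N.+1%:Z; have := f0 (- N.+1%:Z).
move: (f N.+1%:Z) (f (- N.+1%:Z)) (bsum f N) IH => a b c IH b0 a0 c0; nra.
Qed.

(** The multiplier gains the factor [n] of the energy, and the l2 norm is at
    most the l1 norm. *)
Lemma energy_kap L v B N : 0 < L -> l1b v B ->
  energy N (fun n => kap L n * v n) <= (L / (2 * pi) * B) ^+ 2.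
Proof.
move=> L0 hv; have c0 : 0 <= L / (2 * pi) :> R by rewrite divr_ge0 ?mulr_ge0 ?pi_ge0// ltW.
have B0 := l1b_ge0 hv.
have kM n := z1_kapM L0 n; move: (L / (2 * pi)) c0 kM => c c0 kM.
apply: (@le_trans _ _ (bsum (fun n => (c * z1 (v n)) ^+ 2) N)).
  apply: bsum_le => n _; rewrite -(real_normK (num_real n%:~R)) -exprMn.
  rewrite ler_pXn2r ?nnegrE ?mulr_ge0 ?normc_ge0 ?z1_ge0//.
  apply: le_trans (ler_wpM2l (normr_ge0 _) (normc_le_z1 _)) _.
  apply: le_trans (ler_wpM2l (normr_ge0 _) (z1M _ _)) _.
  by rewrite mulrA ler_wpM2r ?z1_ge0.
apply: le_trans (bsum_sq_le N _) _ => [n|]; first by rewrite mulr_ge0// z1_ge0.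
have s0 : 0 <= bsum (fun n => z1 (v n)) N by apply: bsum_ge0 => n; exact: z1_ge0.
by rewrite bsumZ ler_pXn2r ?nnegrE ?mulr_ge0//; exact: ler_wpM2l.
Qed.

Lemma inH_l1 v (P : R) : inH v -> Hnorm v <= P -> l1b v (2 + P ^+ 2 + (1 + 2 * P ^+ 2)).
Proof.
move=> vH hP; have [h0 hE] := inH_energy vH hP.
have ho : l1b (osc v) (2 + P ^+ 2).
  by apply: h1_l1 => [|N]; [exact: osc0|rewrite energy_osc].
apply: (l1b_mean_ext _ _ ho) => [n n0|]; first by rewrite /osc (negbTE n0).
have := z1_sq_le (v 0); move: h0; set x := z1 _; set y := _ ^+ 2 => h0 h1.
by have := sqr_ge0 P; nra.
Qed.

End H_norm.

Section generalized.
Context {R : realType}.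
Notation mu := (@lebesgue_measure R).
Variables (L : R) (phi : int -> R[i]).
Hypothesis L0 : 0 < L.
Hypothesis phi_herm : conj_symmetric phi.
Hypothesis phi_energy : forall N, energy N phi <= 72^-1.
Hypothesis phi_mean : phi 0 = (mean (osc phi))%:C.

Lemma kapE (t : R) n (f : R -> R[i]) (a : R[i]) :
  a - 'i%C * (L / (2 * pi * n%:~R))%:C * cintegral 0 t f =
  a + kap L n * cintegral 0 t f.
Proof. by rewrite /kap mulNr. Qed.

Lemma energy_ext v N : energy N (ext v) = energy N v :> R.
Proof. by apply: energy_eq => n n0; rewrite extN0. Qed.

(** The increments of the flow off the mean mode are [kap] times increments
    bounded in l1, hence are bounded in H by [energy_kap]: continuity in H and
    the bound on the derivative follow. *)
Lemma flow_generalized (u : R -> int -> R[i]) C : lipc u C -> (forall t, small (u t)) ->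
  (forall t n, u t n = osc phi n + kap L n * cintegral 0 t (fun s => quad (ext (u s)) n)) ->
  generalized_solution L phi (fun t => ext (u t)).
Proof.
move=> lu su uE.
have qL := quad_lipschitz lu su.
have [B [qB mB]] : exists B, (forall t, l1b (quad (ext (u t))) B) /\
    forall t, `|mean_velocity L u t| <= 36 * (L / (2 * pi) * B).
  eexists; split; first exact: quad_bound su.
  by move=> t; exact: (mean_velocity_bound L0 su).
have [seg1 seg2] := coord_segments (lipc_continuous qL).
have [A eL] : exists A, lipc (fun t => ext (u t)) A.
  by eexists; exact: ext_lipschitz lu su.
have sym t : conj_symmetric (ext (u t)) by apply: ext_sym; case: (su t).
have en t N : energy N (ext (u t)) <= 72^-1.
  by rewrite energy_ext; case: (su t).
have u0 : ext (u 0) = phi.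
  rewrite -(ext_osc phi_mean); congr ext; apply/funext => n.
  by rewrite (uE 0 n) cintegral0 mulr0 addr0.
have c0 : 0 <= L / (2 * pi) by rewrite divr_ge0 ?mulr_ge0 ?pi_ge0// ltW.
split.
- split=> t t0.
    apply: (Hnorm_le (a := `|mean (u t)|) (b := 1) _ ler01 _).1.
      by rewrite ext0 -z1_real normc_le_z1.
    by move=> N; apply: le_trans (en t N) _; rewrite expr1n; lra.
  apply/cvgrPdist_le => e e0.
  set K := L / (2 * pi) * B; have K0 : 0 <= K by rewrite mulr_ge0// (l1b_ge0 (qB 0)).
  have A0 : 0 <= A by have /l1b_ge0 := eL 1 0; rewrite subr0 normr1 mulr1.
  have AK : 0 < A + K + 1 by rewrite ltr_wpDl// addr_ge0.
  have /cvgrPdist_le near_t : (fun y : R => y) @ t --> t by exact: cvg_id.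
  have := near_t _ (divr_gt0 e0 AK); apply: filterS => s st /=.
  rewrite in_itv /= andbT sub0r normrN => s0.
  have dl := lipc_primitive (fun=> 0) seg1 seg2 (l1b_ge0 (qB 0)) (aeW mu (fun x _ => qB x)) s t.
  have l0 : 0 <= K * `|s - t| by rewrite mulr_ge0.
  have [_ h] : inH (fun n => ext (u s) n - ext (u t) n) /\
      Hnorm (fun n => ext (u s) n - ext (u t) n) <= A * `|s - t| + K * `|s - t|.
    apply: Hnorm_le l0 _.
      by apply: le_trans (normc_le_z1 _) _; exact: (l1b_term 0 (eL s t)).
    move=> N; rewrite /K -mulrA; apply: le_trans (energy_kap N L0 dl).
    apply: eq_ler; apply: energy_eq => n n0.
    by rewrite !extN0// (uE s n) (uE t n); ring.
  rewrite ger0_norm ?sqrtr_ge0//; apply: le_trans h _; rewrite -mulrDl.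
  apply: le_trans (_ : (A + K + 1) * `|t - s| <= _).
    by rewrite distrC ler_wpM2r// lerDl.
  by rewrite mulrC -ler_pdivlMr.
- by move=> t _; exact: sym.
- exists (fun t n => if n == 0 then (mean_velocity L u t)%:C else velocity L u t n).
  have cm := continuous_mean_velocity L0 lu su.
  have cv := lipc_continuous (velocity_lipschitz L0 lu su).
  split; [split|split].
  + apply: aeW => t t0 n; have [->|n0] := eqVneq n 0.
      split.
        apply: (is_derive_congr (is_derive_mean L0 lu su uE t0)) => [s|]; first by rewrite ext0.
        by [].
      apply: (is_derive_congr (is_derive_cst (0 : R) t 1)) => [s|]; first by rewrite ext0.
      by [].
    have [dr di] := is_derive_u L0 lu su uE n t0.
    by split; [apply: (is_derive_congr dr)|apply: (is_derive_congr di)];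
      do ?[move=> s; rewrite extN0].
  + move=> n t t0; have [->|n0] := eqVneq n 0.
      rewrite !ext0 /cintegral /= Rintegral_segment_cst// mul0r.
      suff -> : \int[mu]_(s in `[0, t]) mean_velocity L u s = mean (u t) - mean (u 0).
        by apply/eqP; rewrite eq_complex /= addrC subrK addr0 !eqxx.
      move: t0; rewrite le_eqVlt => /predU1P[<-|t0].
        by rewrite Rintegral_segment0 subrr.
      have cF : continuous (fun s => mean (u s)).
        apply: (@lipschitz_continuous _ _ A) => x y.
        by have := l1b_term 0 (eL x y); rewrite !ext0 -rmorphB z1_real.
      rewrite /Rintegral (@continuous_FTC2 _ _ (fun s => mean (u s)))//.
      * exact: continuous_subspaceT.
      * split.
        - by move=> x; rewrite in_itv /= => /andP[x0 _]; case: (is_derive_mean L0 lu su uE x0).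
        - exact/cvg_at_right_filter/cF.
        - exact/cvg_at_left_filter/cF.
      * move=> x; rewrite in_itv /= => /andP[x0 _]; rewrite derive1E.
        by case: (is_derive_mean L0 lu su uE x0).
    rewrite !extN0// (uE t n) (uE 0 n) cintegral0 mulr0 addr0.
    by rewrite /velocity cintegralZ.
  + move=> n; have [_|n0] := eqVneq n 0.
      split; first by apply: measurable_funTS; exact: continuous_measurable_fun.
      exact: measurable_cst.
    have [c1 c2] := cv n.
    by split; apply: measurable_funTS; exact: continuous_measurable_fun.
  + exists (36 * (L / (2 * pi) * B) + L / (2 * pi) * B); apply: aeW => t t0.
    have B0 : 0 <= L / (2 * pi) * B by rewrite mulr_ge0// (l1b_ge0 (qB 0)).
    apply: Hnorm_le B0 _ => [|N].
      rewrite eqxx; apply: le_trans (normc_le_z1 _) _; rewrite z1_real.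
      exact: mB.
    apply: le_trans (energy_kap N L0 (qB t)).
    apply: eq_ler; apply: energy_eq => n n0.
    by rewrite (negbTE n0).
- by move=> n; rewrite u0.
- move=> t _; apply/(plus_root_mean (sym t) (en t)).
  by rewrite ext0 osc_ext//; case: (su t).
- move=> t n t0 n0; rewrite kapE extN0// (uE t n) /osc (negbTE n0).
  by [].
Qed.

Lemma essentially_bounded_integrable (f : R -> R) (B : R) : 0 <= B ->
  measurable_fun (`[0, +oo[ : set R) f ->
  {ae mu, forall t, 0 <= t -> `|f t| <= B} ->
  integrable_segments (f \_ `[0, +oo[).
Proof.
move=> B0 mf fB a b.
have mf' : measurable_fun [set: R] (f \_ `[0, +oo[).
  by apply/(measurable_restrictT _ _).1.
have mf2 : measurable_fun `[a, b] (f \_ `[0, +oo[) by exact: measurable_funTS.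
apply/integrableP; split; first exact/measurable_EFinP.
apply: (@le_lt_trans _ _ (\int[mu]_(x in `[a, b]) (cst B%:E) x)%E).
  apply: ae_ge0_le_integral => //.
  - by apply/measurable_EFinP; apply: measurableT_comp.
  - by apply: lebesgue_ae_imply fB => x hx _ /=; rewrite lee_fin patchE;
      case: ifP => [|_]; rewrite ?normr0// inE /= in_itv /= andbT => /hx.
rewrite integral_cst//= lebesgue_measure_itv /=; case: ifP => _.
  by rewrite -EFinB -EFinM ltry.
by rewrite mule0 ltry.
Qed.

(** The essentially bounded derivative makes a generalized solution Lipschitz in
    l1, so that its energy stays bounded by [72^-1]; in that region the
    constraint on its mean mode is the equation defining [ext]. *)
Lemma generalized_flow (v : R -> int -> R[i]) : generalized_solution L phi v ->
  exists (y : R -> int -> R[i]) (C : R), [/\ lipc y C, forall t, small (y t),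
    forall t, 0 <= t -> forall n,
      y t n = osc phi n + kap L n * cintegral 0 t (fun s => quad (ext (y s)) n) &
    forall t, 0 <= t -> v t = ext (y t)].
Proof.
move=> [vc vsym [g [[_ gint] [gm [M gM]]]] v0 vmean vmodes].
pose B := 2 + M ^+ 2 + (1 + 2 * M ^+ 2).
have B0 : 0 <= B by have := sqr_ge0 M; rewrite /B; lra.
have gB : {ae mu, forall t, 0 <= t -> l1b (g t) B}.
  by apply: lebesgue_ae_imply gM => t h t0; have [h1 h2] := h t0; exact: inH_l1.
pose gp t n := (complex.Re (g t n) * (0 <= t)%R%:R) +i* (complex.Im (g t n) * (0 <= t)%R%:R).
have gpE t n : 0 <= t -> gp t n = g t n.
  by rewrite /gp => ->; rewrite !mulr1; case: (g t n).
have seg (p : R[i] -> R) n : (forall z, `|p z| <= z1 z) ->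
    measurable_fun (`[0, +oo[ : set R) (fun t => p (g t n)) ->
    integrable_segments (fun t => p (g t n) * (0 <= t)%R%:R).
  move=> pz mp; rewrite (_ : (fun t => _) = (fun t => p (g t n)) \_ `[0, +oo[).
    apply: essentially_bounded_integrable B0 mp _.
    by apply: lebesgue_ae_imply gB => t h t0; apply: le_trans (pz _) (l1b_term n (h t0)).
  apply/funext => t; rewrite patchE mem_setE in_itv /= andbT.
  by case: ifP; rewrite ?mulr1 ?mulr0.
have s1 n : integrable_segments (fun t => complex.Re (gp t n)).
  by apply: seg; [exact: Re_le_z1|exact: (gm n).1].
have s2 n : integrable_segments (fun t => complex.Im (gp t n)).
  by apply: seg; [exact: Im_le_z1|exact: (gm n).2].
have lw : lipc (fun t : R => v (Num.max t 0)) B.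
  have := @lipc_primitive _ gp (v 0) B s1 s2 B0.
  have hb : {ae mu, forall x, 0 <= x -> l1b (gp x) B}.
    apply: lebesgue_ae_imply gB => t h t0; apply: l1b_ext (h t0) => n.
    by rewrite gpE.
  move=> /(_ hb) h s t; apply: l1b_ext (h s t) => n.
  have e x : v (Num.max x 0) n = v 0 n + cintegral 0 x (gp^~ n).
    have x0 : 0 <= Num.max x 0 by rewrite le_max lexx orbT.
    rewrite (gint n _ x0) (cintegral_max (gp^~ n)).
    apply: (congr1 (fun z => v 0 n + z)); apply: eq_cintegral => r /andP[r0 _].
    by rewrite gpE.
  by rewrite (e s) (e t).
set w := fun t : R => v (Num.max t 0) in lw.
pose y (t : R) := osc (w t).
have max0 (t : R) : 0 <= Num.max t 0 by rewrite le_max lexx orbT.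
have wsym t : conj_symmetric (w t) by exact: vsym.
have ly : lipc y B.
  move=> s t; apply: l1b_dom (lw s t) => n; rewrite /y /osc; case: eqP => // _.
  by rewrite subrr z10 z1_ge0.
have phi1 : l1 (osc phi) by exists 3; apply: small_l1; exact: osc_small.
have yE t : 0 <= t -> forall n,
    y t n = osc phi n + kap L n * cintegral 0 t (fun s => quad (w s) n).
  move=> t0 n; rewrite /y /osc; have [->|n0] := eqVneq n 0.
    by rewrite kap0 mul0r addr0.
  rewrite {1}/w max_l// (vmodes t n t0 n0) kapE.
  apply: (congr1 (fun z => phi n + kap L n * z)).
  by apply: eq_cintegral => s /andP[s0 _]; rewrite /w max_l.
have y0 : y 0 = osc phi.
  by apply/funext => n; rewrite (yE 0 (lexx 0) n) cintegral0 mulr0 addr0.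
have w0 : w 0 = phi by apply/funext => n; rewrite /w max_l// v0.
have w0l1 : l1 phi.
  rewrite -(ext_osc phi_mean); case: phi1 => A hA.
  by exists (A + (3^-1 + 6 * A ^+ 2)); exact: l1b_extM.
have real t : exists r, w t 0 = r%:C.
  by have [_ e] := vmean _ (max0 t); rewrite /w e; eexists.
have [r rE] := choice real.
have yen t N : energy N (y t) <= 72^-1.
  have pos s : 0 <= s -> energy N (y s) <= 72^-1.
    move=> s0; apply: (energy_flow (y := y) (w := w) (phi := osc phi) (lam := fun=> 1)
      (r := r) L0 ly _ lw) => //.
    - by rewrite y0.
    - by rewrite w0.
    - by move=> x; exact: osc_sym.
    - by move=> x n n0; rewrite mul1r /y /osc (negbTE n0).
    - by move=> x; rewrite ler01 lexx.
    - by move=> k; rewrite energy_osc.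
  rewrite (_ : y t = y (Num.max t 0)); first exact: pos.
  by rewrite /y /w (max_l (max0 t)).
have wen t N : energy N (w t) <= 72^-1 by rewrite -energy_osc; exact: yen.
have wy t : ext (y t) = w t.
  apply: ext_osc; apply/(plus_root_mean (wsym t) (wen t)).
  exact: vmean.
exists y, B; split; first exact: ly.
- by move=> t; apply: osc_small.
- move=> t t0 n; rewrite (yE t t0 n).
  apply: (congr1 (fun z => osc phi n + kap L n * z)).
  by apply: eq_cintegral => s _; rewrite wy.
- by move=> t t0; rewrite wy /w max_l.
Qed.

End generalized.

(** * Fourier series in the space variable *)

Section fourier_modes.
Context {R : realType}.
Variable L : R.
Hypothesis L0 : 0 < L.
Implicit Types (v w : int -> R[i]) (x y : R).

Notation e := (fourier_mode L).

Definition freq (n : int) : R := 2 * pi / L * n%:~R.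

Lemma mode0 x : e 0 x = 1.
Proof. by rewrite /fourier_mode mulr0z mulr0 mul0r cos0 sin0. Qed.

Lemma modeD x a b : e (a + b) x = e a x * e b x.
Proof.
rewrite /fourier_mode rmorphD /= mulrDr mulrDl cosD sinD.
apply/eqP; rewrite eq_complex /=; apply/andP; split; apply/eqP => //.
by rewrite addrC [X in _ + X]mulrC addrC.
Qed.

Lemma mode_conj n x : e (- n) x = conjc (e n x).
Proof. by rewrite /fourier_mode mulrNz mulrN mulNr cosN sinN. Qed.

Lemma z1_mode n x : z1 (e n x) <= 2.
Proof. by rewrite /z1 /=; have := cos_max (freq n * x); have := sin_max (freq n * x); rewrite /freq; lra. Qed.

Lemma l1b_mode v A x : l1b v A -> l1b (fun n => v n * e n x) (2 * A).
Proof.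
move=> hv; apply: l1b_ext (l1b_mul (c := fun n => e n x) _ hv) => [n|n].
  by rewrite mulrC.
exact: z1_mode.
Qed.

Definition fseries v x : R[i] := csum (fun n => v n * e n x).

Lemma fourier_sumE v x : fourier_sum L v x = complex.Re (fseries v x).
Proof. by []. Qed.

Lemma fseries_real v A x : l1b v A -> conj_symmetric v ->
  complex.Im (fseries v x) = 0.
Proof.
move=> hv sv; have := csum_conj (l1b_mode x hv).
rewrite (@csum_ext _ _ (fun n => v (- n) * e (- n) x)); last first.
  by move=> n; rewrite conjcM sv mode_conj.
rewrite (csum_opp (fun n => v n * e n x)) /fseries; case: (csum _) => a b [] /= bb.
by lra.
Qed.

Lemma fseries_quad v A x : l1b v A -> conj_symmetric v ->
  complex.Re (fseries (quad v) x) =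
  fourier_sum L v x - 3 * fourier_sum L v x ^+ 2.
Proof.
move=> hv sv; have hve := l1b_mode x hv.
have hc := l1b_convM hve hve.
have -> : fseries (quad v) x = fseries v x - 3 * (fseries v x * fseries v x).
  rewrite /fseries -(csum_conv hve hve) -(csumZ 3 hc).
  have h3 : z1 (3 : R[i]) <= 3 by rewrite -[3]mulr1 z13 (z1_real 1) normr1 mulr1.
  rewrite -(csumB hve (l1b_mul (c := fun=> 3) (fun=> h3) hc)).
  apply: csum_ext => n; rewrite (conv_char n hv hv (modeD x)) /quad; ring.
have := fseries_real x hv sv; rewrite fourier_sumE.
have h3 : (3 : R[i]) = (3 : R)%:C by rewrite rmorph_nat.
by rewrite h3; case: (fseries v x) => a b /= ->; ring.
Qed.

Lemma fourier_uniform v A : l1b v A -> conj_symmetric v ->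
  {uniform [set: R], fourier_partial L v @ \oo -->
     ((fun x => (fourier_sum L v x)%:C) : R -> R[i]^o)}.
Proof.
move=> hv sv P /uniform_nbhs [E [entE EP]].
move: entE; rewrite -entourage_ballE => -[d /= d0 dE].
have dr : d = (complex.Re d)%:C.
  by move: d0; rewrite ltcE /= => /andP[/eqP di _]; case: (d) di => a b /= ->.
have r0 : 0 < complex.Re d by move: d0; rewrite ltcE /= => /andP[].
have r4 : 0 < complex.Re d / 4 by rewrite divr_gt0.
have [N hN] := l1b_tail hv r4.
exists N => // M /= NM; apply: EP => x _; apply: dE.
rewrite /= -ball_normE /=.
have -> : (fourier_sum L v x)%:C = fseries v x.
  by have := fseries_real x hv sv; rewrite fourier_sumE; case: (fseries v x) => a b /= ->.
have hz : z1 (fseries v x - bsum (fun n => v n * e n x) M) <= 2 * (complex.Re d / 4).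
  apply: (zcvg_le (csum_cvg (l1b_mode x hv))); exists M => // M' /= MM'.
  apply: le_trans (z1_bsumB _ MM') _.
  have : bsum (fun n => 2 * z1 (v n) - z1 (v n * e n x)) M <=
         bsum (fun n => 2 * z1 (v n) - z1 (v n * e n x)) M'.
    apply: bsum_mono => // n; rewrite subr_ge0 (le_trans (z1M _ _))// mulrC.
    by rewrite ler_wpM2r ?z1_ge0// z1_mode.
  have := hN M'; have := bsum_mono (fun n => z1_ge0 (v n)) NM.
  rewrite !bsumB !bsumZ; lra.
rewrite dr ltcE /= eqxx /=; apply: le_lt_trans (normc_le_z1 _) _.
by apply: le_lt_trans hz _; lra.
Qed.

(** The minimum serves low modes through its second argument, where the
    remainder is quadratic in [b - a], and high modes through its first. *)
Lemma trig_remainder (f df ddf : R -> R) (a b : R) :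
  (forall x : R, is_derive x 1 f (df x)) -> (forall x : R, is_derive x 1 df (ddf x)) ->
  (forall x, `|df x| <= 1) -> (forall x, `|ddf x| <= 1) ->
  `|f b - f a - (b - a) * df a| <= `|b - a| * Num.min 2 `|b - a|.
Proof.
move=> d1 d2 b1 b2.
have mvt (g dg : R -> R) (x y : R) : (forall x : R, is_derive x 1 g (dg x)) -> x < y ->
    exists2 c, x < c < y & g y - g x = dg c * (y - x).
  move=> dg1 xy; have [c] := MVT xy (fun z _ => dg1 z) (continuous_subspaceT (is_derive_continuous dg1)).
  by rewrite in_itv /=; exists c.
have lip (x y : R) : `|df y - df x| <= `|y - x|.
  wlog xy : x y / x <= y.
    by move=> h; case: (leP x y) => xy; [exact: h|rewrite distrC (distrC y) h// ltW].
  move: xy; rewrite le_eqVlt => /predU1P[->|xy]; first by rewrite !subrr.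
  have [c _ ->] := mvt _ _ _ _ d2 xy.
  by rewrite normrM ler_piMl.
have two (x y : R) : `|df x - df y| <= 2.
  by apply: le_trans (ler_normB _ _) _; have := b1 x; have := b1 y; lra.
have main (x y c : R) : x < y -> (c = x \/ c = y) ->
    `|f y - f x - (y - x) * df c| <= `|y - x| * Num.min 2 `|y - x|.
  move=> xy cE; have [z /andP[xz zy] ->] := mvt _ _ _ _ d1 xy.
  rewrite mulrC -mulrBr normrM ler_wpM2l// le_min two /=.
  apply: le_trans (lip _ _) _; case: cE => ->.
    by rewrite !ger0_norm; lra.
  by rewrite ler0_norm ?ger0_norm; lra.
case: (ltgtP a b) => [ab|ba|->].
- by apply: main => //; left.
- have := main b a a ba (or_intror erefl).
  have -> : f b - f a - (b - a) * df a = - (f a - f b - (a - b) * df a) by ring.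
  by rewrite normrN (distrC b a).
- by rewrite !subrr mul0r subrr normr0 mulr_ge0// le_min normr_ge0 ler0n.
Qed.

Lemma mode_remainder n x y :
  z1 (e n y - e n x - (y - x)%:C * ('i%C * (freq n)%:C * e n x)) <=
  2 * (`|freq n * (y - x)| * Num.min 2 `|freq n * (y - x)|).
Proof.
have hc := trig_remainder (freq n * x) (freq n * y) (@is_derive_cos R)
  (fun z => is_deriveN (is_derive_sin z)) _ _.
have hs := trig_remainder (freq n * x) (freq n * y) (@is_derive_sin R)
  (@is_derive_cos R) (@cos_max R) _.
have {}hc := hc (fun z => etrans (congr1 (fun r => r <= 1) (normrN _)) (sin_max z))
  (fun z => etrans (congr1 (fun r => r <= 1) (normrN _)) (cos_max z)).
have {}hs := hs (fun z => etrans (congr1 (fun r => r <= 1) (normrN _)) (sin_max z)).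
rewrite -mulrBr in hc hs; rewrite mulr_natl mulr2n; apply: lerD.
- move: hc; rewrite /fourier_mode -/(freq n) /=.
  by congr (`| _ | <= _); ring.
- move: hs; rewrite /fourier_mode -/(freq n) /=.
  by congr (`| _ | <= _); ring.
Qed.

Lemma freq_neq0 n : n != 0 -> freq n != 0.
Proof.
move=> n0; have nz : n%:~R != 0 :> R by rewrite intr_eq0.
by rewrite /freq !mulf_neq0// ?invr_eq0 ?gt_eqF ?pi_gt0.
Qed.

Lemma kap_freq n : n != 0 -> kap L n * ('i%C * (freq n)%:C) = 1.
Proof.
move=> n0; have nz : n%:~R != 0 :> R by rewrite intr_eq0.
have -> : kap L n = - ('i%C * ((freq n)^-1)%:C).
  rewrite /kap /freq; have := pi_gt0 R; move: (pi : R) => p p0.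
  by congr (- (_ * _%:C)); field; rewrite nz !gt_eqF.
have fz := freq_neq0 n0.
by apply/eqP; rewrite eq_complex /=; apply/andP; split; apply/eqP; field.
Qed.

Lemma z1_kap_freq n : n != 0 -> z1 (kap L n) = `|freq n|^-1.
Proof.
have p0 : 0 <= 2 * pi / L by rewrite divr_ge0 ?mulr_ge0 ?pi_ge0// ltW.
by move=> n0; rewrite z1_kap// /freq normrM [RHS]invfM (ger0_norm p0) invf_div.
Qed.

(** Termwise differentiation: the multiplier [kap] gains one derivative, so the
    differentiated series still converges absolutely. *)
Lemma is_derive_smoothed (Q : int -> R[i]) B x : l1b Q B -> Q 0 = 0 ->
  is_derive x 1 (fun y => complex.Re (fseries (fun n => kap L n * Q n) y))
    (complex.Re (fseries Q x)).
Proof.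
move=> hQ Q0; apply: remainder_derive => ep ep0.
have ep8 : 0 < ep / 8 by rewrite divr_gt0.
have [N hN] := l1b_tail hQ ep8; have {}hN := trunc_tail hN.
pose W := 2 * pi / L * N%:R.
have W0 : 0 <= W by rewrite mulr_ge0// divr_ge0 ?mulr_ge0 ?pi_ge0// ltW.
have B0 := l1b_ge0 hQ.
have WB : 0 < 4 * (W * B + 1) by rewrite mulr_gt0// ltr_wpDl// mulr_ge0.
have := near_dist_le x (divr_gt0 ep0 WB); apply: filterS => y hy.
set h := `|y - x| in hy *; have h0 : 0 <= h by exact: normr_ge0.
pose r n := e n y - e n x - (y - x)%:C * ('i%C * (freq n)%:C * e n x).
have hk : l1b (fun n => kap L n * Q n) (L / (2 * pi) * B) by exact: l1b_mul (z1_kap_le L0) hQ.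
have hx := l1b_mode x hk; have hy' := l1b_mode y hk; have hq := l1b_mode x hQ.
have hyx : l1b (fun n => (y - x)%:C * (Q n * e n x)) (h * (2 * B)).
  by apply: l1b_mul hq => n; rewrite z1_real.
have -> : complex.Re (fseries (fun n => kap L n * Q n) y) -
    complex.Re (fseries (fun n => kap L n * Q n) x) - (y - x) * complex.Re (fseries Q x) =
    complex.Re (csum (fun n => kap L n * Q n * r n)).
  rewrite -Re_realM -!ReN -!ReD /fseries -(csumZ _ hq) -(csumB hy' hx).
  rewrite -(csumB (l1bB hy' hx) hyx); congr (complex.Re _); apply: csum_ext => n.
  rewrite /r; have [->|n0] := eqVneq n 0; first by rewrite Q0 !(mulr0, mul0r) !subr0.
  have := kap_freq n0; set k := kap L n; set c := 'i%C * _ => kc.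
  transitivity (k * Q n * e n y - k * Q n * e n x - (y - x)%:C * (k * c * (Q n * e n x))).
    by rewrite kc mul1r.
  ring.
apply: le_trans (Re_le_z1 _) _; apply: csum_bound => M.
apply: (@le_trans _ _ (bsum (fun n => 2 * h * (W * h) * z1 (Q n) +
    2 * h * 2 * z1 (Q n - trunc N Q n)) M)).
  apply: bsum_le => n _; have [->|n0] := eqVneq n 0.
    by rewrite trunc_in// subrr Q0 mulr0 mul0r z10 !mulr0 addr0.
  have fz : 0 < `|freq n| by rewrite normr_gt0 freq_neq0.
  apply: le_trans (z1M _ _) _.
  apply: le_trans (ler_wpM2l (z1_ge0 _) (mode_remainder n x y)) _.
  apply: le_trans (ler_wpM2r _ (z1M _ _)) _.
    by rewrite !mulr_ge0// le_min normr_ge0 ler0n.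
  rewrite z1_kap_freq// (normrM (freq n) (y - x)) -/h.
  have -> : `|freq n|^-1 * z1 (Q n) * (2 * (`|freq n| * h * Num.min 2 (`|freq n| * h))) =
     2 * h * Num.min 2 (`|freq n| * h) * z1 (Q n) by field; rewrite gt_eqF.
  rewrite /trunc; case: leqP => nN.
    rewrite subrr z10 mulr0 addr0 ler_wpM2r ?z1_ge0// ler_wpM2l ?mulr_ge0//.
    rewrite ge_min; apply/orP; right; rewrite ler_wpM2r// /freq normrM ger0_norm.
      by rewrite ler_wpM2l// -?intr_norm -?(pmulrn 1) ?ler_nat// divr_ge0 ?mulr_ge0 ?pi_ge0// ltW.
    by rewrite divr_ge0 ?mulr_ge0 ?pi_ge0// ltW.
  rewrite subr0; apply: ler_wpDl; first by apply: mulr_ge0 (z1_ge0 _); apply: mulr_ge0 (mulr_ge0 W0 h0); exact: mulr_ge0.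
  by rewrite ler_wpM2r ?z1_ge0// ler_wpM2l ?mulr_ge0// ge_min lexx.
rewrite bsumD !bsumZ.
have t1 : 2 * h * (W * h) * bsum (fun n => z1 (Q n)) M <= 2 * h * (W * h) * B.
  by apply: ler_wpM2l (hQ M); apply: mulr_ge0 (mulr_ge0 W0 h0); exact: mulr_ge0.
have t2 : 2 * h * 2 * bsum (fun n => z1 (Q n - trunc N Q n)) M <= 2 * h * 2 * (ep / 8).
  by rewrite ler_wpM2l// !mulr_ge0.
apply: le_trans (lerD t1 t2) _.
have t3 : (W * B + 1) * h <= ep / 4.
  by move: hy; rewrite ler_pdivlMr//; lra.
have t4 : W * h * B <= ep / 4 by move: t3; lra.
have -> : 2 * h * (W * h) * B + 2 * h * 2 * (ep / 8) = h * (2 * (W * h * B) + ep / 2) by field.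
by rewrite mulrC ler_wpM2r//; lra.
Qed.

End fourier_modes.

(** * Derivatives in physical space *)

Section physical_space.
Context {R : realType}.
Variables (L : R) (phi : int -> R[i]) (u : R -> int -> R[i]) (C : R).
Hypothesis L0 : 0 < L.
Hypothesis lu : lipc u C.
Hypothesis su : forall t, small (u t).
Hypothesis uE : forall t n,
  u t n = phi n + kap L n * cintegral 0 t (fun s => quad (ext (u s)) n).

(** The mean is a root of [m - 3 * (m ^ 2 + osq v)]. *)
Lemma quad_ext0 v : small v -> quad (ext v) 0 = 0 :> R[i].
Proof.
move=> sv; have [v0 vsym _] := sv; have v3 := small_l1 sv.
have im0 : complex.Im (conv v v 0) = 0.
  have := conv_flip 0 v3 v3; rewrite oppr0.
  rewrite (_ : (fun k => conjc (v (- k))) = v); last first.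
    by apply/funext => k; rewrite vsym conjcK.
  by case: (conv v v 0) => a b /= [] bb; lra.
have osqE : conv v v 0 = (osq v)%:C.
  by rewrite /osq; move: im0; case: (conv v v 0) => a b /= ->.
have hs : l1b (single (mean v)%:C) (z1 (mean v)%:C) := l1b_single _.
have he := l1b_extM v3.
have ds : (fun n => ext v n - v n) = single (mean v)%:C.
  apply/funext => n; rewrite /ext /single; case: eqP => [->|_]; first by rewrite v0 subr0.
  by rewrite subrr.
have := conv_sqB 0 he v3; rewrite ds conv_single (convC 0 v3 hs) conv_single.
rewrite v0 mulr0 addr0 ext0 osqE => /eqP; rewrite subr_eq => /eqP cE.
rewrite /quad cE ext0.
have h3 : (3 : R[i]) = (3 : R)%:C by rewrite rmorph_nat.
have os := small_osq sv.
have : mean v - 3 * (mean v * mean v + osq v) = 0.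
  rewrite small_mean//; set s := Num.sqrt _.
  have s2 : s * s = 1 - 36 * osq v by rewrite -expr2 sqr_sqrtr//; lra.
  have -> : 6^-1 * (1 + s) - 3 * (6^-1 * (1 + s) * (6^-1 * (1 + s)) + osq v) =
    12^-1 * (1 - 36 * osq v - s * s) by field.
  by rewrite s2 subrr mulr0.
move=> h; rewrite h3; apply/eqP; rewrite eq_complex /= -[X in _ && X]/(_) !(mul0r, mulr0, subr0, addr0, oppr0) eqxx andbT.
by apply/eqP; lra.
Qed.

(** The time integral of the modes of [u - 3 u^2]; the solution is its initial
    datum plus [kap] times this, up to the mean mode. *)
Definition forcing (t : R) (n : int) : R[i] :=
  cintegral 0 t (fun s => quad (ext (u s)) n).

Let Bq : R := 3 + (3^-1 + 6 * 3 ^+ 2) + 3 * ((3 + (3^-1 + 6 * 3 ^+ 2)) * (3 + (3^-1 + 6 * 3 ^+ 2))).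
Let qB t : l1b (quad (ext (u t))) Bq := quad_bound su t.

Lemma forcing_lipschitz : lipc forcing Bq.
Proof.
have [s1 s2] := coord_segments (lipc_continuous (quad_lipschitz lu su)).
have h := lipc_primitive (fun=> 0) s1 s2 (l1b_ge0 (qB 0))
  (aeW (@lebesgue_measure R) (fun x _ => qB x)).
by move=> s t; apply: l1b_ext (h s t) => n; rewrite !add0r.
Qed.

Lemma forcing_l1 t : l1b (forcing t) (Bq * `|t|).
Proof.
have := forcing_lipschitz t 0; rewrite subr0; apply: l1b_ext => n.
by rewrite /forcing cintegral0 subr0.
Qed.

Lemma forcing0 t : forcing t 0 = 0.
Proof.
rewrite /forcing; case: (ltP t 0) => [t0|t0]; first by rewrite cintegral_neg.
rewrite (@eq_cintegral _ _ (fun=> 0)) => [|s _]; last exact: quad_ext0.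
by rewrite cintegral_cst// mulr0.
Qed.

Lemma fourier_decomposition t x :
  fourier_sum L (ext (u t)) x = fourier_sum L (ext phi) x +
    (mean (u t) - mean phi) + complex.Re (fseries L (fun n => kap L n * forcing t n) x).
Proof.
have phiE : phi = u 0.
  by apply/funext => n; rewrite (uE 0 n) cintegral0 mulr0 addr0.
set d := mean (u t) - mean phi.
have hphi : l1b (ext phi) (3 + (3^-1 + 6 * 3 ^+ 2)).
  by rewrite phiE; apply: l1b_extM; exact: small_l1.
have hd : l1b (single d%:C) (z1 d%:C) := l1b_single _.
have hk := l1b_mul (z1_kap_le L0) (forcing_l1 t).
have e1 := l1b_mode L x hphi; have e2 := l1b_mode L x hd; have e3 := l1b_mode L x hk.
rewrite !fourier_sumE.
have -> : fseries L (ext (u t)) x =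
    fseries L (ext phi) x + fseries L (single d%:C) x +
    fseries L (fun n => kap L n * forcing t n) x.
  rewrite /fseries -(csumD e1 e2) -(csumD (l1bD e1 e2) e3); apply: csum_ext => n.
  rewrite -!mulrDl; congr (_ * _); rewrite /single.
  have [->|n0] := eqVneq n 0.
    by rewrite !ext0 kap0 mul0r addr0 /d -rmorphD addrC subrK.
  by rewrite !extN0// (uE t n) addr0.
have -> : fseries L (single d%:C) x = d%:C.
  rewrite /fseries (@csum_finite _ _ 0) => [|k k0]; last first.
    by rewrite /single (_ : (k == 0) = false) ?mul0r//; lia.
  by rewrite bsum0 /single eqxx mode0 mulr1.
by rewrite !ReD.
Qed.

(** Only the initial datum can fail to be differentiable; the points where it
    does are the same for all [t]. *)
Lemma space_derivative (t x g : R) :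
  is_derive x 1 (fourier_sum L (ext phi)) g ->
  is_derive x 1 (fourier_sum L (ext (u t)))
    (g + complex.Re (fseries L (forcing t) x)).
Proof.
move=> hg; have d2 := is_derive_smoothed L0 x (forcing_l1 t) (forcing0 t).
have := is_deriveD (is_deriveD hg (is_derive_cst (mean (u t) - mean phi) x 1)) d2.
move=> h; apply: (is_derive_congr h) => [y|]; last by rewrite addr0.
by rewrite fourier_decomposition.
Qed.

Lemma fseries_dist v w A B D x : l1b v A -> l1b w B -> l1b (fun n => v n - w n) D ->
  `|complex.Re (fseries L v x) - complex.Re (fseries L w x)| <= 2 * D.
Proof.
move=> hv hw hD; rewrite -ReN -ReD /fseries.
rewrite -(csumB (l1b_mode L x hv) (l1b_mode L x hw)).
apply: le_trans (Re_le_z1 _) _; apply: csum_bound.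
by apply: l1b_ext (l1b_mode L x hD) => n; rewrite mulrBl.
Qed.

Lemma forcing_continuous x : continuous (fun t => complex.Re (fseries L (forcing t) x)).
Proof.
apply: (@lipschitz_continuous _ _ (2 * Bq)) => s t; rewrite -mulrA.
exact: fseries_dist (forcing_l1 s) (forcing_l1 t) (forcing_lipschitz s t).
Qed.

(** [forcing] is differentiable in l1 with a quadratic remainder, so its Fourier
    series is differentiable in [t] at every [x]. *)
Lemma time_derivative_forcing t x : 0 <= t ->
  half_line_derivative (fun s => complex.Re (fseries L (forcing s) x)) t
    (fourier_sum L (ext (u t)) x - 3 * fourier_sum L (ext (u t)) x ^+ 2).
Proof.
move=> t0; have u3 := small_l1 (su t).
have esym : conj_symmetric (ext (u t)) by apply: ext_sym; case: (su t).
rewrite -(fseries_quad L x (l1b_extM u3) esym).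
have lq := quad_lipschitz lu su; set K := C * _ * _ in lq.
apply: (quadratic_half_line (C := 2 * K)) => s s0.
have hT := l1_taylor lq s0 t0.
have hq := l1b_mode L x (qB t).
have h1 := l1b_mode L x (forcing_l1 s); have h2 := l1b_mode L x (forcing_l1 t).
have h3 : l1b (fun n => (s - t)%:C * (quad (ext (u t)) n * fourier_mode L n x))
    (`|s - t| * (2 * Bq)).
  by apply: l1b_mul hq => n; rewrite z1_real.
rewrite -Re_realM -!ReN -!ReD /fseries -(csumZ _ hq) -(csumB h1 h2).
rewrite -(csumB (l1bB h1 h2) h3); apply: le_trans (Re_le_z1 _) _.
rewrite -mulrA; apply: csum_bound; apply: l1b_ext (l1b_mode L x hT) => n.
by rewrite /forcing; ring.
Qed.

End physical_space.

(** * Almost everywhere limits of rapidly convergent sequences *)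

Lemma cvg_square {R : realType} {T : Type} (F : set_system T) {FF : Filter F}
  (h : T -> R) (l : R) : h @ F --> l -> (fun x => h x ^+ 2) @ F --> l ^+ 2.
Proof.
by move=> hl; rewrite expr2 (_ : (fun x => _) = h \* h)//; exact: cvgM.
Qed.

Lemma continuous_square {R : realType} (h : R -> R) :
  continuous h -> continuous (fun x => h x ^+ 2).
Proof. by move=> ch x; apply: cvg_square; exact: ch. Qed.

Section rapid_convergence.
Context {R : realType}.
Notation mu := (@lebesgue_measure R).
Variables (f : nat -> R -> R) (a b c : R).
Hypothesis cf : forall k, continuous (f k).
Hypothesis fc : forall k,
  \int[mu]_(x in `[a, b]) `|f k.+1 x - f k x| <= c / 2 ^+ k.

(** The upper limit is measurable and defined everywhere; where the sequence
    converges it is the limit. *)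
Definition limit_function (x : R) : R := fine (limn_esup (fun k => (f k x)%:E)).

Let g := limit_function.

Lemma bounded_variation_cvg (x : nat -> R) (B : R) :
  (forall k, \sum_(j < k) `|x j.+1 - x j| <= B) ->
  cvgn x /\ forall k, `|x k| <= `|x 0%N| + B.
Proof.
move=> h.
have tel k : x k = x 0%N + \sum_(j < k) (x j.+1 - x j).
  elim: k => [|k IH]; first by rewrite big_ord0 addr0.
  by rewrite big_ord_recr /= addrA -IH addrC subrK.
split; last first.
  move=> k; rewrite tel; apply: le_trans (ler_normD _ _) _; rewrite lerD2l.
  exact: le_trans (ler_norm_sum _ _ _) (h k).
have c1 : cvgn (fun k => \sum_(j < k) `|x j.+1 - x j|).
  apply: nondecreasing_is_cvgn; last by exists B => _ [k _ <-].
  move=> n m /subnKC <-; elim: (m - n)%N => [|k IH]; first by rewrite addn0.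
  by rewrite addnS big_ord_recr /= (le_trans IH)// lerDl.
have c2 : cvgn (fun k => \sum_(j < k) (`|x j.+1 - x j| + (x j.+1 - x j))).
  have p j : 0 <= `|x j.+1 - x j| + (x j.+1 - x j).
    by have := ler_norm (- (x j.+1 - x j)); rewrite normrN; lra.
  apply: nondecreasing_is_cvgn.
    move=> n m /subnKC <-; elim: (m - n)%N => [|k IH]; first by rewrite addn0.
    by rewrite addnS big_ord_recr /= (le_trans IH)// lerDl.
  exists (B + B) => _ [k _ <-]; rewrite big_split /=; apply: lerD; first exact: h.
  by apply: le_trans (h k); apply: ler_sum => j _; exact: ler_norm.
have -> : x = (fun k => x 0%N + (\sum_(j < k) (`|x j.+1 - x j| + (x j.+1 - x j)) -
    \sum_(j < k) `|x j.+1 - x j|)).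
  by apply/funext => k; rewrite big_split /= [in RHS]addrAC subrr add0r -tel.
by apply: is_cvgD; [exact: is_cvg_cst|exact: is_cvgB].
Qed.

Let dev (k : nat) (x : R) : \bar R := `|f k.+1 x - f k x|%:E.
Let G (x : R) : \bar R := (\sum_(0 <= k <oo) dev k x)%E.

Let cont_dev k : continuous (fun x => `|f k.+1 x - f k x|).
Proof. by move=> x; apply: cvg_norm; apply: cvgB; exact: cf. Qed.

Let mdev k : measurable_fun (`[a, b] : set R) (dev k).
Proof.
apply/measurable_EFinP; apply: measurable_funTS.
exact: continuous_measurable_fun.
Qed.

Let integral_dev k : (\int[mu]_(x in `[a, b]) dev k x <= (c / 2 ^+ k)%:E)%E.
Proof.
have i := continuous_integrable_segments (cont_dev (k := k)) a b.
have e : (\int[mu]_(x in `[a, b]) dev k x)%E =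
    (\int[mu]_(x in `[a, b]) `|f k.+1 x - f k x|)%:E.
  by rewrite /Rintegral fineK//; exact: integrable_fin_num.
by rewrite e lee_fin.
Qed.

Let mG : measurable_fun (`[a, b] : set R) G.
Proof. by apply: ge0_emeasurable_sum => // k x _ _; rewrite lee_fin. Qed.

Let G0 x : (0 <= G x)%E.
Proof. by apply: nneseries_ge0 => k _ _; rewrite lee_fin. Qed.

Let intG : mu.-integrable `[a, b] G.
Proof.
apply/integrableP; split; first exact: mG.
under eq_integral do rewrite gee0_abs//.
rewrite integral_nneseries//; last by move=> n x _; rewrite lee_fin.
apply: (@le_lt_trans _ _ (2 * c)%:E); last exact: ltry.
apply: lime_le.
  apply: is_cvg_nneseries => n _ _; apply: integral_ge0 => x _; by rewrite lee_fin.
apply: nearW => n; apply: (@le_trans _ _ (\sum_(0 <= k < n) (c / 2 ^+ k)%:E)%E).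
  by apply: lee_sum => k _; exact: integral_dev.
rewrite sumEFin lee_fin.
suff -> : \sum_(0 <= k < n) c / 2 ^+ k = 2 * c - 2 * (c / 2 ^+ n).
  have c0 : 0 <= c.
    have := fc 0; rewrite expr0 divr1; apply: le_trans.
    by apply: Rintegral_ge0.
  by rewrite gerBl mulr_ge0// divr_ge0 ?exprn_ge0.
elim: n => [|n IH]; first by rewrite big_nil expr0 divr1 subrr.
rewrite big_nat_recr//= IH exprS; field.
by rewrite expf_neq0.
Qed.

Let Gpartial x k : G x \is a fin_num ->
  \sum_(j < k) `|f j.+1 x - f j x| <= fine (G x).
Proof.
move=> Gx; rewrite -lee_fin fineK//.
have h : (\sum_(0 <= j < k) dev j x <= G x)%E.
  by apply: nneseries_lim_ge => j _ _; rewrite lee_fin.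
by apply: le_trans h; rewrite big_mkord sumEFin.
Qed.

Let ae_cvg0 : {ae mu, forall x, a <= x <= b ->
  cvgn (f^~ x) /\ forall k, `|f k x| <= `|f 0 x| + fine (G x)}.
Proof.
have := @integrable_ae _ _ R mu _ (measurable_itv `[a, b]) _ intG.
apply: lebesgue_ae_imply => x hx xab.
have Gx : G x \is a fin_num by apply: hx; rewrite /= in_itv.
by apply: bounded_variation_cvg => k; exact: Gpartial.
Qed.

Lemma limit_function_cvg x : cvgn (f^~ x) -> f^~ x @ \oo --> g x.
Proof.
move=> /cvg_ex[l hl]; have h : (fun k => (f k x)%:E) @ \oo --> l%:E.
  by apply: cvg_EFin => //; exact: nearW.
by rewrite /g /limit_function (cvg_limn_einf_sup h).2.
Qed.

(** The increments have an integrable sum, which is therefore finite almost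
    everywhere. *)
Lemma limit_function_ae : {ae mu, forall x, a <= x <= b -> f^~ x @ \oo --> g x}.
Proof.
by apply: lebesgue_ae_imply ae_cvg0 => x h xab; apply: limit_function_cvg; case: (h xab).
Qed.

Lemma measurable_limit_function : measurable_fun [set: R] g.
Proof.
apply: (@measurableT_comp _ _ _ _ _ _ fine) => //; apply: measurable_fun_limn_esup => k.
by apply/measurable_EFinP; exact: continuous_measurable_fun.
Qed.

(** Dominated convergence; the majorant is [|f 0|] plus the sum of the
    increments. *)
Lemma limit_function_integral x : a <= x <= b ->
  mu.-integrable `[a, b] (EFin \o g) /\
  (fun k => \int[mu]_(t in `[a, x]) f k t) @ \oo --> \int[mu]_(t in `[a, x]) g t.
Proof.
move=> /andP[ax xb].
have key y : a <= y -> y <= b -> mu.-integrable `[a, y] (EFin \o g) /\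
    (fun k => \int[mu]_(t in `[a, y]) f k t) @ \oo --> \int[mu]_(t in `[a, y]) g t.
  move=> ay yb; have sub : [set` `[a, y]] `<=` [set` `[a, b]].
    by apply: subset_itvl; rewrite bnd_simp.
  have iG : mu.-integrable `[a, y] (fun x => `|f 0 x|%:E + G x)%E.
    apply: integrableD => //; last exact: integrableS intG.
    have cn : continuous (fun x => `|f 0 x|) by move=> z; apply: cvg_norm; exact: cf.
    exact: (continuous_integrable_segments cn).
  have mfk k : measurable_fun (`[a, y] : set R) (EFin \o f k).
    by apply/measurable_EFinP; apply: measurable_funTS; exact: continuous_measurable_fun.
  have mg : measurable_fun (`[a, y] : set R) (EFin \o g).
    by apply/measurable_EFinP; apply: measurable_funTS; exact: measurable_limit_function.
  have cv : {ae mu, forall x, [set` `[a, y]] x -> (fun k => (EFin \o f k) x) @ \oo --> (EFin \o g) x}.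
    apply: lebesgue_ae_imply limit_function_ae => z h; rewrite /= in_itv /= => /andP[z1' z2].
    by apply: cvg_EFin; [exact: nearW|apply: h; rewrite z1' (le_trans z2)].
  have bd : {ae mu, forall x, forall n, [set` `[a, y]] x -> (`|(EFin \o f n) x| <= `|f 0 x|%:E + G x)%E}.
    apply: lebesgue_ae_imply ae_cvg0 => z h n; rewrite /= in_itv /= => /andP[z1' z2].
    have [_ hz] := h (introT andP (conj z1' (le_trans z2 yb))).
    have [Gf|] := boolP (G z \is a fin_num).
      by rewrite -(fineK Gf) -EFinD lee_fin.
    by rewrite ge0_fin_numE// -leNgt leye_eq => /eqP ->; rewrite addey// leey.
  have [ig _ lim] := @dominated_convergence _ _ R mu _ (measurable_itv `[a, y]) _ _ _ mfk mg cv iG bd.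
  split=> //; rewrite /Rintegral; apply: fine_cvg.
  by rewrite fineK//; exact: integrable_fin_num.
have [ib _] := key b (le_trans ax xb) (lexx b).
by split=> //; have [] := key x ax xb.
Qed.

(** Fatou's lemma for the squares, whose lower limit is [g ^ 2] almost
    everywhere. *)
Lemma limit_function_square (E : R) :
  (forall k, \int[mu]_(x in `[a, b]) (f k x ^+ 2) <= E) ->
  (\int[mu]_(x in `[a, b]) (g x ^+ 2)%:E <= E%:E)%E.
Proof.
move=> hE.
have cf2 k := continuous_square (cf (k := k)).
have m2 k : measurable_fun (`[a, b] : set R) (fun x => (f k x ^+ 2)%:E).
  by apply/measurable_EFinP; apply: measurable_funTS; exact: continuous_measurable_fun.
have p2 k x : [set` `[a, b]] x -> (0 <= (f k x ^+ 2)%:E)%E.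
  by move=> _; rewrite lee_fin sqr_ge0.
have h := fatou mu (measurable_itv `[a, b]) m2 p2.
have ml : measurable_fun (`[a, b] : set R) (fun x => limn_einf (fun k => (f k x ^+ 2)%:E)).
  apply: (@measurableT_comp _ _ _ _ _ _ -%E) => //.
  by apply: measurable_fun_limn_esup => k; apply: (@measurableT_comp _ _ _ _ _ _ -%E).
have mg2 : measurable_fun (`[a, b] : set R) (fun x => (g x ^+ 2)%:E).
  apply/measurable_EFinP; apply: measurable_funTS; apply: measurable_funX.
  exact: measurable_limit_function.
have eg : ae_eq mu [set` `[a, b]] (fun x => limn_einf (fun k => (f k x ^+ 2)%:E))
    (fun x => (g x ^+ 2)%:E).
  apply: lebesgue_ae_imply limit_function_ae => z hz; rewrite /= in_itv /= => zab.
  have cv : (fun k => (f k z ^+ 2)%:E) @ \oo --> (g z ^+ 2)%:E.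
    apply: cvg_EFin; first exact: nearW.
    by apply: cvg_square; exact: hz.
  exact: (cvg_limn_einf_sup cv).1.
rewrite -(@ae_eq_integral _ _ R mu _ _ _ (measurable_itv `[a, b]) ml mg2 eg).
apply: le_trans h _; rewrite limn_einf_lim; apply: lime_le; first exact: is_cvg_einfs.
apply: nearW => k; apply: ge_ereal_inf; exists (\int[mu]_(x in `[a, b]) (f k x ^+ 2)%:E)%E.
  by exists k => /=.
have i := continuous_integrable_segments (cf2 k) a b.
rewrite -[leLHS]fineK ?lee_fin; first exact: hE.
exact: integrable_fin_num.
Qed.

End rapid_convergence.

(** * Indefinite integrals and orthogonality of the modes *)

Section almost_everywhere_derivative.
Context {R : realType}.
Notation mu := (@lebesgue_measure R).

(** Lebesgue's differentiation theorem for a function that is only known to be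
    an indefinite integral on one segment. *)
Lemma primitive_ae_derive (g F : R -> R) (a b : R) :
  mu.-integrable `[a, b] (EFin \o g) ->
  (forall x, a <= x <= b -> F x - F a = \int[mu]_(t in `[a, x]) g t) ->
  {ae mu, forall x : R, a < x < b -> is_derive x 1 F (g x)}.
Proof.
move=> ig FE; pose h := g \_ [set` `[a, b]].
have hE (x : R) : a <= x <= b -> h x = g x.
  by move=> xab; rewrite /h patchE mem_set//= in_itv.
have ih : mu.-integrable [set: R] (EFin \o h).
  by rewrite -restrict_EFin; exact: (@integrable_mkcond _ _ R mu _ (EFin \o g) (measurable_itv `[a, b])).1.
have ihy (y : R) : mu.-integrable `[a, y] (EFin \o h).
  exact: integrableS ih.
have lh := integrable_locally (measurable_itv `[a, b]) ig.
apply: lebesgue_ae_imply (FTC1 (a := BLeft a) ihy lh) => x hx /andP[ax xb].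
have [dx ex] := hx ax.
pose H (y : R) := F a + \int[mu]_(t in `[a, y]) h t.
have dH : is_derive x 1 H (g x).
  have e : h x = g x by apply: hE; rewrite (ltW ax) (ltW xb).
  rewrite -e -ex derive1E -[X in is_derive _ _ _ X]add0r.
  exact: is_deriveD (is_derive_cst (F a) x 1) (derivableP dx).
apply: near_eq_is_derive dH.
have xab : x \in `]a, b[ by rewrite in_itv /= ax.
have := near_in_itvoo xab; apply: filterS => y.
rewrite in_itv /= => /andP[ay yb]; rewrite /H.
rewrite (@eq_Rintegral _ _ _ mu _ g) => [|z].
  rewrite -(FE y); last by rewrite (ltW ay) (ltW yb).
  by rewrite addrC subrK.
rewrite inE /= in_itv /= => /andP[az zy]; apply: hE.
by rewrite az (le_trans zy)// ltW.
Qed.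

End almost_everywhere_derivative.

Section parseval.
Context {R : realType}.
Notation mu := (@lebesgue_measure R).
Variable L : R.
Hypothesis L0 : 0 < L.
Implicit Types c v : int -> R[i].
Notation e := (fourier_mode L).

Lemma is_derive_mode (w : R[i]) n (x : R) :
  is_derive x 1 (fun y => complex.Re (w * e n y))
    (complex.Re (w * ('i%C * (freq L n)%:C) * e n x)).
Proof.
have d1 : is_derive x 1 (fun y => freq L n * y) (freq L n).
  have := is_deriveZ (freq L n) (is_derive_id x (1 : R)).
  by rewrite /GRing.scale /= mulr1; apply.
have dc := is_derive1_comp (is_derive_cos (freq L n * x)) d1.
have ds := is_derive1_comp (is_derive_sin (freq L n * x)) d1.
have := is_deriveB (is_deriveZ (complex.Re w) dc) (is_deriveZ (complex.Im w) ds).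
move=> h; apply: (is_derive_congr h) => [y|].
  by rewrite (ReM w (e n y)).
by rewrite /GRing.scale /= /fourier_mode !ReM !ImM /= -/(freq L n); ring.
Qed.

Lemma continuous_mode (w : R[i]) n : continuous (fun y => complex.Re (w * e n y)).
Proof. exact: is_derive_continuous (is_derive_mode w n). Qed.

Lemma is_derive_trig_sum c N (x : R) :
  is_derive x 1 (fun y => complex.Re (bsum (fun n => c n * e n y) N))
    (complex.Re (bsum (fun n => c n * ('i%C * (freq L n)%:C) * e n x) N)).
Proof.
have h := is_derive_bsum N (fun n => is_derive_mode (c n) n x).
by apply: (is_derive_congr h) => [y|]; rewrite Re_bsum.
Qed.

Lemma continuous_trig_sum c N :
  continuous (fun x => complex.Re (bsum (fun n => c n * e n x) N)).
Proof. exact: is_derive_continuous (is_derive_trig_sum c N). Qed.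

Lemma mode_period n (k : nat) : e n (L *+ k) = 1.
Proof.
have -> : e n (L *+ k) = e (n * k%:Z) L.
  rewrite /fourier_mode (_ : 2 * pi / L * n%:~R * (L *+ k) = 2 * pi / L * (n * k%:Z)%:~R * L)//.
  by rewrite intrM -mulr_natr pmulrn; ring.
have e1 : e 1 L = 1.
  rewrite /fourier_mode mulr1 divfK ?gt_eqF// mulr_natl cos2pi.
  by rewrite mulr2n sinDpi sinpi oppr0.
elim/int_ind: (n * k%:Z) => [|m IH|m IH]; first exact: mode0.
- by rewrite intS addrC modeD IH e1 mulr1.
- by rewrite intS opprD addrC modeD IH mul1r mode_conj e1 conjc1.
Qed.

Lemma mode_period_neg n (k : nat) : e n (- (L *+ k)) = 1.
Proof.
have -> : e n (- (L *+ k)) = e (- n) (L *+ k).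
  by rewrite /fourier_mode mulrN mulrNz !(mulrN, mulNr).
exact: mode_period.
Qed.

Lemma Rintegral_mode (w : R[i]) n (k : nat) : n != 0 ->
  \int[mu]_(x in `[- (L *+ k), L *+ k]) complex.Re (w * e n x) = 0.
Proof.
move=> n0; have Lk : - (L *+ k) <= L *+ k.
  by rewrite (@le_trans _ _ 0)// ?oppr_le0 mulrn_wge0// ltW.
have fz := freq_neq0 L0 n0; pose z := w * (- 'i%C * (freq L n)^-1%:C).
have zE : z * ('i%C * (freq L n)%:C) = w.
  rewrite /z -mulrA [X in _ * X](_ : _ = 1) ?mulr1//.
  by apply/eqP; rewrite eq_complex /=; apply/andP; split; apply/eqP; field.
have d (x : R) : is_derive x 1 (fun y => complex.Re (z * e n y)) (complex.Re (w * e n x)).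
  by rewrite -{1}zE; exact: is_derive_mode.
by rewrite (Rintegral_derivative Lk d (@continuous_mode w n)) mode_period mode_period_neg subrr.
Qed.

Lemma bsum_diagonal (V : nmodType) (G : int -> int -> V) N :
  (forall n m, n != m -> G n m = 0) ->
  bsum (fun n => bsum (G n) N) N = bsum (fun n => G n n) N.
Proof.
move=> h; apply: eq_bigr => k _; rewrite /bsum (bigD1 k)//= big1 ?addr0// => j jk.
apply: h; apply: contra jk => /eqP jk; apply/eqP/val_inj => /=; lia.
Qed.

(** Orthogonality of the modes over a whole number of periods; the square of the
    real part is at most the squared modulus. *)
Lemma parseval_le c N (k : nat) :
  \int[mu]_(x in `[- (L *+ k), L *+ k]) (complex.Re (bsum (fun n => c n * e n x) N) ^+ 2) <=
  L *+ k *+ 2 * bsum (fun n => normc (c n) ^+ 2) N.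
Proof.
have Lk : - (L *+ k) <= L *+ k.
  by rewrite (@le_trans _ _ 0)// ?oppr_le0 mulrn_wge0// ltW.
pose z n m := c n * conjc (c m).
have cz n m : continuous (fun x => complex.Re (z n m * e (n - m) x)) by exact: continuous_mode.
have iz n m := continuous_integrable_segments (cz n m).
have i1 n : integrable_segments (fun x => bsum (fun m => complex.Re (z n m * e (n - m) x)) N).
  by move=> a b; exact: (Rintegral_bsum a b N (iz n)).1.
have e2 := (Rintegral_bsum (- (L *+ k)) (L *+ k) N i1).2.
have i2 : integrable_segments
    (fun x => bsum (fun n => bsum (fun m => complex.Re (z n m * e (n - m) x)) N) N).
  by move=> a b; exact: (Rintegral_bsum a b N i1).1.
apply: (@le_trans _ _ (\int[mu]_(x in `[- (L *+ k), L *+ k])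
    bsum (fun n => bsum (fun m => complex.Re (z n m * e (n - m) x)) N) N)).
  apply: le_Rintegral_segments => // [|x].
    exact: continuous_integrable_segments (continuous_square (@continuous_trig_sum c N)).
  have -> : bsum (fun n => bsum (fun m => complex.Re (z n m * e (n - m) x)) N) N =
      complex.Re (bsum (fun n => c n * e n x) N * conjc (bsum (fun n => c n * e n x) N)).
    rewrite mulrC -bsumZ Re_bsum; apply: bsum_eq => n _.
    rewrite -Re_bsum mulrC /bsum rmorph_sum mulr_sumr; congr complex.Re.
    apply: eq_bigr => i _; rewrite modeD mode_conj rmorphM /= /z; ring.
  by rewrite ReM; case: (bsum _ _) => p q /=; nra.
have -> : \int[mu]_(x in `[- (L *+ k), L *+ k])
    bsum (fun n => bsum (fun m => complex.Re (z n m * e (n - m) x)) N) N =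
    bsum (fun n => bsum (fun m => \int[mu]_(x in `[- (L *+ k), L *+ k])
      complex.Re (z n m * e (n - m) x)) N) N.
  by rewrite e2; apply: bsum_eq => n _; exact: (Rintegral_bsum _ _ N (iz n)).2.
rewrite bsum_diagonal => [|n m nm]; last first.
  by apply: Rintegral_mode; rewrite subr_eq0.
rewrite -bsumZ; apply: bsum_le => n _.
rewrite (@eq_Rintegral _ _ _ mu _ (fun=> normc (c n) ^+ 2)) => [|x _].
  rewrite Rintegral_segment_cst// opprK mulrC mulr2n; exact: lexx.
by rewrite subrr mode0 mulr1 /z ReM normc_sq; case: (c n) => p q /=; ring.
Qed.

End parseval.

(** * The derivative of the initial datum *)

Section square_integrable_derivative.
Context {R : realType}.
Notation mu := (@lebesgue_measure R).
Variables (L : R) (phi : int -> R[i]) (A P : R).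
Hypothesis L0 : 0 < L.
Hypothesis phi_l1 : l1b phi A.
Hypothesis phi_energy : forall N, energy N phi <= P.
Notation e := (fourier_mode L).

Lemma bsum_window (V : nmodType) (f : int -> V) N M : (N <= M)%N ->
  bsum (fun n => if (`|n| <= N)%N then f n else 0) M = bsum f N.
Proof.
move=> /subnKC <-; elim: (M - N)%N => [|k IH].
  by rewrite addn0; apply: bsum_eq => n ->.
rewrite addnS bsumS IH !ifN ?addr0//; lia.
Qed.

Let c n : R[i] := phi n * ('i%C * (freq L n)%:C).
Let W := (2 * pi / L) ^+ 2.
Let W0 : 0 <= W. Proof. exact: sqr_ge0. Qed.
Let S N x := complex.Re (bsum (fun n => phi n * e n x) N).
Let D N x := complex.Re (bsum (fun n => c n * e n x) N).

Let normc_c n : normc (c n) ^+ 2 =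
  W * (n%:~R ^+ 2 * normc (phi n) ^+ 2).
Proof.
rewrite /c /W !normc_sq (ReM (phi n)) (ImM (phi n)) ReM ImM /= /freq; ring.
Qed.

Let is_derive_S N (x : R) : is_derive x 1 (S N) (D N x).
Proof. exact: is_derive_trig_sum. Qed.

Let continuous_D N : continuous (D N).
Proof. exact: continuous_trig_sum. Qed.

Let square_D N (k : nat) :
  \int[mu]_(x in `[- (L *+ k), L *+ k]) (D N x ^+ 2) <= L *+ k *+ 2 * (W * P).
Proof.
apply: le_trans (parseval_le L0 c N k) _.
rewrite ler_wpM2l ?mulrn_wge0 ?(ltW L0)// (bsum_eq (fun n _ => normc_c n)) bsumZ.
by rewrite ler_wpM2l//; exact: phi_energy.
Qed.

Let square_DB N M (k : nat) : (N <= M)%N ->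
  \int[mu]_(x in `[- (L *+ k), L *+ k]) ((D M x - D N x) ^+ 2) <=
  L *+ k *+ 2 * (W * (energy M phi - energy N phi)).
Proof.
move=> NM; pose d n : R[i] := if (`|n| <= N)%N then 0 else c n.
have dE x : D M x - D N x = complex.Re (bsum (fun n => d n * e n x) M).
  rewrite /D -ReN -ReD -(bsum_window (fun n => c n * e n x) NM) -bsumB.
  congr complex.Re; apply: bsum_eq => n _; rewrite /d.
  by case: ifP => _; [rewrite subrr mul0r|rewrite subr0].
under eq_Rintegral do rewrite dE.
apply: le_trans (parseval_le L0 d M k) _.
rewrite ler_wpM2l ?mulrn_wge0 ?(ltW L0)// /energy.
rewrite -(bsum_window (fun n => n%:~R ^+ 2 * normc (phi n) ^+ 2) NM).
rewrite -bsumB -bsumZ; apply: bsum_le => n _; rewrite /d.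
by case: ifP => _; rewrite ?ComplexField.Normc.normc0 ?expr0n ?subrr ?mulr0 ?subr0 ?normc_c.
Qed.

(** [N] has to grow so that the partial sums along it converge to the Fourier
    sum; the rate makes the L1 distances of consecutive derivatives geometric in
    [2^-1]. *)
Lemma fast_energy_tail : exists N : nat -> nat, [/\ forall k, (N k <= N k.+1)%N,
  forall k, (k <= N k)%N & forall k M, energy M phi - energy (N k) phi <= 4^-1 ^+ k].
Proof.
have ex k : exists K, forall M, energy M phi - energy K phi <= 4^-1 ^+ k.
  apply: (bsum_tail (B := P)) => [n|//|]; first exact: energy_term_ge0.
  by rewrite exprn_gt0.
have [K hK] := choice ex.
exists (fun k => k + \sum_(j < k.+1) K j)%N; split=> [k|k|k M].
- rewrite (big_ord_recr k.+1) /=; lia.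
- lia.
- apply: le_trans (hK k M); rewrite lerD2l lerN2; apply: energy_mono.
  rewrite big_ord_recr /=; lia.
Qed.

(** The derivatives [f k] of the partial sums of order [N k] converge almost
    everywhere and in L1 on each interval of integer periods, to one and the
    same [g].  Passing to the limit in the fundamental theorem of calculus, the
    Fourier sum is an indefinite integral of [g]. *)
Lemma fourier_sum_ae_derive : exists g : R -> R,
  square_integrable `[0, L] g /\
  {ae mu, forall x : R, is_derive x 1 (fourier_sum L phi) (g x)}.
Proof.
have [N [Nmono Nge Ntail]] := fast_energy_tail.
pose f k := D (N k); have cf k : continuous (f k) := continuous_D (N := N k).
pose B (m : nat) := L *+ m * (1 + W).
have fc m k : \int[mu]_(x in `[- (L *+ m), L *+ m]) `|f k.+1 x - f k x| <= B m / 2 ^+ k.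
  have Lm : 0 <= L *+ m by rewrite mulrn_wge0// ltW.
  have Lm2 : - (L *+ m) <= L *+ m by lra.
  have p2 : 0 < 2 ^+ k :> R by rewrite exprn_gt0.
  have cd : continuous (fun x => f k.+1 x - f k x).
    by move=> z; apply: cvgB; exact: cf.
  have cn : continuous (fun x => `|f k.+1 x - f k x|) by move=> z; apply: cvg_norm; exact: cd.
  have i1 := continuous_integrable_segments cn.
  have i2 := continuous_integrable_segments (continuous_square cd).
  have i3 := integrable_segments_cst ((2 ^+ k)^-1 / 2 : R).
  have i4 : integrable_segments (fun x => 2 ^+ k / 2 * (f k.+1 x - f k x) ^+ 2).
    apply: continuous_integrable_segments => z; apply: cvgM; first exact: cvg_cst.
    exact: continuous_square cd z.
  have i5 : integrable_segments (fun x => (2 ^+ k)^-1 / 2 + 2 ^+ k / 2 * (f k.+1 x - f k x) ^+ 2).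
    by move=> a b; exact: (integrableD _ (i3 a b) (i4 a b)).
  (* [|y| <= 2^-k / 2 + 2^k y^2 / 2] passes from L2 to L1 distances *)
  apply: le_trans (le_Rintegral_segments _ _ i1 i5 _) _.
    move=> x; set y := _ - _; have : 0 <= (2 ^+ k) / 2 * (`|y| - (2 ^+ k)^-1) ^+ 2.
      by rewrite mulr_ge0 ?sqr_ge0// divr_ge0// ltW.
    rewrite -[y ^+ 2]real_normK ?num_real//.
    have -> : 2 ^+ k / 2 * (`|y| - (2 ^+ k)^-1) ^+ 2 =
      (2 ^+ k)^-1 / 2 + 2 ^+ k / 2 * `|y| ^+ 2 - `|y| by field; rewrite gt_eqF.
    by rewrite subr_ge0.
  rewrite (RintegralD _ (i3 _ _) (i4 _ _))//.
  rewrite Rintegral_segment_cst// (RintegralZl (2 ^+ k / 2) _ (i2 _ _))//.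
  have h := le_trans (square_DB m (Nmono k)) (ler_wpM2l _ (ler_wpM2l W0 (Ntail k (N k.+1)))).
  have {}h : \int[mu]_(x in `[- (L *+ m), L *+ m]) ((f k.+1 x - f k x) ^+ 2) <=
    L *+ m *+ 2 * (W * 4^-1 ^+ k) by apply: h; rewrite mulrn_wge0.
  have k2 : 0 <= 2 ^+ k / 2 :> R by rewrite divr_ge0// ltW.
  apply: le_trans (lerD (lexx _) (ler_wpM2l k2 h)) _.
  rewrite (_ : 4^-1 ^+ k = (2 ^+ k)^-1 * (2 ^+ k)^-1 :> R); last first.
    by rewrite -invfM -exprMn -exprVn; congr (_^-1 ^+ _); ring.
  rewrite /B -mulr_natr; apply: eq_ler; field.
  by rewrite gt_eqF.
pose g := limit_function f.
have Ncvg x : (fun k => S (N k) x) @ \oo --> fourier_sum L phi x.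
  have [hS _] := csum_cvg (l1b_mode L x phi_l1).
  have cN : N @ \oo --> \oo.
    move=> Q [M _ MQ]; exists M => // k /= Mk; apply: MQ => /=.
    exact: leq_trans Mk (Nge k).
  rewrite fourier_sumE; exact: cvg_comp cN hS.
exists g; split.
- split; first by apply: measurable_funTS; exact: (measurable_limit_function cf).
  apply: (@le_lt_trans _ _ (L *+ 1 *+ 2 * (W * P))%:E); last exact: ltry.
  apply: le_trans (limit_function_square cf (fc 1%N) (fun k => square_D (N k) 1)).
  apply: ge0_subset_integral => //.
  + apply/measurable_EFinP; apply: measurable_funTS; apply: measurable_funX.
    exact: (measurable_limit_function cf).
  + by move=> x _; rewrite lee_fin sqr_ge0.
  + by apply: subset_itv; rewrite bnd_simp ?mulr1n// oppr_le0 ltW.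
- have ax m : {ae mu, forall x : R, - (L *+ m) < x < L *+ m ->
      is_derive x 1 (fourier_sum L phi) (g x)}.
    set a := - (L *+ m); have Lm : a <= L *+ m.
      by rewrite (@le_trans _ _ 0)// ?oppr_le0 mulrn_wge0// ltW.
    apply: primitive_ae_derive.
      have := limit_function_integral cf (fc m) (x := a); rewrite lexx Lm => h.
      by case: (h isT).
    move=> x xab; have [_ lim] := limit_function_integral cf (fc m) xab.
    have aE k : \int[mu]_(t in `[a, x]) f k t = S (N k) x - S (N k) a.
      apply: Rintegral_derivative; [by case/andP: xab|exact: is_derive_S|exact: cf].
    have {}lim : (fun k => S (N k) x - S (N k) a) @ \oo --> \int[mu]_(t in `[a, x]) g t.
      by move: lim; under eq_cvg do rewrite aE.
    exact: (cvg_unique _ (cvgB (Ncvg x) (Ncvg a)) lim).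
  have := ae_foralln ax; apply: lebesgue_ae_imply => x h.
  have [m hm] : exists m : nat, `|x| < L *+ m.
    exists (Num.bound (`|x| / L)); rewrite -mulr_natl -ltr_pdivrMr//.
    by apply: archi_boundP; rewrite divr_ge0// ltW.
  by apply: (h m); rewrite -ltr_norml.
Qed.

End square_integrable_derivative.

(** * Square integrability and conclusion *)

Section square_integrable_sum.
Context {R : realType}.
Notation mu := (@lebesgue_measure R).

Lemma fseries_bounded_measurable L v A : l1b v A ->
  measurable_fun [set: R] (fun x => complex.Re (fseries L v x)) /\
  forall x, `|complex.Re (fseries L v x)| <= 2 * A.
Proof.
move=> hv; split=> [|x]; last first.
  exact: le_trans (Re_le_z1 _) (csum_bound (l1b_mode L x hv)).
apply: (measurable_fun_cvg
    (h := fun N x => complex.Re (bsum (fun n => v n * fourier_mode L n x) N))) => [N|x _].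
  by apply: continuous_measurable_fun; exact: continuous_trig_sum.
by have [] := csum_cvg (l1b_mode L x hv).
Qed.

Lemma square_integrableD (g h : R -> R) (a b B : R) : square_integrable `[a, b] g ->
  measurable_fun [set: R] h -> (forall x, `|h x| <= B) ->
  square_integrable `[a, b] (fun x => g x + h x).
Proof.
move=> [mg ig] mh hB; have mh' : measurable_fun (`[a, b] : set R) h := measurable_funTS mh.
split; first exact: measurable_funD.
have m1 : measurable_fun (`[a, b] : set R) (fun x => (2 * g x ^+ 2)%:E).
  by apply/measurable_EFinP; apply: measurable_funM => //; exact: measurable_funX.
apply: (@le_lt_trans _ _ (\int[mu]_(x in `[a, b]) ((2 * g x ^+ 2)%:E + (2 * B ^+ 2)%:E))%E).
  apply: ge0_le_integral => //.
  - by move=> x _; rewrite lee_fin sqr_ge0.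
  - by apply/measurable_EFinP; apply: measurable_funX; exact: measurable_funD.
  - exact: emeasurable_funD.
  move=> x _; rewrite -EFinD lee_fin.
  have := hB x; rewrite ler_norml => /andP[h1 h2].
  have : 0 <= (B - h x) * (B + h x) by rewrite mulr_ge0//; lra.
  by have := sqr_ge0 (g x - h x); nra.
rewrite ge0_integralD//.
- rewrite lte_add_pinfty//; last first.
    exact: integrable_lty (integrable_segments_cst (2 * B ^+ 2) a b).
  under eq_integral do rewrite EFinM.
  rewrite ge0_integralZl//; first by rewrite lte_mul_pinfty// lee_fin.
  - by apply/measurable_EFinP; exact: measurable_funX.
  - by move=> x _; rewrite lee_fin sqr_ge0.
- by move=> x _; rewrite lee_fin mulr_ge0// sqr_ge0.
- by move=> x _; rewrite lee_fin mulr_ge0// sqr_ge0.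
Qed.

Lemma half_line_derivative_addl (f : R -> R) (c t l : R) :
  half_line_derivative f t l -> half_line_derivative (fun s => c + f s) t l.
Proof.
move=> h; apply: cvg_trans h; apply: near_eq_cvg; apply: nearW => s /=.
by rewrite opprD addrACA subrr add0r.
Qed.

End square_integrable_sum.

Theorem mainTheorem1 (R : realType) (L : R) (L_gt0 : 0 < L)
    (phi : int -> R[i]) (phi_H : inH phi) (phi_herm : conj_symmetric phi)
    (phi_small : (sumsq_deriv phi < (72^-1 : R)%:E)%E)
    (phi_constraint :
       \int[lebesgue_measure]_(x in `[0, L])
          (fourier_sum L phi x - 3 * fourier_sum L phi x ^+ 2) = 0)
    (phi_mean : plus_root phi) :
  exists u : R -> int -> R[i],
    [/\ generalized_solution L phi u,
        forall v, generalized_solution L phi v ->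
          forall (t : R) (n : int), 0 <= t -> v t n = u t n,
        forall t : R, 0 <= t ->
          {uniform [set: R], fourier_partial L (u t) @ \oo -->
             ((fun x => (fourier_sum L (u t) x)%:C) : R -> R[i]^o)}
      & exists ux : R -> R -> R,
          (forall t : R, 0 <= t -> square_integrable `[0, L] (ux t)) /\
          {ae lebesgue_measure, forall x : R,
             [/\ forall t : R, 0 <= t ->
                   is_derive x 1 (fourier_sum L (u t)) (ux t x),
                 {within `[0, +oo[, continuous (fun t => ux t x)}
               & forall t : R, 0 <= t ->
                   half_line_derivative (fun s => ux s x) t
                     (fourier_sum L (u t) x - 3 * fourier_sum L (u t) x ^+ 2)]}].
Proof.
have phi_energy N : energy N phi <= 72^-1.
  exact: (sumsq_deriv_le phi _).1 (ltW phi_small) N.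
have {}phi_mean := (plus_root_mean phi_herm phi_energy).1 phi_mean.
have small0 := osc_small phi_herm phi_energy.
have [u [C [lu su uE]]] := flow_exists L_gt0 small0.
exists (fun t => ext (u t)); split.
- exact (flow_generalized L_gt0 phi_mean lu su uE).
- move=> v hv t n t0.
  have [y [C' [ly sy yE vE]]] := generalized_flow L_gt0 phi_herm phi_energy phi_mean hv.
  rewrite (vE t t0).
  by rewrite (flow_unique L_gt0 small0 ly lu sy su yE (fun t _ => uE t) t0).
- move=> t _; apply: fourier_uniform (l1b_extM (small_l1 (su t))) _.
  by apply: ext_sym; case: (su t).
have phi_l1 := l1b_extM (small_l1 small0); rewrite (ext_osc phi_mean) in phi_l1.
have [g [sg dg]] := fourier_sum_ae_derive L_gt0 phi_l1 phi_energy.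
exists (fun t x => g x + complex.Re (fseries L (forcing u t) x)); split.
  move=> t _; have [m b] := fseries_bounded_measurable L (forcing_l1 lu su t).
  exact: square_integrableD sg m b.
apply: lebesgue_ae_imply dg => x dx; split.
- move=> t _; apply: (space_derivative L_gt0 lu su uE).
  by rewrite (ext_osc phi_mean).
- apply: continuous_subspaceT => t; apply: cvgD; first exact: cvg_cst.
  exact: (forcing_continuous lu su).
- move=> t t0; apply: half_line_derivative_addl.
  exact: (@time_derivative_forcing _ L _ _ lu su t x t0).
Qed.
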